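(* Let $T\subset\mathbb{R}^d$ be compact, $X=(X(t),t\in T)$ a real-valued centered Gaussian random field with continuous sample paths and covariance $R_X(s,t)$, and let $\xi:[0,1]\to T$ be continuous with $\xi(0)=a$, $\xi(1)=b$. Let $C_X(\xi)=\inf\{EH^2: H\in\mathcal{L},\ w_H(\xi(v))>1 \text{ for all } 0\le v\le1\}$. (i) With $\Psi_{a,b}(u;\xi)=P(X(\xi(v))>u,\ 0\le v\le1)$, $$\lim_{u\to\infty}\frac1{u^2}\log\Psi_{a,b}(u;\xi)=-\frac12C_X(\xi).$$ (ii) $C_X(\xi)=\inf\{EH^2: H\in\mathcal{L},\ E[X(\xi(v))H]\ge1,\ 0\le v\le1\}$, and if the feasible set of this latter problem is nonempty, its infimum is attained at a unique $H_\xi\in\mathcal{L}$. (iii) The set $\mathcal{W}_\xi$ of $\mu\in M_1^+([0,1])$ at which $\min_{\mu\in M_1^+([0,1])}\int_0^1\int_0^1R_X(\xi(u),\xi(v))\mu(du)\mu(dv)$ is attained is a weakly compact convex subset of $M_1^+([0,1])$. Moreover, if the feasible set in (ii) is nonempty, then for every $\mu\in\mathcal{W}_\xi$, $$\mu\big(\{0\le v\le1:\ E[X(\xi(v))H_\xi]>1\}\big)=0.$$ (iv) If the feasible set in (ii) is nonempty, then for every $\varepsilon>0$, $$P\Big(\sup_{0\le v\le1}\Big|\frac1uX(\xi(v))-x_\xi(v)\Big|\ge\varepsilon\ \Big|\ X(\xi(v))>u,\ 0\le v\le1\Big)\to0\quad(u\to\infty),$$ where $x_\xi(v)=E[X(\xi(v))H_\xi]$,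 $0\le v\le 1$.
   Context: $\mathcal{L}$ is the closure in $L^2(P)$ of finite linear combinations $\sum_j a_jX(t_j)$, $t_j\in T$; for $H\in\mathcal{L}$, $w_H(t)=E(X(t)H)$. $M_1^+([0,1])$ is the set of Borel probability measures on $[0,1]$ with the weak topology. $\inf\emptyset=+\infty$. *)

(* Defs.v *)
From HB Require Import structures.
From mathcomp Require Import all_boot all_order all_algebra.
From mathcomp Require Import all_classical all_reals all_analysis.
Set Implicit Arguments. Unset Strict Implicit. Unset Printing Implicit Defensive.
Import Order.TTheory GRing.Theory Num.Theory.
Import numFieldNormedType.Exports.
Local Open Scope classical_set_scope.
Local Open Scope ring_scope.

Section GaussDefs.
Context {R : realType} {d : nat} {dO : measure_display} {Omega : measurableType dO}.
Variable P : probability Omega R.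

Definition lincomb (X : 'rV[R]_d -> Omega -> R) (s : seq (R * 'rV[R]_d)) : Omega -> R :=
  fun w => \sum_(p <- s) p.1 * X p.2 w.

Definition centered_gaussian (Y : Omega -> R) : Prop :=
  measurable_fun setT Y /\
  ((forall A, measurable A -> P (Y @^-1` A) = \d_(0:R) A) \/
   exists s : R, 0 < s /\
     forall A, measurable A -> P (Y @^-1` A) = normal_prob 0 s A).

Definition centered_gaussian_field (T : set 'rV[R]_d) (X : 'rV[R]_d -> Omega -> R) : Prop :=
  forall s : seq (R * 'rV[R]_d), (forall p, p \in s -> T p.2) ->
    centered_gaussian (lincomb X s).

Definition covX (X : 'rV[R]_d -> Omega -> R) (s t : 'rV[R]_d) : R :=
  fine (\int[P]_w (X s w * X t w)%:E)%E.

Definition sqexp (H : Omega -> R) : \bar R := (\int[P]_w ((H w) ^+ 2)%:E)%E.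

Definition wH (X : 'rV[R]_d -> Omega -> R) (H : Omega -> R) (t : 'rV[R]_d) : \bar R :=
  (\int[P]_w (X t w * H w)%:E)%E.

Definition inL (T : set 'rV[R]_d) (X : 'rV[R]_d -> Omega -> R) (H : Omega -> R) : Prop :=
  measurable_fun setT H /\
  exists c : nat -> seq (R * 'rV[R]_d),
    (forall n p, p \in c n -> T p.2) /\
    ((fun n => \int[P]_w ((H w - lincomb X (c n) w) ^+ 2)%:E)%E @ \oo --> 0%E).

End GaussDefs.

Definition lnE {R : realType} (x : \bar R) : \bar R :=
  if x == 0%E then -oo%E else (ln (fine x))%:E.

Record prob01 (R : realType) := Prob01 {
  p01 :> probability R R ;
  p01_supp : p01 `[0%R, 1%R]%classic = 1%E }.

HB.instance Definition _ (R : realType) := gen_eqMixin (prob01 R).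
HB.instance Definition _ (R : realType) := gen_choiceMixin (prob01 R).

Definition C01 (R : realType) := {f : R -> R | {within `[0%R, 1%R]%classic, continuous f}}.

(* mu |-> (f |-> \int f dmu); the weak topology on M_1^+([0,1]) is the
   initial topology of this map into the product (pointwise) topology *)
Definition weak_map (R : realType) (mu : prob01 R) : {ptws C01 R -> R} :=
  fun f => fine (\int[mu]_(x in `[0%R, 1%R]%classic) (proj1_sig f x)%:E)%E.

Definition weakly_compact (R : realType) (W : set (prob01 R)) : Prop :=
  @compact (initial_topology (@weak_map R)) W.

Definition convex_prob01 (R : realType) (W : set (prob01 R)) : Prop :=
  forall mu1 mu2 nu : prob01 R, forall l : R, W mu1 -> W mu2 -> 0 <= l <= 1 ->
    (forall A, measurable A -> nu A = (l%:E * mu1 A + (1 - l)%:E * mu2 A)%E) ->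
    W nu.

Definition energy {R : realType} (K : R -> R -> R) (mu : prob01 R) : \bar R :=
  (\int[mu]_(u in `[0%R, 1%R]%classic) \int[mu]_(v in `[0%R, 1%R]%classic) (K u v)%:E)%E.

(* Main.v *)
(* A Gaussian family indexed by a path xi is studied through the pairing
   <mu, v> -> E[X(xi v) H_mu], where H_mu is the integral of X along xi against a
   probability mu on [0, 1]; E[H_mu^2] is the energy of mu.

   Duality. If m is the minimal energy, attained at mu, moving mu towards a Dirac mass
   gives E[X(xi v) H_mu] >= m for every v, so H_mu / m is feasible when m > 0; conversely a
   feasible H satisfies E[H H_mu] >= 1, hence E[H^2] >= 1 / m by Cauchy-Schwarz, with equality
   only for H = H_mu / m.  If m = 0 nothing is feasible.  Existence of mu and weak
   compactness come from limits along ultrafilters and from the lower semicontinuity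
   E[H_mu^2] >= 2 E[H_mu S] - E[S^2].

   Large deviations. The event {X(xi v) > u for all v} forces H_mu >= u, which gives the
   upper bound exp(-u^2 / (2m)).  For the lower bound take a linear combination S of the
   X(xi v) close to H_mu / m with E[X(xi v) S] >= 1 + k, and split X = (regression on S) +
   (part independent of S): the event contains {S >= u E[S^2]} intersected with an
   independent event of probability at least 1/2.  For the conditional law, the part of X
   independent of H_mu has Gaussian tails by Fernique's theorem, and H_mu > (1 + delta) u
   is exponentially less likely than the conditioning event.

   Independence and Fernique's rotation argument are both reduced to a uniqueness theorem
   for characteristic functions: half-space events of two Gaussian families have the same
   probability as soon as all the expectations of cosines and sines agree. *)
Require Import Defs.
From HB Require Import structures.
From mathcomp Require Import all_boot all_order all_algebra.
From mathcomp Require Import all_classical all_reals all_analysis.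
From mathcomp Require Import measurable_realfun ring lra.
Import Order.TTheory GRing.Theory Num.Theory.
Import numFieldNormedType.Exports.
Local Open Scope classical_set_scope.
Local Open Scope ring_scope.
Set Implicit Arguments.
Unset Strict Implicit.
Unset Printing Implicit Defensive.

(** * The normal law *)

(** The hypothesis gives the law of each finite linear combination: no joint density, no
    independence. Whatever concerns several variables at once is therefore phrased through E cos and
    E sin of linear combinations, which depend on the variance alone; of that function of the
    variance, [gcf], only multiplicativity and continuity are exploited.

    [HZ mu] has two readings: a pathwise integral, which gives event inclusions at every sample
    point, and an L2 limit of Riemann sums, which gives its covariances. The second reading needs
    mean-square continuity of the process; this is extracted from path continuity and from a bound
    on the mass that a normal law of given variance can put near 0.

    Finite combinations are exactly normal, whereas their limits are handled through a
    characteristic function and a Chernoff bound. This is why the lower bound on probabilities runs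
    through a finite combination with a margin, not through H_mu / m itself.

    Events over all v are uncountable intersections. Path continuity brings them down to a countable
    grid, so comparing countable orthants is enough. *)

Section normal_law.
Context {R : realType}.
Local Notation mu := (@lebesgue_measure R).

(** The Radon-Nikodym derivative and the explicit density have the same integral over every
    measurable set, so they agree almost everywhere. *)
Lemma ge0_integral_normal_prob (m s : R) (f : R -> \bar R) :
  measurable_fun [set: R] f -> (forall x, 0 <= f x)%E ->
  (\int[normal_prob m s]_x f x = \int[mu]_x (f x * (normal_pdf m s x)%:E))%E.
Proof.
move=> mf f0.
have dom : normal_prob m s `<< mu by exact: normal_prob_dominates.
rewrite -(Radon_Nikodym_SigmaFinite.change_of_variables dom)//=.
have mg := measurable_int _ (Radon_Nikodym_SigmaFinite.f_integrable dom).
apply: ae_eq_integral => //.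
- exact: emeasurable_funM.
- apply: emeasurable_funM => //; apply/measurable_EFinP.
  exact: measurable_normal_pdf.
- apply: ae_eqe_mul2l; apply: integral_ae_eq => //.
  + exact: Radon_Nikodym_SigmaFinite.f_integrable.
  + by apply/measurable_EFinP; exact: measurable_normal_pdf.
  + by move=> E _ mE; rewrite -Radon_Nikodym_SigmaFinite.f_integral.
Qed.

Lemma ge0_integral_translate (a : R) (f : R -> \bar R) :
  measurable_fun [set: R] f -> (forall x, 0 <= f x)%E ->
  (\int[mu]_x f (a + x)%R = \int[mu]_x f x)%E.
Proof.
move=> mf f0.
have mphi : measurable_fun setT (fun x : measurableTypeR R => (a + x)%R : measurableTypeR R).
  exact: measurable_funD.
rewrite -(ge0_integral_pushforward mphi mu measurableT mf)//.
apply: eq_measure_integral => A mA _.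
apply/esym/lebesgue_measure_unique => //= _ [[x y]] _ <-.
rewrite /pushforward.
have -> : (fun x0 : R => a + x0) @^-1` `]x, y] = `]x - a, y - a]%classic.
  by apply/seteqP; split => z /=; rewrite !in_itv/= => /andP[? ?]; apply/andP; split; lra.
rewrite !lebesgue_measure_itv/= !lte_fin ltrD2r.
by case: ifPn => // _; rewrite -!EFinB; congr EFin; lra.
Qed.

Lemma ge0_integral_reflect (f : R -> \bar R) :
  measurable_fun [set: R] f -> (forall x, 0 <= f x)%E ->
  (\int[mu]_x f (- x)%R = \int[mu]_x f x)%E.
Proof.
move=> mf f0.
have mphi : measurable_fun setT (fun x : measurableTypeR R => (- x)%R : measurableTypeR R).
  exact: measurable_funN.
rewrite -(ge0_integral_pushforward mphi mu measurableT mf)//.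
by apply: eq_measure_integral => A mA _; exact: lebesgue_measureN.
Qed.

(** Bayes factorization: the joint density of a summand and the sum is the density of the sum at [z]
    times the conditional density of the summand, normal with mean z a^2 / c^2 and deviation a b /
    c. *)
Lemma normal_pdf_convol (a b x z : R) : 0 < a -> 0 < b ->
  let c := Num.sqrt (a ^+ 2 + b ^+ 2) in
  normal_pdf 0 a x * normal_pdf 0 b (- x + z) =
  normal_pdf 0 c z * normal_pdf (z * (a / c) ^+ 2) (a * b / c) x.
Proof.
move=> a0 b0 c.
have c2 : c ^+ 2 = a ^+ 2 + b ^+ 2 by rewrite sqr_sqrtr// addr_ge0// sqr_ge0.
have c0 : 0 < c by rewrite sqrtr_gt0 addr_gt0// exprn_gt0.
have d0 : 0 < a * b / c by rewrite divr_gt0// mulr_gt0.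
rewrite !normal_pdfE ?gt_eqF//.
rewrite /normal_fun mulrACA [RHS]mulrACA -!expRD.
congr (_ * expR _).
  rewrite /normal_peak -!invfM -!sqrtrM; last 2 first.
  - by rewrite mulrn_wge0// mulr_ge0 ?sqr_ge0 ?pi_ge0.
  - by rewrite mulrn_wge0// mulr_ge0 ?sqr_ge0 ?pi_ge0.
  congr (_^-1); congr Num.sqrt.
  by field; rewrite gt_eqF.
rewrite !subr0 -mulr_natl -[in X in _ + X]mulr_natl -[in RHS](mulr_natl (c ^+ 2)).
rewrite -[in X in _ = _ + X]mulr_natl.
rewrite !exprMn exprVn c2; field.
by rewrite -c2 !gt_eqF ?exprn_gt0.
Qed.

End normal_law.

Section probability_integral.
Context {R : realType} {d : measure_display} {T : measurableType d}.
Variable P : probability T R.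
Implicit Types f g : T -> R.

Lemma bounded_integrable f (M : R) :
  measurable_fun setT f -> (forall x, `|f x| <= M) ->
  P.-integrable setT (EFin \o f).
Proof.
move=> mf fM; apply: measurable_bounded_integrable => //.
  by rewrite (le_lt_trans (probability_le1 P measurableT))// ltry.
exists M; split => [|N MN x _]; first exact: num_real.
exact: le_trans (fM x) (ltW MN).
Qed.

Lemma EFin_Rintegral f : P.-integrable setT (EFin \o f) ->
  (\int[P]_x (f x)%:E)%E = (\int[P]_x f x)%:E.
Proof. by move=> fi; rewrite /Rintegral fineK//; exact: integrable_fin_num. Qed.

Lemma integrable_radd f g : P.-integrable setT (EFin \o f) ->
  P.-integrable setT (EFin \o g) -> P.-integrable setT (EFin \o (fun x => f x + g x)).
Proof. by move=> fi gi; exact: (integrableD measurableT fi gi). Qed.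

Lemma integrable_rsub f g : P.-integrable setT (EFin \o f) ->
  P.-integrable setT (EFin \o g) -> P.-integrable setT (EFin \o (fun x => f x - g x)).
Proof. by move=> fi gi; exact: (integrableB measurableT fi gi). Qed.

Lemma integrable_rscale (r : R) f : P.-integrable setT (EFin \o f) ->
  P.-integrable setT (EFin \o (fun x => r * f x)).
Proof. by move=> fi; exact: (integrableZl measurableT r fi). Qed.

Lemma Rintegral_cst1 (r : R) : \int[P]_x r = r.
Proof.
rewrite Rintegral_cst// -[RHS]mulr1; congr (r * _).
exact: (congr1 fine (probability_setT P)).
Qed.

End probability_integral.

Lemma measurable_cos {R : realType} : measurable_fun setT (@cos R).
Proof. by apply: continuous_measurable_fun; exact: continuous_cos. Qed.

Lemma measurable_sin {R : realType} : measurable_fun setT (@sin R).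
Proof. by apply: continuous_measurable_fun; exact: continuous_sin. Qed.

Section convolution_cos.
Context {R : realType}.
Local Notation mR := (measurableTypeR R).
Variables Pa Pb Pc : probability mR R.

(** The convolution identity concerns nonnegative integrands, so it is applied to 1 + cos; the sine
    term of the addition formula dies with the sine integral of [Pb]. *)
Lemma convol_cos : \int[Pb]_x sin x = 0 ->
  (forall f : R -> \bar R, measurable_fun [set: R] f -> (forall x, 0 <= f x)%E ->
    (\int[Pc]_z f z = \int[Pa]_x \int[Pb]_y f (x + y)%R)%E) ->
  \int[Pc]_x cos x = \int[Pa]_x cos x * \int[Pb]_x cos x.
Proof.
move=> sin0 conv.
have mc : measurable_fun setT (@cos R).
  exact: measurable_cos.
have msi : measurable_fun setT (@sin R).
  exact: measurable_sin.
have i1 (Q : probability mR R) : Q.-integrable setT (EFin \o (fun x : R => 1)).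
  by apply: (@bounded_integrable _ _ _ _ _ 1) => // x; rewrite normr1.
have ic (Q : probability mR R) : Q.-integrable setT (EFin \o @cos R).
  by apply: (@bounded_integrable _ _ _ _ _ 1) => // x; exact: cos_max.
have isn (Q : probability mR R) : Q.-integrable setT (EFin \o @sin R).
  by apply: (@bounded_integrable _ _ _ _ _ 1) => // x; exact: sin_max.
have icr (Q : probability mR R) r : Q.-integrable setT (EFin \o (fun x => r * cos x)).
  apply: (@bounded_integrable _ _ _ _ _ `|r|) => // [|x]; first exact: measurable_funM.
  by rewrite normrM ler_piMr// cos_max.
have isr (Q : probability mR R) r : Q.-integrable setT (EFin \o (fun x => r * sin x)).
  apply: (@bounded_integrable _ _ _ _ _ `|r|) => // [|x]; first exact: measurable_funM.
  by rewrite normrM ler_piMr// sin_max.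
have i1c (Q : probability mR R) r : Q.-integrable setT (EFin \o (fun x => 1 + r * cos x)).
  apply: (@bounded_integrable _ _ _ _ _ (1 + `|r|)) => [|x].
    by apply: measurable_funD => //; exact: measurable_funM.
  by rewrite (le_trans (ler_normD _ _))// normr1 lerD2l normrM ler_piMr// cos_max.
have i1c' (Q : probability mR R) : Q.-integrable setT (EFin \o (fun x => 1 + cos x)).
  by have := i1c Q 1; under eq_fun do rewrite mul1r.
have : (\int[Pc]_z (1 + cos z)%:E = \int[Pa]_x (1 + (\int[Pb]_x cos x) * cos x)%:E)%E.
  rewrite [LHS]conv; last 2 first.
  - by apply/measurable_EFinP; exact: measurable_funD.
  - by move=> x; rewrite lee_fin.
  apply: eq_integral => x _.
  rewrite EFin_Rintegral/=; last first.
    apply: (@bounded_integrable _ _ _ _ _ (1 + 1)) => [|y].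
      apply: measurable_funD => //; apply: measurableT_comp => //.
      exact: measurable_funD.
    by rewrite (le_trans (ler_normD _ _))// normr1 lerD2l cos_max.
  congr EFin.
  under eq_Rintegral do rewrite cosD addrA.
  rewrite RintegralB; [|exact: measurableT|exact: i1c|exact: isr].
  rewrite RintegralD; [|exact: measurableT|exact: i1|exact: icr].
  rewrite RintegralZl; [|exact: measurableT|exact: ic].
  rewrite RintegralZl; [|exact: measurableT|exact: isn].
  by rewrite sin0 mulr0 subr0 Rintegral_cst1 mulrC.
rewrite (EFin_Rintegral (i1c' Pc)) (EFin_Rintegral (i1c Pa _)) => -[].
rewrite RintegralD; [|exact: measurableT|exact: i1|exact: ic].
rewrite RintegralD; [|exact: measurableT|exact: i1|exact: icr].
rewrite RintegralZl; [|exact: measurableT|exact: ic].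
by rewrite !Rintegral_cst1 => /addrI ->; rewrite mulrC.
Qed.

End convolution_cos.

Definition cnormal {R : realType} (s : R) : probability (measurableTypeR R) R :=
  [the probability _ _ of normal_prob 0 s].

Lemma ge0_integral_cnormal {R : realType} (s : R) (f : R -> \bar R) :
  measurable_fun [set: R] f -> (forall x, 0 <= f x)%E ->
  (\int[cnormal s]_x f x =
   \int[lebesgue_measure]_x (f x * (normal_pdf 0 s x)%:E))%E.
Proof. by move=> mf f0; rewrite /cnormal; exact: ge0_integral_normal_prob. Qed.

Section normal_moments.
Context {R : realType}.
Local Notation N := (@cnormal R).

(** Tonelli and a translation by the first summand reduce the claim to the factorization of
    densities. *)
Lemma ge0_integral_normal_convol (a b : R) (f : R -> \bar R) :
  0 < a -> 0 < b -> measurable_fun [set: R] f -> (forall x, 0 <= f x)%E ->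
  (\int[N (Num.sqrt (a ^+ 2 + b ^+ 2))]_z f z =
   \int[N a]_x \int[N b]_y f (x + y)%R)%E.
Proof.
move=> a0 b0 mf f0; set c := Num.sqrt _.
have mp s : measurable_fun [set: R] (EFin \o normal_pdf 0 s).
  by apply/measurable_EFinP; exact: measurable_normal_pdf.
have mpf m s : measurable_fun [set: R] (fun x => (normal_pdf m s x)%:E).
  by apply/measurable_EFinP; exact: measurable_normal_pdf.
have p0 m s (x : R) : (0 <= (normal_pdf m s x)%:E)%E by rewrite lee_fin normal_pdf_ge0.
rewrite [LHS](ge0_integral_cnormal _ mf f0).
pose g (xz : R * R) := (f xz.2 * (normal_pdf 0 b (- xz.1 + xz.2))%:E
   * (normal_pdf 0 a xz.1)%:E)%E.
have mg : measurable_fun setT g.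
  apply: emeasurable_funM; last exact: (measurableT_comp (mp a) measurable_fst).
  apply: emeasurable_funM; first exact: (measurableT_comp mf measurable_snd).
  apply: (measurableT_comp (mp b)).
  by apply: measurable_funD => //; exact: measurable_funN.
have g0 z : (0 <= g z)%E by rewrite /g !mule_ge0.
have E1 : (\int[lebesgue_measure]_x (f x * (normal_pdf 0 c x)%:E) =
   \int[lebesgue_measure]_z \int[lebesgue_measure]_x g (x, z))%E.
  apply: eq_integral => z _.
  (* The conditional density is inserted here; its integral in [x] is 1. *)
  transitivity (f z * (normal_pdf 0 c z)%:E *
      \int[lebesgue_measure]_x (normal_pdf (z * (a / c) ^+ 2) (a * b / c) x)%:E)%E.
    by rewrite integral_normal_pdf mule1.
  rewrite -ge0_integralZl; [|exact: measurableT|exact: mpf|by move=> x _; exact: p0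
    |by rewrite mule_ge0].
  apply: eq_integral => x _; rewrite /g/= -!muleA -!EFinM; congr (_ * _%:E)%E.
  by rewrite [RHS]mulrC [RHS](normal_pdf_convol x z a0 b0).
rewrite E1; transitivity (\int[lebesgue_measure]_x \int[lebesgue_measure]_z g (x, z))%E.
  by apply/esym/fubini_tonelli; [exact: mg|exact: g0].
have mshift x : measurable_fun [set: R] (fun y : R => f (x + y)%R).
  by apply: (measurableT_comp mf); exact: measurable_funD.
have mF : measurable_fun [set: R] (fun x => \int[N b]_y f (x + y)%R)%E.
  apply: (measurable_fun_fubini_tonelli_F (m2 := N b)
    (fun xy : R * R => f (xy.1 + xy.2)%R)) => //.
  by apply: (measurableT_comp mf); exact: measurable_funD.
rewrite [RHS]ge0_integral_cnormal; [|exact: mF|by move=> x; exact: integral_ge0].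
apply: eq_integral => x _.
have -> : (\int[N b]_y f (x + y)%R =
    \int[lebesgue_measure]_y (f (x + y)%R * (normal_pdf 0 b y)%:E))%E.
  by apply: ge0_integral_cnormal => [|y]; [exact: mshift|exact: f0].
rewrite -ge0_integralZr; [|exact: measurableT| |by move=> y _; rewrite mule_ge0
  |exact: p0]; last first.
  by apply: emeasurable_funM; [exact: mshift|exact: mp].
rewrite -[LHS](ge0_integral_translate x).
- by apply: eq_integral => z _; rewrite /g/= addKr.
- apply: emeasurable_funM; last exact: (@measurable_cst _ _ _ _ _ (normal_pdf 0 a x)%:E).
  apply: emeasurable_funM; first exact: mf.
  have mm : measurable_fun [set: R] (fun y : R => - x + y) by exact: measurable_funD.
  exact: (measurableT_comp (mp b) mm).
- by move=> y; rewrite !mule_ge0.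
Qed.

(** Multiplying by exp(t x) recentres the density at t s^2, up to a constant factor. *)
Lemma normal_mgf (s t : R) : 0 < s ->
  (\int[N s]_x (expR (t * x))%:E = (expR (t ^+ 2 * s ^+ 2 / 2))%:E)%E.
Proof.
move=> s0; rewrite [LHS]ge0_integral_cnormal; last 2 first.
- apply/measurable_EFinP; apply: measurableT_comp => //; exact: measurable_funM.
- by move=> x; rewrite lee_fin expR_ge0.
transitivity ((expR (t ^+ 2 * s ^+ 2 / 2))%:E *
    \int[lebesgue_measure]_x (normal_pdf (t * s ^+ 2) s x)%:E)%E; last first.
  by rewrite integral_normal_pdf mule1.
rewrite -ge0_integralZl; last 4 first.
- exact: measurableT.
- by apply/measurable_EFinP; exact: measurable_normal_pdf.
- by move=> x _; rewrite lee_fin normal_pdf_ge0.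
- by rewrite lee_fin expR_ge0.
apply: eq_integral => x _; rewrite -!EFinM; congr EFin.
rewrite !normal_pdfE ?gt_eqF// /normal_fun [LHS]mulrCA [RHS]mulrCA -!expRD.
congr (_ * expR _); rewrite -mulr_natl; field.
by rewrite gt_eqF.
Qed.

(** The density is even. Reflection is applied to 1 + sin, which is nonnegative. *)
Lemma normal_sin0 (s : R) : 0 < s -> \int[N s]_x sin x = 0.
Proof.
move=> s0.
have ms : measurable_fun setT (@sin R).
  exact: measurable_sin.
have iS : (N s).-integrable setT (EFin \o @sin R).
  by apply: (@bounded_integrable _ _ _ _ _ 1) => // x; exact: sin_max.
have iN : (N s).-integrable setT (EFin \o (fun x => sin (- x))).
  apply: (@bounded_integrable _ _ _ _ _ 1) => // [|x]; last exact: sin_max.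
  by apply: measurableT_comp => //; exact: measurable_funN.
have i1 : (N s).-integrable setT (EFin \o (fun x : R => 1)).
  by apply: (@bounded_integrable _ _ _ _ _ 1) => // x; rewrite normr1.
have : \int[N s]_x (1 + sin x) = \int[N s]_x (1 + sin (- x)).
  rewrite /Rintegral; congr fine.
  rewrite [LHS]ge0_integral_cnormal; last 2 first.
  - by apply/measurable_EFinP; apply: measurable_funD.
  - by move=> x; rewrite lee_fin.
  rewrite [RHS]ge0_integral_cnormal; last 2 first.
  - apply/measurable_EFinP; apply: measurable_funD => //.
    by apply: measurableT_comp => //; exact: measurable_funN.
  - by move=> x; rewrite lee_fin.
  rewrite -[LHS]ge0_integral_reflect; last 2 first.
  - apply: emeasurable_funM; apply/measurable_EFinP; last exact: measurable_normal_pdf.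
    exact: measurable_funD.
  - by move=> x; rewrite mule_ge0// lee_fin// normal_pdf_ge0.
  apply: eq_integral => x _; congr (_ * _%:E)%E.
  by rewrite !normal_pdfE ?gt_eqF// /normal_fun !subr0 sqrrN.
rewrite !RintegralD//.
under [X in _ = _ + X]eq_Rintegral do rewrite sinN -mulN1r.
rewrite RintegralZl//; lra.
Qed.

(* The characteristic function of the centered normal law, as a function of
   the variance; its multiplicativity replaces the closed form exp(-v/2). *)
Definition gcf (v : R) : R :=
  if v == 0 then 1 else \int[N (Num.sqrt v)]_x cos x.

Lemma gcf0 : gcf 0 = 1. Proof. by rewrite /gcf eqxx. Qed.

Lemma gcfD (v w : R) : 0 <= v -> 0 <= w -> gcf (v + w) = gcf v * gcf w.
Proof.
rewrite le_eqVlt => /predU1P[<-|v0]; first by rewrite add0r gcf0 mul1r.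
rewrite le_eqVlt => /predU1P[<-|w0]; first by rewrite addr0 gcf0 mulr1.
rewrite /gcf !gt_eqF ?addr_gt0//.
have -> : v + w = Num.sqrt v ^+ 2 + Num.sqrt w ^+ 2 by rewrite !sqr_sqrtr// ltW.
apply: convol_cos; first by apply: normal_sin0; rewrite sqrtr_gt0.
by move=> f mf f0; apply: ge0_integral_normal_convol => //; rewrite sqrtr_gt0.
Qed.

End normal_moments.

Section normal_second_moment.
Context {R : realType}.
Local Notation N := (@cnormal R).

Lemma expR_norm_le (x : R) : expR `|x| <= expR x + expR (- x).
Proof. by have [_|_] := ger0P x; rewrite ?lerDl ?lerDr expR_ge0. Qed.

(** With z = |y|, the second difference is the square of e^(z/2) - e^(-z/2), which 1 + x <= e^x
    alone pins between z e^(-z/2) and z e^(z/2). *)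
Lemma expR_second_difference (y : R) :
  `|expR y + expR (- y) - 2 - y ^+ 2| <= `|y| ^+ 3 * expR `|y|.
Proof.
set z := `|y|.
have z0 : 0 <= z by exact: normr_ge0.
have -> : expR y + expR (- y) = expR z + expR (- z).
  by rewrite /z; have [//|_] := ger0P y; rewrite opprK addrC.
rewrite -[y ^+ 2]real_normK ?num_real// -/z.
set a := expR (z / 2); set b := expR (- (z / 2)).
have ab : a * b = 1 by rewrite -expRD subrr expR0.
have a2 : expR z = a ^+ 2 by rewrite -expRM_natl; congr expR; lra.
have b2 : expR (- z) = b ^+ 2 by rewrite -expRM_natl; congr expR; lra.
have a0 : 0 < a by exact: expR_gt0.
have b0 : 0 < b by exact: expR_gt0.
have lo1 : z * b <= a - b.
  have : 1 + z <= expR z by exact: expR_ge1Dx.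
  by rewrite a2 => h; have := ler_wpM2r (ltW b0) h; nra.
have hi1 : a - b <= z * a.
  have : 1 - z <= expR (- z) by exact: expR_ge1Dx.
  by rewrite b2 => h; have := ler_wpM2r (ltW a0) h; nra.
have D2 : expR z + expR (- z) - 2 = (a - b) ^+ 2 by rewrite a2 b2; nra.
have zb0 : 0 <= z * b by rewrite mulr_ge0// ltW.
have lo2 : z ^+ 2 * expR (- z) <= expR z + expR (- z) - 2.
  by rewrite D2 b2 -exprMn ler_sqr// nnegrE; lra.
have hi2 : expR z + expR (- z) - 2 <= z ^+ 2 * expR z.
  by rewrite D2 a2 -exprMn ler_sqr// nnegrE; nra.
have k1 : 1 - expR (- z) <= z by have := expR_ge1Dx (- z); lra.
have e1 : 1 <= expR z by rewrite -expR0 ler_expR.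
have k2 : expR z - 1 <= z * expR z by nra.
have z2 : 0 <= z ^+ 2 by exact: sqr_ge0.
have z3 : z ^+ 3 = z ^+ 2 * z by rewrite exprSr.
have := ler_wpM2l z2 k1; have := ler_wpM2l z2 k2.
have : 0 <= z ^+ 2 * z by rewrite mulr_ge0.
rewrite ler_norml z3 -!mulrA => m0 m1 m2.
apply/andP; split; last lra.
have : z ^+ 2 * z <= z ^+ 2 * (z * expR z) by rewrite ler_wpM2l// ler_peMr.
lra.
Qed.

Lemma normal_expR_integrable (s t : R) : 0 < s ->
  (N s).-integrable setT (EFin \o (fun x => expR (t * x))).
Proof.
move=> s0; apply/integrableP; split.
  by apply/measurable_EFinP; apply: measurableT_comp => //; exact: measurable_funM.
under eq_integral do rewrite /= ger0_norm ?expR_ge0//.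
by rewrite normal_mgf// ltry.
Qed.

Lemma expR_norm3 (x : R) : `|x| ^+ 3 <= 6 * expR `|x|.
Proof.
have := @expR_ge1Dxn R `|x| 2 (normr_ge0 x).
by rewrite (_ : (3`!)%:R = 6 :> R)//; lra.
Qed.

Lemma normal_sqr_integrable (s : R) : 0 < s ->
  (N s).-integrable setT (EFin \o (fun x => x ^+ 2)).
Proof.
move=> s0.
apply: (@le_integrable _ _ _ (N s) _ measurableT _
  (EFin \o (fun x => 2 * (expR (1 * x) + expR (- 1 * x))))).
- by apply/measurable_EFinP; exact: measurable_funX.
- move=> x _ /=; rewrite lee_fin ger0_norm ?sqr_ge0// ger0_norm; last first.
    by rewrite mulr_ge0// addr_ge0// expR_ge0.
  rewrite mul1r mulN1r -[x ^+ 2]real_normK ?num_real//.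
  have := @expR_ge1Dxn R `|x| 1 (normr_ge0 x).
  rewrite (_ : (2`!)%:R = 2 :> R)//.
  have := expR_norm_le x; lra.
- have -> : EFin \o (fun x : R => 2 * (expR (1 * x) + expR (-1 * x))) =
     (fun x => 2%:E * ((EFin \o (fun x => expR (1 * x))) \+
        (EFin \o (fun x => expR (-1 * x)))) x)%E by [].
  by apply: integrableZl => //; apply: integrableD => //; exact: normal_expR_integrable.
Qed.

(** The Laplace transform is known in closed form, and the variance is the limit of its symmetric
    second difference quotient at 0; exponential moments control the cubic remainder. *)
Lemma normal_second_moment (s : R) : 0 < s -> \int[N s]_x (x ^+ 2) = s ^+ 2.
Proof.
move=> s0; set V := Rintegral _ _ _.
have ie t := normal_expR_integrable t s0.
have Ee t : \int[N s]_x expR (t * x) = expR (t ^+ 2 * s ^+ 2 / 2).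
  by rewrite /Rintegral normal_mgf.
have i1 (r : R) : (N s).-integrable setT (EFin \o (fun x : R => r)).
  by apply: (@bounded_integrable _ _ _ _ _ `|r|) => // x; rewrite normr1.
have i2 := normal_sqr_integrable s0.
(* First term: the integral of 6 (e^(2x) + e^(-2x)), which dominates the cubic remainder when t <=
   1. Second term: twice the bound on e^h - 1 - h, where h = t^2 s^2 / 2. *)
pose C := 12 * expR (2 * s ^+ 2) + s ^+ 4 * expR (s ^+ 2 / 2) / 2.
have C0 : 0 <= C by rewrite addr_ge0 ?mulr_ge0 ?expR_ge0 ?exprn_ge0// ltW.
suff H t : 0 < t -> t <= 1 -> `|V - s ^+ 2| <= t * C.
  apply/eqP; rewrite -subr_eq0 -normr_le0 leNgt; apply/negP => V0.
  set D := `|V - s ^+ 2| in H V0.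
  pose t := Num.min 1 (D / (2 * (C + 1))).
  have t0 : 0 < t by rewrite lt_min ltr01 divr_gt0//; lra.
  have t1 : t <= 1 by rewrite ge_min lexx.
  have tD : t <= D / (2 * (C + 1)) by rewrite ge_min lexx orbT.
  have := H _ t0 t1; apply/negP; rewrite -ltNge.
  have : t * (2 * (C + 1)) <= D by rewrite -ler_pdivlMr//; lra.
  nra.
move=> t0 t1.
have id2 : (N s).-integrable setT (EFin \o (fun x => expR (t * x) + expR (- t * x))).
  by exact: integrable_radd.
have id : (N s).-integrable setT
    (EFin \o (fun x => expR (t * x) + expR (- t * x) - 2)).
  by exact: integrable_rsub.
have it2 : (N s).-integrable setT (EFin \o (fun x => t ^+ 2 * x ^+ 2)).
  by exact: integrable_rscale.
have idd : (N s).-integrable setT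
    (EFin \o (fun x => expR (t * x) + expR (- t * x) - 2 - t ^+ 2 * x ^+ 2)).
  by exact: integrable_rsub.
have id3 : (N s).-integrable setT
    (EFin \o (fun x => expR (2 * x) + expR (- 2 * x))).
  by exact: integrable_radd.
have id4 : (N s).-integrable setT
    (EFin \o (fun x => (6 * t ^+ 3) * (expR (2 * x) + expR (- 2 * x)))).
  by exact: integrable_rscale.
have h1 : `|\int[N s]_x (expR (t * x) + expR (- t * x) - 2 - t ^+ 2 * x ^+ 2)|
    <= \int[N s]_x ((6 * t ^+ 3) * (expR (2 * x) + expR (- 2 * x))).
  apply: (le_trans (le_normr_Rintegral measurableT idd)).
  apply: le_Rintegral => //; first exact: integrable_norm.
  move=> x _.
  have -> : `|expR (t * x) + expR (- t * x) - 2 - t ^+ 2 * x ^+ 2| =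
      `|expR (t * x) + expR (- (t * x)) - 2 - (t * x) ^+ 2| by rewrite mulNr exprMn.
  apply: (le_trans (expR_second_difference (t * x))).
  rewrite normrM (gtr0_norm t0) exprMn.
  have -> : t ^+ 3 * `|x| ^+ 3 * expR (t * `|x|) = t ^+ 3 * (`|x| ^+ 3 * expR (t * `|x|)).
    by rewrite -mulrA.
  have -> : 6 * t ^+ 3 * (expR (2 * x) + expR (- 2 * x)) =
      t ^+ 3 * (6 * (expR (2 * x) + expR (- 2 * x))).
    by rewrite -mulrA mulrCA.
  apply: ler_wpM2l; first by rewrite exprn_ge0// ltW.
  have h : expR (t * `|x|) <= expR `|x| by rewrite ler_expR ler_piMl.
  apply: (le_trans (ler_wpM2l (exprn_ge0 3 (normr_ge0 x)) h)).
  apply: (le_trans (ler_wpM2r (expR_ge0 `|x|) (expR_norm3 x))).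
  rewrite -mulrA ler_wpM2l// -expRD -[X in X <= _]ger0_norm ?expR_ge0//.
  have -> : `|x| + `|x| = `|2 * x| by rewrite normrM (ger0_norm (ler0n _ 2)); lra.
  by rewrite mulNr ger0_norm ?expR_ge0//; exact: expR_norm_le.
move: h1; rewrite RintegralB// RintegralB// RintegralD// RintegralZl// RintegralZl//.
rewrite RintegralD// !Ee Rintegral_cst1 !sqrrN -/V.
set h := t ^+ 2 * s ^+ 2 / 2.
have h0 : 0 <= h by rewrite /h divr_ge0// mulr_ge0// sqr_ge0.
have k1 : h <= expR h - 1 by have := expR_ge1Dx h; lra.
have k2 : expR h - 1 - h <= h ^+ 2 * expR h.
  have q1 : 1 - h <= expR (- h) by have := expR_ge1Dx (- h); lra.
  have q2 : expR h * expR (- h) = 1 by rewrite -expRD subrr expR0.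
  have q4 : expR h - 1 <= h * expR h by nra.
  by rewrite expr2; nra.
have t20 : 0 < t ^+ 2 by rewrite exprn_gt0.
have k3 : expR h <= expR (s ^+ 2 / 2).
  rewrite ler_expR /h -mulrA ler_piMl//; last by rewrite expr_le1// ltW.
  by rewrite divr_ge0// sqr_ge0.
have e22 : 2 ^+ 2 * s ^+ 2 / 2 = 2 * s ^+ 2 :> R by field.
rewrite e22; set E := expR (2 * _); set F := expR (s ^+ 2 / 2) in k3 *.
have F0 : 0 <= F by exact: expR_ge0.
have k4 : h ^+ 2 * expR h <= h ^+ 2 * F by rewrite ler_wpM2l// sqr_ge0.
have k5 : h ^+ 2 * F = t ^+ 2 * (t ^+ 2 * (s ^+ 4 * F / 4)).
  by rewrite /h; field.
have k6 : t ^+ 2 * (s ^+ 4 * F / 4) <= t * (s ^+ 4 * F / 4).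
  rewrite ler_wpM2r//; last by rewrite expr2 ler_piMl// ltW.
  by rewrite divr_ge0// mulr_ge0// exprn_ge0// ltW.
have k7 : t ^+ 2 * (t ^+ 2 * (s ^+ 4 * F / 4)) <= t ^+ 2 * (t * (s ^+ 4 * F / 4)).
  by rewrite ler_wpM2l// ltW.
have k8 : 2 * h = t ^+ 2 * s ^+ 2 by rewrite /h; field.
have t3 : t ^+ 3 = t ^+ 2 * t by rewrite exprSr.
rewrite ler_norml t3 => /andP[l1 l2].
rewrite -(ler_pM2l t20) -[X in X * `|_|](gtr0_norm t20) -normrM mulrBr ler_norml.
rewrite /C -/E -/F mulrDr mulrDr.
by apply/andP; split; lra.
Qed.

End normal_second_moment.

Lemma cvg_toE {R : realType} {I : Type} {F : set_system I} {FF : Filter F}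
    (f : I -> R) (l : R) :
  f x @[x --> F] --> l -> (f x)%:E @[x --> F] --> l%:E.
Proof. by move=> fl; apply: cvg_EFin; [exact: nearW|exact: fl]. Qed.

(** * Square-integrable and Gaussian variables *)

Section square_integrable.
Context {R : realType} {d : measure_display} {T : measurableType d}.
Variable P : probability T R.
Implicit Types Y Z V : T -> R.

Definition L2 Y :=
  measurable_fun setT Y /\ P.-integrable setT (EFin \o (fun w => Y w ^+ 2)).

Definition ip Y Z : R := \int[P]_w (Y w * Z w).

Lemma ipC Y Z : ip Y Z = ip Z Y.
Proof. by apply: eq_Rintegral => w _; rewrite mulrC. Qed.

Lemma L2_meas Y : L2 Y -> measurable_fun setT Y. Proof. by case. Qed.

Lemma L2_mul Y Z : L2 Y -> L2 Z -> P.-integrable setT (EFin \o (fun w => Y w * Z w)).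
Proof.
move=> [mY iY] [mZ iZ].
apply: (le_integrable measurableT _ _ (integrable_radd iY iZ)).
  by apply/measurable_EFinP; exact: measurable_funM.
move=> w _ /=; rewrite lee_fin normrM [leRHS]ger0_norm ?addr_ge0 ?sqr_ge0//.
rewrite -[Y w ^+ 2]real_normK ?num_real// -[Z w ^+ 2]real_normK ?num_real//.
by have := sqr_ge0 (`|Y w| - `|Z w|); have := sqr_ge0 (`|Y w| + `|Z w|); nra.
Qed.

Lemma L2_scale (r : R) Y : L2 Y -> L2 (fun w => r * Y w).
Proof.
move=> [mY iY]; split; first exact: measurable_funM.
by under eq_fun do rewrite exprMn; exact: integrable_rscale.
Qed.

Lemma L2_add Y Z : L2 Y -> L2 Z -> L2 (fun w => Y w + Z w).
Proof.
move=> LY LZ; have [[mY iY] [mZ iZ]] := (LY, LZ).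
split; first exact: measurable_funD.
under eq_fun do rewrite sqrrD -mulr_natl.
apply: integrable_radd => //; apply: integrable_radd => //.
by apply: integrable_rscale; exact: L2_mul.
Qed.

Lemma L2_sub Y Z : L2 Y -> L2 Z -> L2 (fun w => Y w - Z w).
Proof.
move=> LY LZ; have := L2_add LY (L2_scale (-1) LZ).
by under eq_fun do rewrite mulN1r.
Qed.

Lemma ipDl Y Z V : L2 Y -> L2 Z -> L2 V -> ip (fun w => Y w + Z w) V = ip Y V + ip Z V.
Proof.
move=> LY LZ LV; rewrite /ip; under eq_Rintegral do rewrite mulrDl.
by rewrite RintegralD//; exact: L2_mul.
Qed.

Lemma ipZl (r : R) Y V : L2 Y -> L2 V -> ip (fun w => r * Y w) V = r * ip Y V.
Proof.
move=> LY LV; rewrite /ip; under eq_Rintegral do rewrite -mulrA.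
by rewrite RintegralZl//; exact: L2_mul.
Qed.

Lemma ipBl Y Z V : L2 Y -> L2 Z -> L2 V -> ip (fun w => Y w - Z w) V = ip Y V - ip Z V.
Proof.
move=> LY LZ LV; rewrite /ip; under eq_Rintegral do rewrite mulrBl.
by rewrite RintegralB//; exact: L2_mul.
Qed.

Lemma ipDr Y Z V : L2 Y -> L2 Z -> L2 V -> ip V (fun w => Y w + Z w) = ip V Y + ip V Z.
Proof. by move=> LY LZ LV; rewrite ipC ipDl// !(ipC V). Qed.

Lemma ipBr Y Z V : L2 Y -> L2 Z -> L2 V -> ip V (fun w => Y w - Z w) = ip V Y - ip V Z.
Proof. by move=> LY LZ LV; rewrite ipC ipBl// !(ipC V). Qed.

Lemma ipZr (r : R) Y V : L2 Y -> L2 V -> ip V (fun w => r * Y w) = r * ip V Y.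
Proof. by move=> LY LV; rewrite ipC ipZl// ipC. Qed.

Lemma ip_ge0 Y : 0 <= ip Y Y.
Proof. by apply: Rintegral_ge0 => w _; rewrite -expr2 sqr_ge0. Qed.

Lemma ip_sub Y Z : L2 Y -> L2 Z ->
  ip (fun w => Y w - Z w) (fun w => Y w - Z w) = ip Y Y - 2 * ip Y Z + ip Z Z.
Proof.
move=> LY LZ; have LB := L2_sub LY LZ.
by rewrite ipBl// !ipBr// (ipC Z Y); lra.
Qed.

Lemma ip_CS Y Z : L2 Y -> L2 Z -> (ip Y Z) ^+ 2 <= ip Y Y * ip Z Z.
Proof.
move=> LY LZ.
have key r : 0 <= ip Y Y - 2 * r * ip Y Z + r ^+ 2 * ip Z Z.
  have LrZ := L2_scale r LZ.
  have := ip_ge0 (fun w => Y w - r * Z w).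
  by rewrite ip_sub// ipZl// !ipZr//; nra.
have yy := ip_ge0 Y; have zz := ip_ge0 Z.
have [Z0|Z0] := eqVneq (ip Z Z) 0.
  suff -> : ip Y Z = 0 by rewrite expr0n/= Z0 mulr0.
  apply/eqP/negPn/negP => n0.
  (* This value of [r] would make the quadratic equal to -1. *)
  have := key ((ip Y Y + 1) / (2 * ip Y Z)).
  have -> : 2 * ((ip Y Y + 1) / (2 * ip Y Z)) * ip Y Z = ip Y Y + 1 by field.
  by rewrite Z0 mulr0 addr0; lra.
have zp : 0 < ip Z Z by rewrite lt_neqAle eq_sym Z0.
have := key (ip Y Z / ip Z Z).
have -> : ip Y Y - 2 * (ip Y Z / ip Z Z) * ip Y Z + (ip Y Z / ip Z Z) ^+ 2 * ip Z Z =
   (ip Y Y * ip Z Z - ip Y Z ^+ 2) / ip Z Z by field.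
by rewrite pmulr_lge0 ?invr_gt0// subr_ge0.
Qed.

Lemma ip_le Y Z : L2 Y -> L2 Z -> `|ip Y Z| <= Num.sqrt (ip Y Y) * Num.sqrt (ip Z Z).
Proof.
move=> LY LZ; rewrite -sqrtrM ?ip_ge0// -sqrtr_sqr.
by rewrite ler_sqrt ?mulr_ge0 ?ip_ge0// ip_CS.
Qed.

Lemma sqexpE Y : L2 Y -> sqexp P Y = (ip Y Y)%:E.
Proof.
by move=> [_ iY]; rewrite /sqexp (EFin_Rintegral iY).
Qed.

Lemma sqexp_L2 Y : measurable_fun setT Y -> (sqexp P Y < +oo)%E -> L2 Y.
Proof.
move=> mY fY; split=> //; apply/integrableP; split.
  by apply/measurable_EFinP; exact: measurable_funX.
by under eq_integral do rewrite /= ger0_norm ?sqr_ge0//.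
Qed.

Lemma le_prob A B : measurable A -> measurable B -> A `<=` B -> (P A <= P B)%E.
Proof. by move=> mA mB AB; rewrite le_measure// inE. Qed.

Lemma fatou_le (f : nat -> T -> R) (g : T -> R) (c : R) :
  (forall n, measurable_fun setT (f n)) -> (forall n w, 0 <= f n w) ->
  (forall w, f n w @[n --> \oo] --> g w) ->
  (\forall n \near \oo, (\int[P]_w (f n w)%:E <= c%:E)%E) ->
  (\int[P]_w (g w)%:E <= c%:E)%E.
Proof.
move=> mf f0 fg fc.
have -> : (\int[P]_w (g w)%:E = \int[P]_w limn_einf (fun n => (f n w)%:E))%E.
  by apply: eq_integral => w _; have [-> _] := cvg_limn_einf_sup (cvg_toE (fg w)).
apply: (@le_trans _ _ (limn_einf (fun n => (\int[P]_w (f n w)%:E)%E))).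
  apply: fatou => //; first by move=> n; apply/measurable_EFinP.
  by move=> n x _; rewrite lee_fin.
apply: le_trans (limn_einf_sup _) _.
rewrite limn_esup_lim.
case: fc => N _ Nc.
apply: lime_le; first exact: is_cvg_esups.
exists N => // n /= Nn; apply: ge_ereal_sup => _ [m /= nm <-].
by apply: Nc; rewrite /= (leq_trans Nn).
Qed.

Lemma markov_set (f : T -> R) (A : set T) (c : R) : measurable A ->
  measurable_fun setT f -> (forall w, 0 <= f w) -> 0 <= c ->
  (forall w, A w -> c <= f w) -> (c%:E * P A <= \int[P]_w (f w)%:E)%E.
Proof.
move=> mA mf f0 c0 cf.
have m1 : measurable_fun setT (fun w => (\1_A w)%:E : \bar R).
  by apply/measurable_EFinP; exact: measurable_indic.
have -> : (c%:E * P A = \int[P]_w (c%:E * (\1_A w)%:E))%E.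
  by rewrite ge0_integralZl// integral_indic// setIT.
apply: ge0_le_integral => //.
- by move=> w _; rewrite -EFinM lee_fin mulr_ge0.
- exact: emeasurable_funM.
- exact/measurable_EFinP.
move=> w _; rewrite -EFinM lee_fin indicE.
have [/set_mem Aw|_] := boolP (w \in A); first by rewrite mulr1 cf.
by rewrite mulr0.
Qed.

Lemma ip_as0 Y : L2 Y -> ip Y Y = 0 -> {ae P, forall w, Y w = 0}.
Proof.
move=> LY Y0; have [mY iY] := LY.
have Y20 : (\int[P]_w `|(Y w ^+ 2)%:E| = 0)%E.
  transitivity (sqexp P Y); last by rewrite sqexpE// Y0.
  by apply: eq_integral => w _; rewrite gee0_abs// lee_fin sqr_ge0.
have mY2 : measurable_fun setT (fun w => (Y w ^+ 2)%:E : \bar R).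
  by apply/measurable_EFinP; exact: measurable_funX.
have := (ae_eq_integral_abs P measurableT mY2).1 Y20.
by apply: filterS => w /(_ I) /= [] /eqP; rewrite sqrf_eq0 => /eqP.
Qed.

Lemma ae_eq_L2 Y Z : L2 Y -> L2 Z ->
  ip (fun w => Y w - Z w) (fun w => Y w - Z w) = 0 -> {ae P, forall w, Y w = Z w}.
Proof.
move=> LY LZ /(ip_as0 (L2_sub LY LZ)).
by apply: filterS => w /eqP; rewrite subr_eq0 => /eqP.
Qed.

Lemma ae_eq_ip Y Z V : L2 Y -> L2 Z -> L2 V -> {ae P, forall w, Y w = Z w} ->
  ip V Y = ip V Z.
Proof.
move=> LY LZ LV YZ; rewrite /ip /Rintegral; congr fine.
apply: ae_eq_integral => //.
- by apply/measurable_EFinP; apply: measurable_funM; exact: L2_meas.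
- by apply/measurable_EFinP; apply: measurable_funM; exact: L2_meas.
- by apply: filterS YZ => w -> _.
Qed.

End square_integrable.

Definition dirac0 (R : realType) : probability (measurableTypeR R) R :=
  [the probability _ _ of @dirac _ (measurableTypeR R) (0 : R) R].

Section gaussian_law.
Context {R : realType}.
Local Notation mR := (measurableTypeR R).

(** What the proof draws from a centered Gaussian law of variance [v]: second moment, Laplace
    transform, characteristic function, a bound on the mass near 0 and a lower tail bound. The
    fourth clause is multiplied through by the deviation so that it makes sense for the Dirac mass
    as well. *)
Definition gaussian_var (Q : probability mR R) (v : R) : Prop :=
  [/\ Q.-integrable setT (EFin \o (fun x => x ^+ 2)) /\ \int[Q]_x (x ^+ 2) = v,
      forall t : R, (\int[Q]_x (expR (t * x))%:E = (expR (t ^+ 2 * v / 2))%:E)%E,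
      \int[Q]_x cos x = gcf v /\ \int[Q]_x sin x = 0,
      forall dl : R, 0 <= dl -> ((Num.sqrt v)%:E * Q `[(- dl)%R, dl]%classic <= dl%:E)%E &
      forall h : R, 0 <= h -> 0 < v ->
        ((normal_pdf 0 (Num.sqrt v) (h + 1))%:E <= Q `[h, +oo[%classic)%E].

Lemma gaussian_var_dirac : gaussian_var (dirac0 R) 0.
Proof.
have m2 : measurable_fun [set: mR] (fun x : mR => (x ^+ 2)%:E : \bar R).
  by apply/measurable_EFinP; exact: measurable_funX.
have mabs : measurable_fun [set: mR] (fun x : mR => `|(x ^+ 2)%:E|%E : \bar R).
  exact: measurableT_comp.
have Id (f : mR -> \bar R) : measurable_fun setT f ->
    (\int[dirac0 R]_x f x = f (0 : R)%R)%E.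
  by move=> mf; rewrite integral_dirac// diracT mul1e.
split.
- split.
    by apply/integrableP; split; rewrite ?Id//= expr0n/= normr0 ltry.
  by rewrite /Rintegral Id//= expr0n.
- move=> t; rewrite Id ?mulr0 ?mul0r//.
  by apply/measurable_EFinP; apply: measurableT_comp => //; exact: measurable_funM.
- rewrite /Rintegral !Id ?gcf0 ?cos0 ?sin0//; apply/measurable_EFinP.
    exact: measurable_sin.
  exact: measurable_cos.
- by move=> dl dl0; rewrite sqrtr0 mul0e lee_fin.
- by move=> h _; rewrite ltxx.
Qed.

(** This amounts to pi >= 2. An interval [-dl, dl] of length 2 dl then has mass at most dl / s. *)
Lemma normal_peak_le (s : R) : 0 < s -> normal_peak s <= (2 * s)^-1.
Proof.
move=> s0; rewrite /normal_peak.
have s20 : 0 < 2 * s by rewrite mulr_gt0.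
have p0 : 0 < s ^+ 2 * pi *+ 2 by rewrite mulrn_wgt0// mulr_gt0 ?pi_gt0// exprn_gt0.
have sq0 : 0 < Num.sqrt (s ^+ 2 * pi *+ 2) by rewrite sqrtr_gt0.
rewrite lef_pV2 ?posrE//.
have -> : 2 * s = Num.sqrt ((2 * s) ^+ 2) by rewrite sqrtr_sqr gtr0_norm.
rewrite ler_sqrt ?(ltW p0)//.
have := @pi_ge2 R; rewrite -mulr_natl; have := exprn_gt0 2 s0; nra.
Qed.

Lemma cnormal_setE (s : R) (A : set R) :
  cnormal s A = (\int[lebesgue_measure]_(x in A) (normal_pdf 0 s x)%:E)%E.
Proof. by []. Qed.

Lemma gaussian_var_normal (s : R) : 0 < s -> gaussian_var (cnormal s) (s ^+ 2).
Proof.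
move=> s0; have sE : Num.sqrt (s ^+ 2) = s by rewrite sqrtr_sqr gtr0_norm.
have mp (D : set R) : measurable D ->
    measurable_fun D (fun x => (normal_pdf 0 s x)%:E).
  by move=> mD; apply/measurable_EFinP/measurable_funTS; exact: measurable_normal_pdf.
split.
- by split; [exact: normal_sqr_integrable|exact: normal_second_moment].
- by move=> t; exact: normal_mgf.
- by split; [rewrite /gcf sE expf_eq0/= gt_eqF|exact: normal_sin0].
- move=> dl dl0; rewrite sE cnormal_setE.
  set D : set R := `[(- dl)%R, dl]%classic.
  apply: (@le_trans _ _ (s%:E * \int[lebesgue_measure]_(x in D) (normal_peak s)%:E)%E).
    apply: lee_wpmul2l; first by rewrite lee_fin ltW.
    apply: ge0_le_integral.
    + exact: measurable_itv.
    + by move=> x _; rewrite lee_fin normal_pdf_ge0.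
    + by apply: mp; exact: measurable_itv.
    + exact: measurable_cst.
    + by move=> x _; rewrite lee_fin normal_pdf_ub// gt_eqF.
  rewrite /D integral_cst//= lebesgue_measure_itv/= lte_fin.
  case: ifPn => [_|_]; last by rewrite !mule0 lee_fin.
  rewrite -EFinB -!EFinM lee_fin opprK.
  have h := ler_wpM2l (ltW s0) (normal_peak_le s0).
  have E : s * (2 * s)^-1 = 2^-1 by field; rewrite gt_eqF.
  move: h; rewrite E => h; have := ler_wpM2r dl0 h.
  by rewrite mulrA mulrDr; lra.
(* The half-line is cut down to an interval of length 1, on which the density is least at the right
   end. *)
- move=> h h0 _; rewrite sE cnormal_setE; pose D : set R := `[h, h + 1]%classic.
  apply: (@le_trans _ _ (\int[lebesgue_measure]_(x in D) (normal_pdf 0 s x)%:E)%E); last first.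
    apply: ge0_subset_integral.
    + exact: measurable_itv.
    + exact: measurable_itv.
    + by apply: mp; exact: measurable_itv.
    + by move=> x _; rewrite lee_fin normal_pdf_ge0.
    + by move=> x; rewrite /D/= !in_itv/= andbT => /andP[].
  apply: (@le_trans _ _ (\int[lebesgue_measure]_(x in D) (normal_pdf 0 s (h + 1)%R)%:E)%E).
    rewrite /D integral_cst//= lebesgue_measure_itv/= lte_fin ltrDl ltr01 -EFinB.
    by rewrite addrAC subrr add0r mule1.
  apply: ge0_le_integral.
  + exact: measurable_itv.
  + by move=> x _; rewrite lee_fin normal_pdf_ge0.
  + exact: measurable_cst.
  + by apply: mp; exact: measurable_itv.
  + move=> x; rewrite /D/= in_itv/= => /andP[hx xh]; rewrite lee_fin.
    rewrite !normal_pdfE ?gt_eqF// ler_wpM2l ?normal_peak_ge0// /normal_fun ler_expR.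
    rewrite !subr0 ler_wpM2r ?invr_ge0 ?mulrn_wge0 ?sqr_ge0// lerN2.
    by rewrite ler_sqr ?nnegrE//; lra.
Qed.

End gaussian_law.

Section gaussian_rv.
Context {R : realType} {d : measure_display} {T : measurableType d}.
Variable P : probability T R.
Local Notation mR := (measurableTypeR R).

Section transfer.
Variables (Y : T -> R) (Q : probability mR R).
Hypothesis mY : measurable_fun setT Y.
Hypothesis YQ : forall A, measurable A -> P (Y @^-1` A) = Q A.

Lemma ge0_transfer (f : R -> \bar R) : measurable_fun [set: R] f ->
  (forall x, 0 <= f x)%E -> (\int[P]_w f (Y w) = \int[Q]_x f x)%E.
Proof.
move=> mf f0.
have := @ge0_integral_pushforward _ _ T mR R Y mY P setT f measurableT mf (fun x _ => f0 x).
by rewrite preimage_setT => <-; apply: eq_measure_integral => A mA _; exact: YQ.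
Qed.

Lemma integrable_transfer (f : R -> R) : measurable_fun [set: R] f ->
  Q.-integrable setT (EFin \o f) ->
  P.-integrable setT (EFin \o (fun w => f (Y w))) /\
  \int[P]_w f (Y w) = \int[Q]_x f x.
Proof.
move=> mf /integrableP[mf' iQ].
have ifY : P.-integrable setT (EFin \o (fun w => f (Y w))).
  apply/integrableP; split; first by apply/measurable_EFinP; exact: measurableT_comp.
  rewrite (ge0_transfer (f := fun x => `|(f x)%:E|%E))//.
  by apply: measurableT_comp => //; exact/measurable_EFinP.
split=> //; rewrite /Rintegral; congr fine.
have mf2 : measurable_fun [set: mR] (EFin \o f) by exact/measurable_EFinP.
have := @integral_pushforward _ _ T mR R Y mY P setT (EFin \o f) mf2.
rewrite preimage_setT => /(_ ifY measurableT) <-.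
by apply: eq_measure_integral => A mA _; exact: YQ.
Qed.

End transfer.

Lemma gaussian_measurable Y : centered_gaussian P Y -> measurable_fun setT Y.
Proof. by case. Qed.

Lemma gaussian_law Y : centered_gaussian P Y -> exists (Q : probability mR R) v,
  gaussian_var Q v /\ forall A : set mR, measurable A -> P (Y @^-1` A) = Q A.
Proof.
move=> [mY [H|[s [s0 H]]]].
- by exists (dirac0 R), 0; split; [exact: gaussian_var_dirac|].
- by exists (cnormal s), (s ^+ 2); split; [exact: gaussian_var_normal|].
Qed.

Lemma gaussianP Y : centered_gaussian P Y ->
  [/\ L2 P Y,
      forall t : R, (\int[P]_w (expR (t * Y w))%:E = (expR (t ^+ 2 * ip P Y Y / 2))%:E)%E,
      \int[P]_w cos (Y w) = gcf (ip P Y Y) /\ \int[P]_w sin (Y w) = 0,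
      forall dl : R, 0 <= dl ->
        ((Num.sqrt (ip P Y Y))%:E * P [set w | (`|Y w| <= dl)%R] <= dl%:E)%E &
      forall h : R, 0 <= h -> 0 < ip P Y Y ->
        ((normal_pdf 0 (Num.sqrt (ip P Y Y)) (h + 1))%:E <= P [set w | (h <= Y w)%R])%E].
Proof.
move=> gY; have mY := gaussian_measurable gY.
have [Q [v [[[i2 v2] mgf [ec es] sb dens] YQ]]] := gaussian_law gY.
have mX2 : measurable_fun [set: R] (fun x : R => x ^+ 2) by exact: measurable_funX.
have mc : measurable_fun setT (@cos R).
  exact: measurable_cos.
have ms : measurable_fun setT (@sin R).
  exact: measurable_sin.
have ic : Q.-integrable setT (EFin \o @cos R).
  by apply: (@bounded_integrable _ _ _ _ _ 1) => // x; exact: cos_max.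
have isn : Q.-integrable setT (EFin \o @sin R).
  by apply: (@bounded_integrable _ _ _ _ _ 1) => // x; exact: sin_max.
have [iY2 vE] := integrable_transfer mY YQ mX2 i2.
have -> : ip P Y Y = v by rewrite -v2 -vE; apply: eq_Rintegral => w _; rewrite expr2.
split.
- by [].
- move=> t; rewrite -mgf (ge0_transfer mY YQ (f := fun x => (expR (t * x))%:E))//.
  by apply/measurable_EFinP; apply: measurableT_comp => //; exact: measurable_funM.
- have Ec := (integrable_transfer mY YQ mc ic).2.
  have Es := (integrable_transfer mY YQ ms isn).2.
  by rewrite Ec Es; split.
- move=> dl dl0; rewrite (_ : [set w | _] = Y @^-1` `[- dl, dl]%classic); last first.
    by apply/seteqP; split=> w /=; rewrite in_itv/= ler_norml.
  by rewrite YQ; [exact: sb|exact: measurable_itv].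
- move=> h h0 v0; rewrite (_ : [set w | _] = Y @^-1` `[h, +oo[%classic); last first.
    by apply/seteqP; split=> w /=; rewrite in_itv/= andbT.
  by rewrite YQ; [exact: dens|exact: measurable_itv].
Qed.

End gaussian_rv.

Section bounded_convergence.
Context {R : realType} {d : measure_display} {T : measurableType d}.
Variable P : probability T R.

Lemma bounded_convergence (f : nat -> T -> R) (g : T -> R) (M : R) :
  (forall n, measurable_fun setT (f n)) -> (forall n w, `|f n w| <= M) ->
  (forall w, f n w @[n --> \oo] --> g w) ->
  measurable_fun setT g /\ \int[P]_w f n w @[n --> \oo] --> \int[P]_w g w.
Proof.
move=> mf fM fg.
have mg : measurable_fun setT g.
  by apply: (measurable_fun_cvg (h := f)) => // w _; exact: fg.
split=> //; apply: fine_cvg.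
have gM w : `|g w| <= M.
  have h : `|f n w| @[n --> \oo] --> `|g w| by apply: cvg_norm.
  rewrite -(cvg_lim (@Rhausdorff R) h); apply: limr_le; last exact: nearW.
  by apply/cvg_ex; exists `|g w|.
rewrite fineK; last first.
  by apply: integrable_fin_num => //; exact: (bounded_integrable P mg gM).
have [//|||||_ _] := @dominated_convergence _ _ _ P setT measurableT
  (fun n w => (f n w)%:E) (fun w => (g w)%:E) (cst M%:E).
- by move=> n; apply/measurable_EFinP.
- exact/measurable_EFinP.
- by apply: aeW => w _; exact: cvg_toE.
- exact: finite_measure_integrable_cst.
- by apply: aeW => w n _; rewrite lee_fin.
by [].
Qed.

End bounded_convergence.

(** * Indicators of half-lines as limits of trigonometric expressions *)

Section smooth_step.
Context {R : realType}.

Lemma bernoulli_expr (x : R) (n : nat) : 0 <= x <= 1 -> 1 - n%:R * x <= (1 - x) ^+ n.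
Proof.
move=> /andP[x0 x1]; elim: n => [|n IH]; first by rewrite mul0r subr0 expr0.
rewrite exprS -natr1.
have n0 : 0 <= n%:R :> R by rewrite ler0n.
have : (1 - x) * (1 - n%:R * x) <= (1 - x) * (1 - x) ^+ n by rewrite ler_wpM2l//; lra.
nra.
Qed.

Lemma cvg_natr_geometric (r : R) : 0 <= r < 1 -> k%:R * r ^+ k @[k --> \oo] --> (0 : R).
Proof.
move=> /andP[r0 r1].
set s := Num.sqrt r.
have s0 : 0 <= s by exact: sqrtr_ge0.
have s1 : s < 1 by rewrite -sqrtr1 ltr_sqrt.
have rE : r = s * s by rewrite -expr2 sqr_sqrtr.
have bd k : k%:R * s ^+ k <= (1 - s)^-1.
  rewrite -[leRHS]mul1r ler_pdivlMr ?subr_gt0//.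
  have sk0 : 0 <= s ^+ k by exact: exprn_ge0.
  suff : s ^+ k * (1 + k%:R * (1 - s)) <= 1 by lra.
  elim: k sk0 => [_|k IH _]; first by rewrite expr0 mul0r addr0 mulr1.
  have sk0 : 0 <= s ^+ k by exact: exprn_ge0.
  apply: le_trans (IH sk0); rewrite exprS -natr1 [s * _]mulrC -mulrA ler_wpM2l//.
  have : s * ((k%:R + 1) * (1 - s)) <= (k%:R + 1) * (1 - s).
    by rewrite ler_piMl ?mulr_ge0 ?subr_ge0 ?addr_ge0 ?(ltW s1).
  nra.
apply: (@squeeze_cvgr _ _ _ _ (fun=> 0) (fun k => (1 - s)^-1 * s ^+ k)).
- apply: nearW => k; rewrite rE exprMn mulr_ge0 ?mulr_ge0 ?exprn_ge0//=.
  by rewrite mulrA ler_wpM2r ?exprn_ge0.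
- exact: cvg_cst.
- rewrite -[X in _ --> X](mulr0 (1 - s)^-1); apply: cvgMr.
  by apply: cvg_expr; rewrite ger0_norm.
Qed.

(** If h >= 1/2, then k 2^k h^k >= k and the power is at most e^(-k); if h < 1/2, Bernoulli bounds
    the expression by k (2h)^k. The extra factor k in the exponent settles the threshold h = 1/2,
    where 2^k alone would give the limit 1 - 1/e. *)
Lemma cvg_smooth_step (h : R) : 0 <= h <= 1 ->
  1 - (1 - h ^+ k) ^+ (k * 2 ^ k) @[k --> \oo] --> ((2^-1 <= h)%R%:R : R).
Proof.
move=> /andP[h0 h1].
have hk k : 0 <= h ^+ k <= 1 by rewrite exprn_ge0//= exprn_ile1.
have [h2|h2] := leP (2^-1) h.
- rewrite [X in _ --> X](_ : _ = 1 - 0); last by rewrite subr0.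
  apply: cvgB; first exact: cvg_cst.
  apply: (@squeeze_cvgr _ _ _ _ (fun=> 0) (fun k => (expR (- 1)) ^+ k)).
  + apply: nearW => k; have /andP[k0 k1] := hk k.
    rewrite exprn_ge0 ?subr_ge0//=.
    apply: (@le_trans _ _ (expR (- h ^+ k) ^+ (k * 2 ^ k))).
      by rewrite lerXn2r ?nnegrE ?expR_ge0 ?subr_ge0// expR_ge1Dx.
    rewrite -!expRM_natl ler_expR natrM natrX mulrN mulrN1 lerN2 -mulrA.
    rewrite ler_peMr ?ler0n// -exprMn exprn_ege1//; lra.
  + exact: cvg_cst.
  + by apply: cvg_expr; rewrite ger0_norm ?expR_ge0// -expR0 ltr_expR; lra.
- apply: (@squeeze_cvgr _ _ _ _ (fun=> 0) (fun k => k%:R * (2 * h) ^+ k)).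
  + apply: nearW => k; have /andP[k0 k1] := hk k.
    apply/andP; split.
      by rewrite subr_ge0 exprn_ile1 ?subr_ge0//; lra.
    have := bernoulli_expr (k * 2 ^ k) (hk k).
    by rewrite natrM natrX exprMn mulrA; lra.
  + exact: cvg_cst.
  + by apply: cvg_natr_geometric; lra.
Qed.

(** Once |y| / (n + 1) < pi, the sine has the sign of [y]: dilation undoes the periodicity of a
    trigonometric threshold. *)
Lemma cvg_sin_sign (y : R) :
  ((0 <= sin (n.+1%:R^-1 * y))%R%:R : R) @[n --> \oo] --> ((0 <= y)%R%:R : R).
Proof.
have near_small : \forall n \near \oo, n.+1%:R^-1 * `|y| < pi.
  have : n.+1%:R^-1 * `|y| @[n --> \oo] --> 0 * `|y|.
    by apply: cvgM; [exact: cvg_harmonic|exact: cvg_cst].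
  by rewrite mul0r => /cvgr_lt; apply; exact: pi_gt0.
apply: (@cvg_near_cst _ _ _ _ _) => //.
apply: filterS near_small => n ny.
have n0 : 0 < n.+1%:R^-1 :> R by rewrite invr_gt0 ltr0n.
have [y0|y0] := leP 0 y.
- rewrite sin_ge0_pi// mulr_ge0 ?(ltW n0)//=.
  by rewrite ger0_norm// in ny; exact: ltW.
- rewrite leNgt -[y]opprK mulrN sinN oppr_lt0 sin_gt0_pi//.
  rewrite ltr0_norm// in ny.
  by rewrite mulr_gt0// oppr_gt0.
Qed.

End smooth_step.

(** * Equality of laws from trigonometric moments *)

Section trigonometric_class.
Context {R : realType} {d d' : measure_display}.
Context {T : measurableType d} {T' : measurableType d'}.
Variables (P : probability T R) (P' : probability T' R).
Variable V : (T -> R) -> (T' -> R) -> Prop.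
Hypothesis V_meas : forall Y Y', V Y Y' -> measurable_fun setT Y /\ measurable_fun setT Y'.
Hypothesis V_cos : forall Y Y', V Y Y' -> \int[P]_w cos (Y w) = \int[P']_w cos (Y' w).
Hypothesis V_sin : forall Y Y', V Y Y' -> \int[P]_w sin (Y w) = \int[P']_w sin (Y' w).
Hypothesis V_add : forall Y1 Y1' Y2 Y2', V Y1 Y1' -> V Y2 Y2' ->
  V (fun w => Y1 w + Y2 w) (fun w => Y1' w + Y2' w).
Hypothesis V_scale : forall r Y Y', V Y Y' -> V (fun w => r * Y w) (fun w => r * Y' w).

(* Stable under products with (1 + cos (Y + b)) / 2 and under bounded limits, hence, through
   the smooth steps 1 - (1 - h^k)^(k 2^k), under products with indicators of half-spaces. *)
Definition trig_class (U : T -> R) (U' : T' -> R) : Prop :=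
  [/\ measurable_fun setT U, measurable_fun setT U',
      (forall w, 0 <= U w <= 1), (forall w, 0 <= U' w <= 1) &
      forall Y Y' al, V Y Y' ->
        \int[P]_w (U w * cos (Y w + al)) = \int[P']_w (U' w * cos (Y' w + al))].

Let mcos : measurable_fun setT (@cos R) := measurable_cos.

Let Ucos_int (e : measure_display) (S : measurableType e) (Q : probability S R)
    (U Y : S -> R) (al : R) :
  measurable_fun setT U -> (forall w, 0 <= U w <= 1) -> measurable_fun setT Y ->
  Q.-integrable setT (EFin \o (fun w => U w * cos (Y w + al))).
Proof.
move=> mU U01 mY; apply: (@bounded_integrable _ _ _ _ _ 1).
  apply: measurable_funM => //; apply: measurableT_comp => //.
  exact: measurable_funD.
move=> w; rewrite normrM; have /andP[u0 u1] := U01 w.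
by rewrite ger0_norm// mulr_ile1// cos_max.
Qed.

(** The addition formula splits off the phase; this is where the hypotheses on E cos and E sin
    enter. *)
Lemma trig_class1 : trig_class (fun=> 1) (fun=> 1).
Proof.
split=> // [w|w|Y Y' al VY]; rewrite ?ler01 ?lexx//.
have [mY mY'] := V_meas VY.
have E (e : measure_display) (S : measurableType e) (Q : probability S R) (Z : S -> R) :
    measurable_fun setT Z ->
    \int[Q]_w (1 * cos (Z w + al)) =
    cos al * \int[Q]_w cos (Z w) - sin al * \int[Q]_w sin (Z w).
  move=> mZ.
  have msin : measurable_fun setT (@sin R).
    exact: measurable_sin.
  have ic : Q.-integrable setT (EFin \o (fun w => cos (Z w))).
    apply: (@bounded_integrable _ _ _ _ _ 1) => [|w]; last exact: cos_max.
    exact: measurableT_comp.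
  have iS : Q.-integrable setT (EFin \o (fun w => sin (Z w))).
    apply: (@bounded_integrable _ _ _ _ _ 1) => [|w]; last exact: sin_max.
    exact: measurableT_comp.
  under eq_Rintegral do rewrite mul1r cosD [cos (Z _) * _]mulrC [sin (Z _) * _]mulrC.
  rewrite RintegralB//; [|exact: integrable_rscale|exact: integrable_rscale].
  by rewrite !RintegralZl.
by rewrite !E// (V_cos VY) (V_sin VY).
Qed.

(** A product of two cosines is half the sum of the cosines of Y + Y0 and Y - Y0, which are again
    governed by [V]. *)
Lemma trig_class_mul U U' Y0 Y0' (be : R) : trig_class U U' -> V Y0 Y0' ->
  trig_class (fun w => U w * ((1 + cos (Y0 w + be)) / 2))
             (fun w => U' w * ((1 + cos (Y0' w + be)) / 2)).
Proof.
move=> [mU mU' U01 U'01 UU'] VY0.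
have [mY0 mY0'] := V_meas VY0.
have mh (e : measure_display) (S : measurableType e) (W Z : S -> R) :
    measurable_fun setT W -> measurable_fun setT Z ->
    measurable_fun setT (fun w => W w * ((1 + cos (Z w + be)) / 2)).
  move=> mW mZ; apply: measurable_funM => //; apply: measurable_funM => //.
  apply: measurable_funD => //; apply: measurableT_comp => //.
  exact: measurable_funD.
have h01 (x : R) : 0 <= (1 + cos x) / 2 <= 1.
  by have := cos_max x; rewrite ler_norml => /andP[? ?]; apply/andP; split; lra.
split.
- exact: mh.
- exact: mh.
- move=> w; have /andP[u0 u1] := U01 w; have /andP[h0 h1] := h01 (Y0 w + be).
  by rewrite mulr_ge0//= mulr_ile1.
- move=> w; have /andP[u0 u1] := U'01 w; have /andP[h0 h1] := h01 (Y0' w + be).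
  by rewrite mulr_ge0//= mulr_ile1.
- move=> Y Y' al VY; have [mY mY'] := V_meas VY.
  have E (e : measure_display) (S : measurableType e) (Q : probability S R)
      (W Z Z0 : S -> R) :
      measurable_fun setT W -> (forall w, 0 <= W w <= 1) ->
      measurable_fun setT Z -> measurable_fun setT Z0 ->
      \int[Q]_w (W w * ((1 + cos (Z0 w + be)) / 2) * cos (Z w + al)) =
      2^-1 * \int[Q]_w (W w * cos (Z w + al)) +
      (4^-1 * \int[Q]_w (W w * cos (Z w + Z0 w + (al + be))) +
       4^-1 * \int[Q]_w (W w * cos (Z w + -1 * Z0 w + (al - be)))).
    move=> mW W01 mZ mZ0.
    have i1 := Ucos_int Q al mW W01 mZ.
    have i2 := Ucos_int Q (al + be) mW W01 (measurable_funD mZ mZ0).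
    have mZ0N : measurable_fun setT (fun w => -1 * Z0 w) by exact: measurable_funM.
    have i3 := Ucos_int Q (al - be) mW W01 (measurable_funD mZ mZ0N).
    rewrite -!RintegralZl// -RintegralD//; [|exact: integrable_rscale..].
    rewrite -RintegralD//; [|exact: integrable_rscale|].
      apply: eq_Rintegral => w _.
      have -> : Z w + Z0 w + (al + be) = (Z w + al) + (Z0 w + be) by ring.
      have -> : Z w + -1 * Z0 w + (al - be) = (Z w + al) - (Z0 w + be) by ring.
      by rewrite (cosD (Z w + al)) (cosB (Z w + al)); field.
    by apply: integrable_radd; exact: integrable_rscale.
  rewrite !E// (UU' _ _ al VY) (UU' _ _ (al + be) (V_add VY VY0)).
  by rewrite (UU' _ _ (al - be) (V_add VY (V_scale (-1) VY0))).
Qed.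

Lemma trig_class_lim (U : nat -> T -> R) (U' : nat -> T' -> R) W W' :
  (forall n, trig_class (U n) (U' n)) ->
  (forall w, U n w @[n --> \oo] --> W w) ->
  (forall w, U' n w @[n --> \oo] --> W' w) -> trig_class W W'.
Proof.
move=> UU' UW UW'.
have lim01 (S : Type) (F : nat -> S -> R) (G : S -> R) :
   (forall n w, 0 <= F n w <= 1) -> (forall w, F n w @[n --> \oo] --> G w) ->
   forall w, 0 <= G w <= 1.
  move=> F01 FG w; rewrite -(cvg_lim (@Rhausdorff R) (FG w)).
  have cF : cvgn (fun n => F n w) by apply/cvg_ex; exists (G w).
  by rewrite limr_ge ?limr_le//; apply: nearW => n; have /andP[] := F01 n w.
have mUW : measurable_fun setT W.
  by apply: (measurable_fun_cvg (h := U)) => [n|w _]; [case: (UU' n)|exact: UW].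
have mUW' : measurable_fun setT W'.
  by apply: (measurable_fun_cvg (h := U')) => [n|w _]; [case: (UU' n)|exact: UW'].
split=> //.
- by apply: (lim01 _ U) => // n w; case: (UU' n).
- by apply: (lim01 _ U') => // n w; case: (UU' n).
move=> Y Y' al VY; have [mY mY'] := V_meas VY.
have E (e : measure_display) (S : measurableType e) (Q : probability S R)
    (F : nat -> S -> R) (G Z : S -> R) :
    (forall n, measurable_fun setT (F n)) -> (forall n w, 0 <= F n w <= 1) ->
    (forall w, F n w @[n --> \oo] --> G w) -> measurable_fun setT Z ->
    \int[Q]_w (F n w * cos (Z w + al)) @[n --> \oo] --> \int[Q]_w (G w * cos (Z w + al)).
  move=> mF F01 FG mZ; apply: (bounded_convergence (M := 1) _ _ _ _).2.
  - move=> n; apply: measurable_funM => //; apply: measurableT_comp => //.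
    exact: measurable_funD.
  - move=> n w; rewrite normrM; have /andP[u0 u1] := F01 n w.
    by rewrite ger0_norm// mulr_ile1// cos_max.
  - by move=> w; apply: cvgM; [exact: FG|exact: cvg_cst].
have c1 : \int[P]_w (U n w * cos (Y w + al)) @[n --> \oo] --> \int[P]_w (W w * cos (Y w + al)).
  by apply: E => // n; case: (UU' n).
have c2 : \int[P']_w (U' n w * cos (Y' w + al)) @[n --> \oo] --> \int[P']_w (W' w * cos (Y' w + al)).
  by apply: E => // n; case: (UU' n).
have c3 : \int[P]_w (U n w * cos (Y w + al)) @[n --> \oo] --> \int[P']_w (W' w * cos (Y' w + al)).
  rewrite [X in X @ _](_ : _ = fun n => \int[P']_w (U' n w * cos (Y' w + al)))//.
  by apply/funext => n; case: (UU' n) => _ _ _ _ /(_ _ _ al VY).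
exact: (cvg_unique (@Rhausdorff R) c1 c3).
Qed.

Lemma trig_class_compl U U' W W' : trig_class U U' -> trig_class W W' ->
  (forall w, W w <= U w) -> (forall w, W' w <= U' w) ->
  trig_class (fun w => U w - W w) (fun w => U' w - W' w).
Proof.
move=> [mU mU' U01 U'01 UU'] [mW mW' W01 W'01 WW'] WU WU'.
split.
- exact: measurable_funB.
- exact: measurable_funB.
- move=> w; have /andP[? ?] := U01 w; have /andP[? ?] := W01 w; have := WU w.
  by move=> ?; apply/andP; split; lra.
- move=> w; have /andP[? ?] := U'01 w; have /andP[? ?] := W'01 w; have := WU' w.
  by move=> ?; apply/andP; split; lra.
- move=> Y Y' al VY; have [mY mY'] := V_meas VY.
  under eq_Rintegral do rewrite mulrBl.
  under [RHS]eq_Rintegral do rewrite mulrBl.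
  rewrite RintegralB//; [|exact: Ucos_int..].
  by rewrite RintegralB//; [|exact: Ucos_int..]; rewrite (UU' _ _ al VY) (WW' _ _ al VY).
Qed.

Let hat (x : R) := (1 + cos x) / 2.

Let hat01 x : 0 <= hat x <= 1.
Proof.
by have := cos_max x; rewrite /hat ler_norml => /andP[? ?]; apply/andP; split; lra.
Qed.

Lemma trig_class_step U U' Y0 Y0' (be : R) : trig_class U U' -> V Y0 Y0' ->
  trig_class (fun w => U w * (2^-1 <= hat (Y0 w + be))%R%:R)
             (fun w => U' w * (2^-1 <= hat (Y0' w + be))%R%:R).
Proof.
move=> UU' VY0.
have hX W W' k : trig_class W W' ->
    trig_class (fun w => W w * hat (Y0 w + be) ^+ k) (fun w => W' w * hat (Y0' w + be) ^+ k).
  move=> WW'; elim: k => [|k IH].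
    by under eq_fun do rewrite expr0 mulr1; under [X in trig_class _ X]eq_fun do rewrite expr0 mulr1.
  under eq_fun do rewrite exprSr mulrA.
  under [X in trig_class _ X]eq_fun do rewrite exprSr mulrA.
  exact: trig_class_mul.
(* Induction on [m]: (1 - h^k)^(m+1) is (1 - h^k)^m minus its product with h^k. *)
have hkX k m W W' : trig_class W W' ->
    trig_class (fun w => W w * (1 - hat (Y0 w + be) ^+ k) ^+ m)
               (fun w => W' w * (1 - hat (Y0' w + be) ^+ k) ^+ m).
  move=> WW'; elim: m => [|m IH].
    by under eq_fun do rewrite expr0 mulr1; under [X in trig_class _ X]eq_fun do rewrite expr0 mulr1.
  under eq_fun do rewrite exprSr mulrA mulrBr mulr1.
  under [X in trig_class _ X]eq_fun do rewrite exprSr mulrA mulrBr mulr1.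
  have hk1 (x : R) : hat x ^+ k <= 1 by have /andP[? ?] := hat01 x; rewrite exprn_ile1.
  apply: trig_class_compl => //; first exact: hX.
  - move=> w; rewrite ler_piMr//; have [_ _ + _ _] := IH => /(_ w) /andP[]//.
  - move=> w; rewrite ler_piMr//; have [_ _ _ + _] := IH => /(_ w) /andP[]//.
apply: (@trig_class_lim
  (fun k w => U w - U w * (1 - hat (Y0 w + be) ^+ k) ^+ (k * 2 ^ k))
  (fun k w => U' w - U' w * (1 - hat (Y0' w + be) ^+ k) ^+ (k * 2 ^ k))).
- move=> k; apply: trig_class_compl => //; first exact: hkX.
  + move=> w; rewrite ler_piMr//; first by case: UU' => _ _ + _ _ => /(_ w) /andP[].
    have /andP[h0 h1] := hat01 (Y0 w + be).
    by rewrite exprn_ile1// ?subr_ge0 ?exprn_ile1// gerBl exprn_ge0.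
  + move=> w; rewrite ler_piMr//; first by case: UU' => _ _ _ + _ => /(_ w) /andP[].
    have /andP[h0 h1] := hat01 (Y0' w + be).
    by rewrite exprn_ile1// ?subr_ge0 ?exprn_ile1// gerBl exprn_ge0.
- move=> w; under eq_fun do rewrite -[X in X - _]mulr1 -mulrBr.
  by apply: cvgM; [exact: cvg_cst|exact: cvg_smooth_step].
- move=> w; under eq_fun do rewrite -[X in X - _]mulr1 -mulrBr.
  by apply: cvgM; [exact: cvg_cst|exact: cvg_smooth_step].
Qed.

Lemma trig_class_ge U U' Y0 Y0' (c : R) : trig_class U U' -> V Y0 Y0' ->
  trig_class (fun w => U w * (c <= Y0 w)%R%:R) (fun w => U' w * (c <= Y0' w)%R%:R).
Proof.
move=> UU' VY0.
(* The phase -pi/2 turns the cosine into a sine, so the threshold 1/2 of [hat] becomes the sign of a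
   sine whose period grows with [n]. *)
have E n (y : R) : (2^-1 <= hat (n.+1%:R^-1 * y + (- (n.+1%:R^-1 * c) - pi / 2)))%R =
    (0 <= sin (n.+1%:R^-1 * (y - c)))%R.
  rewrite /hat addrA cosBpihalf mulrBr.
  by apply/idP/idP => h; lra.
have S n : trig_class (fun w => U w * (0 <= sin (n.+1%:R^-1 * (Y0 w - c)))%R%:R)
                      (fun w => U' w * (0 <= sin (n.+1%:R^-1 * (Y0' w - c)))%R%:R).
  have := trig_class_step (- (n.+1%:R^-1 * c) - pi / 2) UU' (V_scale n.+1%:R^-1 VY0).
  by under eq_fun do rewrite E; under [X in trig_class _ X]eq_fun do rewrite E.
apply: (trig_class_lim S) => w.
- apply: cvgM; first exact: cvg_cst.
  by rewrite -[c <= _]subr_ge0; exact: cvg_sin_sign.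
- apply: cvgM; first exact: cvg_cst.
  by rewrite -[c <= _]subr_ge0; exact: cvg_sin_sign.
Qed.

(** Finite products of half-space indicators lie in the class by induction, and their limit is the
    indicator of the countable orthant. *)
Lemma prob_orthant_eq (Y : nat -> T -> R) (Y' : nat -> T' -> R) (c : nat -> R) :
  (forall n, V (Y n) (Y' n)) ->
  P [set w | forall n, c n <= Y n w] = P' [set w | forall n, c n <= Y' n w].
Proof.
move=> VY.
have K n : trig_class (fun w => \prod_(i < n) (c i <= Y i w)%R%:R)
                      (fun w => \prod_(i < n) (c i <= Y' i w)%R%:R).
  elim: n => [|n IH].
    under eq_fun do rewrite big_ord0; under [X in trig_class _ X]eq_fun do rewrite big_ord0.
    exact: trig_class1.
  under eq_fun do rewrite big_ord_recr/=; under [X in trig_class _ X]eq_fun do rewrite big_ord_recr/=.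
  exact: trig_class_ge.
have lim (S : Type) (Z : nat -> S -> R) (w : S) :
   (\prod_(i < n) (c i <= Z i w)%R%:R : R) @[n --> \oo] -->
   (\1_([set v | forall n, c n <= Z n v] : set S) w : R).
  rewrite indicE; have [/set_mem/= cZ|] := boolP (w \in _).
    apply: cvg_near_cst; apply: nearW => n.
    by rewrite big1// => i _; rewrite cZ.
  rewrite notin_setE/= => /existsNP[m /negP cZ].
  apply: cvg_near_cst; exists m.+1 => // n /= mn.
  by rewrite (bigD1 (Ordinal mn))//= (negbTE cZ) mul0r.
(* Tested against the zero variable with phase 0, so the cosine is 1 and the integrals are
   probabilities. *)
have [mI mI' _ _ /(_ _ _ 0 (V_scale 0 (VY 0%N)))] := trig_class_lim K (lim T Y) (lim T' Y').
have mS (e : measure_display) (S : measurableType e) (A : set S) :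
    measurable_fun setT (\1_A : S -> R) -> measurable A.
  move=> mA; have := mA measurableT [set 1] (measurable_set1 _).
  rewrite setTI; congr (measurable _); apply/seteqP; split => w /=; rewrite indicE.
    by have [/set_mem//|_ /eqP] := boolP (w \in A); rewrite eq_sym oner_eq0.
  by move=> Aw; rewrite mem_set.
under eq_Rintegral do rewrite mul0r addr0 cos0 mulr1.
under [X in _ = X]eq_Rintegral do rewrite mul0r addr0 cos0 mulr1.
have I (e : measure_display) (S : measurableType e) (Q : probability S R) (A : set S) :
    measurable A -> \int[Q]_w (\1_A w : R) = fine (Q A).
  by move=> mA; rewrite /Rintegral integral_indic// setIT.
rewrite !I; [|exact: mS..].
move=> /(congr1 (@EFin R)); rewrite !fineK//; exact: fin_num_measure (mS _ _ _ _).
Qed.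

Lemma prob_orthant_eq_count (I : countType) (Y : I -> T -> R) (Y' : I -> T' -> R) (c : I -> R) :
  I -> (forall i, V (Y i) (Y' i)) ->
  P [set w | forall i, c i <= Y i w] = P' [set w | forall i, c i <= Y' i w].
Proof.
(* Integers that decode to nothing are sent to [i0], which only repeats one constraint. *)
move=> i0 VY; pose e n := odflt i0 (unpickle n).
have eK i : exists n, e n = i by exists (pickle i); rewrite /e pickleK.
have reindex (S : Type) (X : I -> S -> R) :
    [set w | forall i, c i <= X i w] = [set w | forall n, c (e n) <= X (e n) w].
  by apply/seteqP; split=> w /= h // i; have [n <-] := eK i.
by rewrite !reindex; apply: prob_orthant_eq => n; exact: VY.
Qed.

End trigonometric_class.

(** * Probabilities on [0, 1] and their weak limits *)

Section heine.
Context {R : realType}.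
Local Notation I01 := (`[0, 1]%classic : set R).

(* Heine's theorem for a pseudo-distance, so that it serves both a real function and
   an L2-continuous process. *)
Lemma heine01 (dst : R -> R -> R) :
  (forall u v, dst u v = dst v u) ->
  (forall u v w, dst u w <= dst u v + dst v w) ->
  (forall p e : R, I01 p -> 0 < e ->
    exists2 dl : R, 0 < dl & forall v, I01 v -> `|v - p| < dl -> dst p v <= e) ->
  forall e : R, 0 < e -> exists n0 : nat, forall u v, I01 u -> I01 v ->
    `|u - v| <= n0.+1%:R^-1 -> dst u v <= e.
Proof.
move=> dC dT dloc e e0; apply: contrapT => /forallNP H.
have {H} H n : exists uv : R * R, [/\ I01 uv.1, I01 uv.2, `|uv.1 - uv.2| <= n.+1%:R^-1
    & e < dst uv.1 uv.2].
  have /existsNP[u /existsNP[v /not_implyP[Iu /not_implyP[Iv /not_implyP[uv /negP]]]]] := H n.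
  by rewrite -ltNge => h; exists (u, v).
pose s n := sval (cid (H n)).
have sP n : [/\ I01 (s n).1, I01 (s n).2, `|(s n).1 - (s n).2| <= n.+1%:R^-1
    & e < dst (s n).1 (s n).2] by rewrite /s; case: cid.
have cpt := @segment_compact R 0 1.
have [|p [Ip clp]] := cpt ((fun n => (s n).1) @ \oo) _.
  by exists 0%N => // n _ /=; have [] := sP n.
have e20 : 0 < e / 2 by rewrite divr_gt0.
have [dl dl0 dlP] := dloc p _ Ip e20.
have N1 : nbhs p (ball p (dl / 2)) by apply: nbhsx_ballx; rewrite divr_gt0.
have N2 : ((fun n => (s n).1) @ \oo) [set x | exists2 n, n.+1%:R^-1 < dl / 2 & x = (s n).1].
  have /cvgr_lt : (@harmonic R) @ \oo --> 0 by exact: cvg_harmonic.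
  move=> /(_ (dl / 2)); rewrite divr_gt0// => /(_ isT).
  by apply: filterS => n /= nd; exists n.
have [x [[n nd xE] px]] := clp _ _ N2 N1.
have [I1 I2 d12 dn] := sP n; suff : dst (s n).1 (s n).2 <= e by rewrite leNgt dn.
have h1 : `|(s n).1 - p| < dl / 2 by rewrite distrC -xE.
have h2 : `|(s n).2 - p| < dl.
  have -> : (s n).2 - p = ((s n).1 - p) - ((s n).1 - (s n).2) by ring.
  apply: (le_lt_trans (ler_normB _ _)).
  have := le_lt_trans d12 nd; lra.
have k1 := dlP _ I1 (lt_trans h1 _); have k2 := dlP _ I2 h2.
apply: (le_trans (dT _ p _)); rewrite (dC _ p).
have : dst p (s n).1 <= e / 2 by apply: k1; lra.
lra.
Qed.

Lemma within_continuousP (f : R -> R) : {within I01, continuous f} ->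
  forall p e : R, I01 p -> 0 < e ->
  exists2 dl : R, 0 < dl & forall v, I01 v -> `|v - p| < dl -> `|f p - f v| <= e.
Proof.
move=> cf p e Ip e0.
move/subspace_continuousP: cf => /(_ p Ip) /cvgrPdist_le /(_ e e0) [dl /= dl0 H].
by exists dl => // v Iv pv; apply: H => //=; rewrite distrC.
Qed.

Lemma heine_within (f : R -> R) : {within I01, continuous f} ->
  forall e, 0 < e -> exists n0 : nat, forall u v, I01 u -> I01 v ->
    `|u - v| <= n0.+1%:R^-1 -> `|f u - f v| <= e.
Proof.
move=> cf; apply: (@heine01 (fun u v => `|f u - f v|)).
- by move=> u v; rewrite distrC.
- by move=> u v w; exact: ler_distD.
- exact: within_continuousP.
Qed.

Lemma within_bounded (f : R -> R) : {within I01, continuous f} ->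
  exists M, forall v, I01 v -> `|f v| <= M.
Proof.
move=> cf; have [n0 n0P] := heine_within cf ltr01.
have [c _ cP] := @EVT_max R f 0 1 ler01 cf.
have [c' _ cP'] := @EVT_min R f 0 1 ler01 cf.
exists (`|f c| + `|f c'|) => v Iv.
have := cP v Iv; have := cP' v Iv; rewrite ler_norml.
have := ler_norm (f c); have := ler_norm (- f c'); rewrite normrN.
have := normr_ge0 (f c); have := normr_ge0 (f c').
by move=> ? ? ? ? ? ?; apply/andP; split; lra.
Qed.

Lemma within_measurable (f : R -> R) : {within I01, continuous f} -> measurable_fun I01 f.
Proof. by move=> cf; apply: subspace_continuous_measurable_fun. Qed.

End heine.

Section ultra.
Context {R : realType}.

Lemma cvg_ler (I : Type) (F : set_system I) {FF : ProperFilter F} (f g : I -> R) (l l' : R) :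
  f @ F --> l -> g @ F --> l' -> (forall i, f i <= g i) -> l <= l'.
Proof.
move=> fl gl fg; rewrite leNgt; apply/negP => ll.
have e0 : 0 < (l - l') / 2 by lra.
have nf : F [set i | `|l - f i| < (l - l') / 2].
  by move/cvgrPdist_lt : fl => /(_ _ e0).
have ng : F [set i | `|l' - g i| < (l - l') / 2].
  by move/cvgrPdist_lt : gl => /(_ _ e0).
have [i [/=]] := filter_ex (filterI nf ng).
rewrite !ltr_norml => /andP[_ h1] /andP[h2 _].
by have := fg i; lra.
Qed.

Lemma cvg_sum_ord (I : Type) (F : set_system I) {FF : Filter F} (f : nat -> I -> R)
    (l : nat -> R) (n : nat) : (forall j, f j @ F --> l j) ->
  (fun i => \sum_(j < n) f j i) @ F --> \sum_(j < n) l j.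
Proof.
move=> fl; elim: n => [|n IH].
  rewrite big_ord0; under eq_fun do rewrite big_ord0; exact: cvg_cst.
rewrite big_ord_recr/=; under eq_fun do rewrite big_ord_recr/=.
by apply: cvgD.
Qed.

(** A cluster point along an ultrafilter is a limit: the preimage of a neighbourhood or that of its
    complement belongs to the filter, and the latter contradicts clustering. *)
Lemma ultra_bounded_cvg (I : Type) (F : set_system I) (f : I -> R) (M : R) :
  UltraFilter F -> (forall i, `|f i| <= M) -> exists l : R, f i @[i --> F] --> l.
Proof.
move=> UF fM.
have cpt := @segment_compact R (- M) M.
have [|p [_ clp]] := cpt (f @ F) _.
  by apply: nearW => i /=; rewrite in_itv/= -ler_norml.
exists p => A pA.
have [//|FnA] := in_ultra_setVsetC (f @^-1` A) UF.
have [x [nAx Ax]] := clp (~` A) A FnA pA.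
by [].
Qed.

End ultra.

Section borel_probability.
Context {R : realType}.
Variable Q : probability (measurableTypeR R) R.

(* The same set function, seen on R with its default Borel display. *)
Definition reborel (A : set R) : \bar R := Q A.

Let reborel0 : reborel set0 = 0%E. Proof. exact: measure0. Qed.

Let reborel_ge0 A : (0 <= reborel A)%E. Proof. exact: measure_ge0. Qed.

Let reborel_sigma_additive : semi_sigma_additive reborel.
Proof. by move=> A mA tA mUA; exact: (@measure_semi_sigma_additive _ _ _ Q A). Qed.

HB.instance Definition _ := isMeasure.Build _ R R reborel reborel0 reborel_ge0
  reborel_sigma_additive.

Let reborelT : reborel setT = 1%E. Proof. exact: (probability_setT Q). Qed.

HB.instance Definition _ := Measure_isProbability.Build _ R R reborel reborelT.

End borel_probability.

Section mixture.
Context {R : realType} {d : measure_display} {T : measurableType d}.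
Variables (Q1 Q2 : probability T R) (l : R) (l01 : 0 <= l <= 1).

(** The bounds on [l] are an argument so that the probability structure can be attached to the term
    [mixture l01]. *)
Definition mixture (_ : 0 <= l <= 1) (A : set T) : \bar R :=
  (l%:E * Q1 A + (1 - l)%:E * Q2 A)%E.

Local Notation mix := (mixture l01).

Let l0 : 0 <= l. Proof. by have /andP[] := l01. Qed.
Let l1 : 0 <= 1 - l. Proof. by rewrite subr_ge0; have /andP[] := l01. Qed.

Let mixture0 : mix set0 = 0%E.
Proof. by rewrite /mixture !measure0 !mule0 adde0. Qed.

Let mixture_ge0 A : (0 <= mix A)%E.
Proof. by rewrite /mixture adde_ge0// mule_ge0// ?lee_fin. Qed.

Let mixture_sigma_additive : semi_sigma_additive mix.
Proof.
move=> A mA tA mUA.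
pose m := measure_add (mscale (NngNum l0) Q1) (mscale (NngNum l1) Q2).
have E B : mix B = m B by rewrite /m measure_addE.
rewrite E; under eq_fun do under eq_bigr do rewrite E.
exact: measure_semi_sigma_additive.
Qed.

HB.instance Definition _ := isMeasure.Build _ T R mix mixture0 mixture_ge0
  mixture_sigma_additive.

Let mixtureT : mix setT = 1%E.
Proof.
rewrite /mixture (probability_setT Q1) (probability_setT Q2) !mule1 -EFinD.
by congr EFin; ring.
Qed.

HB.instance Definition _ := Measure_isProbability.Build _ T R mix mixtureT.

End mixture.

Section distribution_functions.
Context {R : realType}.
Local Notation I01 := (`[0, 1]%classic : set R).

Definition cdfm (Q : probability R R) (x : R) : R := fine (Q `]-oo, x]%classic).

Lemma cdfmE Q x : (cdfm Q x)%:E = Q `]-oo, x]%classic.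
Proof. by rewrite /cdfm fineK//; apply: fin_num_measure; exact: measurable_itv. Qed.

Lemma cdfm_le Q x y : x <= y -> cdfm Q x <= cdfm Q y.
Proof.
move=> xy; rewrite -lee_fin !cdfmE; apply: le_prob; [exact: measurable_itv..|].
by move=> z /=; rewrite !in_itv/= => /le_trans; apply.
Qed.

Lemma cdfm_ge0 Q x : 0 <= cdfm Q x.
Proof. by rewrite -lee_fin cdfmE measure_ge0. Qed.

Lemma cdfm_le1 Q x : cdfm Q x <= 1.
Proof. by rewrite -lee_fin cdfmE probability_le1//; exact: measurable_itv. Qed.

Lemma prob01_out (Q : prob01 R) (A : set R) : measurable A -> A `&` I01 = set0 -> Q A = 0%E.
Proof.
move=> mA A0.
have : (Q (A `|` I01) = Q A + Q I01)%E by rewrite measureU.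
rewrite p01_supp => QU.
have : (Q (A `|` I01) <= 1)%E by rewrite probability_le1//; exact: measurableU.
rewrite QU -[leRHS]add0e leeD2rE// => Q0.
by apply/eqP; rewrite eq_le Q0 measure_ge0.
Qed.

Lemma cdfm_lt0 (Q : prob01 R) x : x < 0 -> cdfm Q x = 0.
Proof.
move=> x0; rewrite /cdfm (_ : Q _ = 0%E)//.
apply: prob01_out; first exact: measurable_itv.
apply/seteqP; split => // z [] /=; rewrite !in_itv/= => zx /andP[z0 _].
by have := lt_le_trans x0 z0; rewrite ltNge zx.
Qed.

Lemma cdfm_ge1 (Q : prob01 R) x : 1 <= x -> cdfm Q x = 1.
Proof.
move=> x1; apply/le_anti; rewrite cdfm_le1/= -lee_fin cdfmE -(p01_supp Q).
apply: le_prob; [exact: measurable_itv..|].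
by move=> z /=; rewrite !in_itv/= => /andP[_ /le_trans]; apply.
Qed.

(** The measure is the Lebesgue-Stieltjes measure of [H], moved to the default Borel display by
    [reborel]; continuity along increasing unions recovers its values on half-lines. *)
Lemma prob01_cdf (H : R -> R) : {homo H : x y / x <= y} ->
  (forall x, H y @[y --> x^'+] --> H x) ->
  (forall x, x < 0 -> H x = 0) -> (forall x, 1 <= x -> H x = 1) ->
  exists nu : prob01 R, forall x, cdfm nu x = H x.
Proof.
move=> Hnd Hrc H0 H1.
have HNy : H x @[x --> -oo] --> (0 : R).
  by apply: cvg_near_cst; exists (0 : R); split; [exact: num_real|move=> x /H0 ->].
have Hy : H x @[x --> +oo] --> (1 : R).
  by apply: cvg_near_cst; exists (1 : R); split; [exact: num_real|move=> x /ltW /H1 ->].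
pose Hc : cumulativeBounded (0 : R) (1 : R) := HB.pack H
  (isCumulative.Build R _ R H Hnd Hrc) (isCumulativeBounded.Build R 0 1 H HNy Hy).
pose Q : probability (measurableTypeR R) R :=
  [the probability _ _ of lebesgue_stieltjes_measure Hc].
have Qoc a b : a <= b -> Q `]a, b]%classic = (H b - H a)%:E.
  move=> ab; rewrite /Q/= /lebesgue_stieltjes_measure /measure_extension.
  rewrite measurable_mu_extE/=; last exact: is_ocitv.
  by rewrite wlength_itv_bnd.
pose nu0 : probability R R := [the probability R R of reborel Q].
have nuE x : nu0 `]-oo, x]%classic = (H x)%:E.
  (* The left end is at most -1, where [H] vanishes, and at most [x], so the interval formula
     applies. *)
  pose A n : set R := `](Num.min (-1) x - n%:R), x]%classic.
  have AE : `]-oo, x]%classic = \bigcup_n A n.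
    apply/seteqP; split=> [y|y [n _]]; rewrite /A /= !in_itv/=; last by case/andP.
    move=> yx; exists (Num.bound (`|y| + `|Num.min (-1) x|)) => //=.
    rewrite in_itv/= yx andbT ltrBlDr.
    have := archi_boundP (addr_ge0 (normr_ge0 y) (normr_ge0 (Num.min (-1) x))).
    have := ler_norm (- y); have := ler_norm (Num.min (-1) x); rewrite normrN; lra.
  have mA n : measurable (A n) by exact: measurable_itv.
  have QA n : nu0 (A n) = (H x)%:E.
    have le1 : Num.min (-1) x - n%:R <= x.
      by rewrite lerBlDr (@le_trans _ _ x)// ?ge_min ?lexx ?orbT// lerDl ler0n.
    rewrite /nu0/= /reborel /A Qoc// (H0 (_ - _)) ?subr0//.
    by rewrite (@le_lt_trans _ _ (-1 : R))// lerBlDr (@le_trans _ _ (-1 : R)) ?ge_min ?lexx// lerDl ler0n.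
  have : nu0 \o A @ \oo --> nu0 (\bigcup_n A n).
    apply: nondecreasing_cvg_mu => //; first exact: bigcup_measurable.
    move=> m n mn; apply/subsetPset => y; rewrite /A /= !in_itv/= => /andP[h ->].
    by rewrite andbT (le_lt_trans _ h)// lerB// ler_nat.
  rewrite -AE => c1.
  have c2 : nu0 \o A @ \oo --> (H x)%:E by apply: cvg_near_cst; apply: nearW => n; exact: QA.
  exact: (cvg_unique _ c1 c2).
have neg0 : nu0 `]-oo, 0[%classic = 0%E.
  pose A n : set R := `]-oo, (- n.+1%:R^-1)]%classic.
  have AE : `]-oo, 0[%classic = \bigcup_n A n.
    apply/seteqP; split=> [y|y [n _]]; rewrite /A /= !in_itv/=; last first.
      by move=> /le_lt_trans; apply; rewrite oppr_lt0 invr_gt0.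
    move=> y0; exists (Num.bound ((- y)^-1)) => //=.
    rewrite in_itv/= -lerN2 opprK invf_ple ?posrE ?oppr_gt0//.
    have yi : 0 <= (- y)^-1 by rewrite invr_ge0 oppr_ge0 ltW.
    by rewrite ltW// (lt_trans (archi_boundP yi))// ltr_nat.
  have mA n : measurable (A n) by exact: measurable_itv.
  have : nu0 \o A @ \oo --> nu0 (\bigcup_n A n).
    apply: nondecreasing_cvg_mu => //; first exact: bigcup_measurable.
    move=> m n mn; apply/subsetPset => y; rewrite /A /= !in_itv/= => /le_trans; apply.
    by rewrite lerN2 lef_pV2 ?posrE// ler_nat.
  rewrite -AE => c1.
  have c2 : nu0 \o A @ \oo --> 0%E.
    apply: cvg_near_cst; apply: nearW => n.
    by rewrite /= /A nuE H0// oppr_lt0 invr_gt0.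
  exact: (cvg_unique _ c1 c2).
have supp : nu0 I01 = 1%E.
  pose A1 : set R := `]-oo, 1]%classic.
  pose A0 : set R := `]-oo, 0[%classic.
  have U : (nu0 A1 = nu0 A0 + nu0 I01)%E.
    rewrite -measureU; [|exact: measurable_itv|exact: measurable_itv|].
      congr (nu0 _); apply/seteqP; split=> y; rewrite /A1 /A0/= !in_itv/=.
        by move=> ->; rewrite andbT; case: (ltP y 0) => _; [left|right].
      by case=> [y0|/andP[//]]; rewrite ltW// (lt_trans y0).
    apply/seteqP; split => // y []; rewrite /A0/= !in_itv/= => y0 /andP[].
    by rewrite leNgt y0.
  by move: U; rewrite /A0 neg0 add0e /A1 nuE H1.
by exists (Prob01 supp) => x; rewrite /cdfm /= nuE.
Qed.

End distribution_functions.

(** * Weak limits through distribution functions *)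

Section weak_limits.
Context {R : realType}.
Local Notation I01 := (`[0, 1]%classic : set R).

Let mI01 : measurable I01. Proof. exact: measurable_itv. Qed.

Definition E01 (mu : prob01 R) (f : R -> R) : R := \int[mu]_(v in I01) f v.

Lemma prob01_integrable (Q : prob01 R) (f : R -> R) (M : R) : measurable_fun I01 f ->
  (forall v, I01 v -> `|f v| <= M) -> Q.-integrable I01 (EFin \o f).
Proof.
move=> mf fM; apply: measurable_bounded_integrable => //.
  by apply: (le_lt_trans (probability_le1 Q mI01)); exact: ltry.
exists M; split => [|N MN x Ix]; first exact: num_real.
exact: le_trans (fM x Ix) (ltW MN).
Qed.

Lemma Rintegral_cdf (Q : prob01 R) (x : R) :
  \int[Q]_(v in I01) (v <= x)%R%:R = cdfm Q x.
Proof.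
have -> : (\int[Q]_(v in I01) (v <= x)%R%:R : R) = \int[Q]_(v in I01) \1_(`]-oo, x]%classic : set R) v.
  apply: eq_Rintegral => v _; rewrite indicE.
  by rewrite (_ : (v \in _) = (v <= x))//; apply/idP/idP; rewrite inE/= in_itv.
rewrite /Rintegral integral_indic// /cdfm; congr fine.
rewrite -[in RHS](setUIDK `]-oo, x]%classic I01).
rewrite measureU; [|exact: measurableI|exact: measurableD|]; last first.
  by rewrite setDE setIACA setICr setI0.
rewrite [X in (_ + X)%E](_ : _ = 0%E) ?adde0//.
by apply: prob01_out; [exact: measurableD|rewrite setDE -setIA setICl setI0].
Qed.

(* The Riemann sum of f with tags j/(N+1) and division points x_j, where
   x_j lies between the tags (j-1)/(N+1) and j/(N+1). *)
Definition step_sum (Q : probability R R) (N : nat) (x : nat -> R) (f : R -> R) : R :=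
  \sum_(j < N.+2) f (j%:R / N.+1%:R) * (cdfm Q (x j.+1) - cdfm Q (x j)).

(** Each division point may move within its window, which lets it avoid the atoms of a prescribed
    limit measure. *)
Definition interlaced (N : nat) (x : nat -> R) : Prop :=
  forall j, (j%:R - 1) / N.+1%:R < x j < j%:R / N.+1%:R.

Lemma interlaced_tag (N j : nat) : (j < N.+2)%N -> I01 (j%:R / N.+1%:R).
Proof.
move=> jN; rewrite /= in_itv/= divr_ge0//= ler_pdivrMr// mul1r ler_nat.
by rewrite -ltnS.
Qed.

Lemma interlaced_le N x j : interlaced N x -> x j <= x j.+1.
Proof.
move=> ix; have /andP[_ h1] := ix j; have /andP[h2 _] := ix j.+1.
have E : j.+1%:R - 1 = j%:R :> R by rewrite -natr1 addrK.
by rewrite E in h2; exact: ltW (lt_trans h1 h2).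
Qed.

(** The indicators [a j] of the cells ]x_j, x_(j+1)] form a partition of unity on [0, 1], and every
    point of a cell is within 1/(N+1) of its tag, so the oscillation bound integrates against a
    probability. *)
Lemma step_sum_approx (Q : prob01 R) (N : nat) (x : nat -> R) (f : R -> R) (e M : R) :
  interlaced N x -> measurable_fun I01 f -> (forall v, I01 v -> `|f v| <= M) ->
  (forall u v, I01 u -> I01 v -> `|u - v| <= N.+1%:R^-1 -> `|f u - f v| <= e) ->
  `|\int[Q]_(v in I01) f v - step_sum Q N x f| <= e.
Proof.
move=> ix mf fM fe.
pose a j v : R := (v <= x j.+1)%R%:R - (v <= x j)%R%:R.
have mle y : measurable_fun I01 (fun v : R => (v <= y)%R%:R : R).
  have -> : (fun v : R => (v <= y)%R%:R : R) = \1_(`]-oo, y]%classic : set R).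
    apply/funext => v; rewrite indicE.
    by rewrite (_ : (v \in _) = (v <= y))//; apply/idP/idP; rewrite inE/= in_itv.
  by apply: measurable_funTS; apply: measurable_indic; exact: measurable_itv.
have ile y : Q.-integrable I01 (EFin \o (fun v : R => (v <= y)%R%:R : R)).
  by apply: (@prob01_integrable _ _ 1) => // v _; case: (v <= y); rewrite ?normr1 ?normr0.
have ia j : Q.-integrable I01 (EFin \o a j).
  exact: (integrableB mI01 (ile (x j.+1)) (ile (x j))).
have ifn : Q.-integrable I01 (EFin \o f) by exact: prob01_integrable mf fM.
have a0 j v : 0 <= a j v.
  rewrite /a; have := interlaced_le j ix.
  by case: (leP v (x j)) => h1; case: (leP v (x j.+1)) => h2 /=; rewrite ?mulr1n ?mulr0n; lra.
have atag j v : I01 v -> a j v != 0 -> `|v - j%:R / N.+1%:R| <= N.+1%:R^-1.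
  move=> _; rewrite /a; have /andP[_ h1] := ix j.+1; have /andP[h2 _] := ix j.
  have E : (j%:R - 1) / N.+1%:R = j%:R / N.+1%:R - N.+1%:R^-1 :> R by rewrite mulrBl mul1r.
  have E' : j.+1%:R / N.+1%:R = j%:R / N.+1%:R + N.+1%:R^-1 :> R.
    by rewrite -[j.+1%:R]natr1 mulrDl mul1r.
  move: h1 h2; rewrite E E' {E E'}.
  set t := j%:R / N.+1%:R; set w := N.+1%:R^-1.
  case: (leP v (x j)) => h3; case: (leP v (x j.+1)) => h4 ? ? /=; rewrite ?subrr ?eqxx//.
    by have := interlaced_le j ix; lra.
  by move=> _; rewrite ler_norml; apply/andP; split; lra.
(* The N + 2 cells telescope from x_0 < 0 to x_(N+2) > 1, hence cover [0, 1] including both ends. *)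
have asum v : I01 v -> \sum_(j < N.+2) a j v = 1.
  rewrite /= in_itv/= => /andP[v0 v1].
  rewrite -(big_mkord xpredT (fun j => a j v)) telescope_sumr//.
  have /andP[_ h1] := ix 0%N; have /andP[h2 _] := ix N.+2.
  rewrite mul0r in h1.
  have E : N.+2%:R - 1 = N.+1%:R :> R by rewrite -[N.+2%:R]natr1 addrK.
  rewrite E divff ?gt_eqF// in h2.
  have -> : (v <= x N.+2) by lra.
  by rewrite (_ : (v <= x 0%N) = false) ?subr0//; apply/negbTE; rewrite -ltNge; lra.
pose g v := \sum_(j < N.+2) f (j%:R / N.+1%:R) * a j v.
have ig : Q.-integrable I01 (EFin \o g).
  have -> : EFin \o g = fun v => (\sum_(j < N.+2) (f (j%:R / N.+1%:R))%:E * (a j v)%:E)%E.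
    by apply/funext => v; rewrite /g/= -sumEFin.
  by apply: integrable_sum => // j _; apply: integrableZl => //; exact: ia.
have -> : step_sum Q N x f = \int[Q]_(v in I01) g v.
  rewrite /step_sum /Rintegral.
  under [X in _ = fine X]eq_integral do rewrite /g -sumEFin.
  rewrite integral_sum//; last first.
    by move=> j; exact: (integrableZl mI01 _ (ia j)).
  rewrite -(_ : \sum_(j < N.+2) (f (j%:R / N.+1%:R) * (cdfm Q (x j.+1) - cdfm Q (x j)))%:E =
    \sum_(j < N.+2) \int[Q]_(v in I01) (f (j%:R / N.+1%:R) * a j v)%:E)%E.
    by rewrite sumEFin.
  apply: eq_bigr => j _; under eq_integral do rewrite EFinM.
  have -> : (\int[Q]_(v in I01) ((f (j%:R / N.+1%:R))%:E * (a j v)%:E) =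
      (f (j%:R / N.+1%:R))%:E * \int[Q]_(v in I01) (a j v)%:E)%E.
    exact: (integralZl mI01 (ia j)).
  have -> : (\int[Q]_(v in I01) (a j v)%:E = (cdfm Q (x j.+1) - cdfm Q (x j))%:E)%E.
    rewrite -!Rintegral_cdf -RintegralB// /Rintegral fineK//.
    exact: (integrable_fin_num mI01 (ia j)).
  by [].
rewrite -RintegralB//.
have ifg : Q.-integrable I01 (EFin \o (fun v => f v - g v)) by exact: (integrableB mI01 ifn ig).
apply: (le_trans (le_normr_Rintegral mI01 ifg)).
have ice : Q.-integrable I01 (EFin \o (fun=> e)).
  by apply: (@prob01_integrable _ _ `|e|).
apply: (@le_trans _ _ (\int[Q]_(v in I01) e)).
  apply: le_Rintegral => //; first exact: integrable_norm.
  move=> v Iv.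
  have e1 (r : R) : r = \sum_(j < N.+2) r * a j v by rewrite -mulr_sumr asum// mulr1.
  rewrite {1}(e1 (f v)) /g -sumrB [leRHS]e1.
  apply: (le_trans (ler_norm_sum _ _ _)); apply: ler_sum => j _.
  rewrite -mulrBl normrM (ger0_norm (a0 j v)).
  have [->|aj] := eqVneq (a j v) 0; first by rewrite !mulr0.
  rewrite ler_wpM2r//; apply: fe => //; first exact: interlaced_tag.
  exact: atag.
rewrite Rintegral_cst// -[leRHS]mulr1 le_eqVlt; apply/orP; left; apply/eqP.
by congr (e * _); exact: (congr1 fine (p01_supp Q)).
Qed.

(** The atoms of [Q] are those of the identity as a random variable: a countable set, which cannot
    fill an interval of positive length. *)
Lemma prob01_nonatom (Q : probability R R) (u v : R) : u < v ->
  exists x, u < x < v /\ Q [set x] = 0%E.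
Proof.
move=> uv; apply: contrapT => /forallNP H.
have mid : measurable_fun setT (fun x : R => x) by exact: measurable_id.
pose X : {mfun R >-> R} := HB.pack (fun x : R => x) (isMeasurableFun.Build _ _ _ _ _ mid).
have sub : `]u, v[%classic `<=` [set r | 0 < pmf (P := Q) X r].
  move=> x /=; rewrite in_itv/= => uxv; rewrite lt_neqAle pmf_ge0 andbT.
  apply/negP => /eqP x0; apply: (H x); split => //.
  have fq : Q [set x] \is a fin_num by apply: fin_num_measure; exact: measurable_set1.
  by rewrite -(fineK fq); congr EFin; exact: esym x0.
have := countable_lebesgue_measure0 (sub_countable (subset_card_le sub) (pmf_gt0_countable (P := Q) X)).
rewrite lebesgue_measure_itv/= lte_fin uv -EFinB => -[] h.
by move: uv; rewrite -subr_gt0 h ltxx.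
Qed.

(** Helly's selection theorem along an ultrafilter. Distribution functions converge pointwise, the
    limit is made right-continuous, and integrals are compared through Riemann sums cut at points
    that carry no mass of the limit. *)
Lemma prob01_ultra_cvg (F : set_system (prob01 R)) : UltraFilter F ->
  exists nu : prob01 R, forall f : R -> R, {within I01, continuous f} ->
    E01 mu f @[mu --> F] --> E01 nu f.
Proof.
move=> UF.
have G_ex x : exists l : R, (fun mu : prob01 R => cdfm mu x) @ F --> l.
  by apply: (@ultra_bounded_cvg _ _ _ _ 1) => mu; rewrite ger0_norm ?cdfm_ge0 ?cdfm_le1.
pose G x := sval (cid (G_ex x)).
have GP x : (fun mu : prob01 R => cdfm mu x) @ F --> G x by rewrite /G; case: cid.
have Gnd x y : x <= y -> G x <= G y.
  by move=> xy; apply: (cvg_ler (GP x) (GP y)) => mu; exact: cdfm_le.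
have G0 x : x < 0 -> G x = 0.
  move=> x0; apply: (cvg_unique (@Rhausdorff R) (GP x)).
  by apply: cvg_near_cst; apply: nearW => mu; exact: cdfm_lt0.
have G1 x : 1 <= x -> G x = 1.
  move=> x0; apply: (cvg_unique (@Rhausdorff R) (GP x)).
  by apply: cvg_near_cst; apply: nearW => mu; exact: cdfm_ge1.
(* The pointwise limit [G] may fail to be right-continuous; [H] is its right regularization. *)
pose H x := inf [set G y | y in [set y | x < y]].
have Hinf x : has_inf [set G y | y in [set y | x < y]].
  split; first by exists (G (x + 1)), (x + 1) => //=; lra.
  by exists (G x) => _ [y /= xy <-]; apply: Gnd; exact: ltW.
have HG x y : x < y -> H x <= G y.
  by move=> xy; apply: ge_inf; [case: (Hinf x)|exists y].
have GH x : G x <= H x.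
  apply: lb_le_inf; first by case: (Hinf x).
  by move=> _ [y /= xy <-]; apply: Gnd; exact: ltW.
have Hnd : {homo H : x y / x <= y}.
  move=> x y; rewrite le_eqVlt => /predU1P[->//|xy].
  exact: le_trans (HG _ _ xy) (GH y).
have Hrc x : H y @[y --> x^'+] --> H x.
  apply/cvgrPdist_le => e e0.
  have [_ [y /= xy <-] Gy] := inf_adherent e0 (Hinf x).
  near=> z.
  have xz : x < z by near: z; exact: nbhs_right_gt.
  have zy : z < y by near: z; exact: nbhs_right_lt.
  have h1 := Hnd _ _ (ltW xz); have h2 := HG _ _ zy.
  by rewrite -/(H x) in Gy; rewrite distrC ger0_norm ?subr_ge0//; lra.
have H0 x : x < 0 -> H x = 0.
  move=> x0; apply/le_anti/andP; split; last by rewrite -(G0 _ x0).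
  by rewrite -(G0 (x / 2)); [apply: HG; lra|lra].
have H1 x : 1 <= x -> H x = 1.
  move=> x1; apply/le_anti/andP; split; last by rewrite -(G1 _ x1).
  by rewrite -(G1 (x + 1)); [apply: HG; lra|lra].
have [nu nuE] := prob01_cdf Hnd Hrc H0 H1.
(* For y < x one has H y <= G x, so the mass of ]-oo, x[ is at most G x; without an atom at [x] this
   is the mass of ]-oo, x]. *)
have GnuE x : nu [set x] = 0%E -> G x = cdfm nu x.
  move=> nux; apply/le_anti; rewrite nuE GH/=.
  pose A n : set R := `]-oo, (x - n.+1%:R^-1)]%classic.
  have AE : `]-oo, x[%classic = \bigcup_n A n.
    apply/seteqP; split=> [y|y [n _]]; rewrite /A /= !in_itv/=; last first.
      by move=> /le_lt_trans; apply; rewrite gtrBl invr_gt0.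
    rewrite -subr_gt0 => y0; exists (Num.bound ((x - y)^-1)) => //=.
    rewrite in_itv/= lerBrDl -lerBrDr invf_ple ?posrE//.
    have yi : 0 <= (x - y)^-1 by rewrite invr_ge0 ltW.
    by rewrite ltW// (lt_trans (archi_boundP yi))// ltr_nat.
  have mA n : measurable (A n) by exact: measurable_itv.
  have c1 : nu \o A @ \oo --> nu `]-oo, x[%classic.
    rewrite AE; apply: nondecreasing_cvg_mu => //; first exact: bigcup_measurable.
    move=> m n mn; apply/subsetPset => y; rewrite /A /= !in_itv/= => /le_trans; apply.
    by rewrite lerD2l lerN2 lef_pV2 ?posrE// ler_nat.
  have le1 : (nu `]-oo, x[%classic <= (G x)%:E)%E.
    rewrite -(cvg_lim (@ereal_hausdorff R) c1); apply: lime_le.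
      by apply/cvg_ex; exists (nu `]-oo, x[%classic).
    apply: nearW => n; rewrite /= /A -cdfmE nuE lee_fin; apply: HG.
    by rewrite gtrBl invr_gt0.
  rewrite -lee_fin -nuE cdfmE; apply: le_trans le1.
  have -> : `]-oo, x]%classic = `]-oo, x[%classic `|` [set x].
    apply/seteqP; split=> y /=; rewrite !in_itv/= le_eqVlt.
      by move=> /predU1P[->|->]; [right|left].
    by move=> [->|->]; rewrite ?orbT ?eqxx.
  have dis : `]-oo, x[%classic `&` [set x] = set0.
    by apply/seteqP; split => // y [] /[swap] ->; rewrite /= in_itv/= ltxx.
  have -> // : nu (`]-oo, x[%classic `|` [set x]) = nu `]-oo, x[%classic.
  transitivity (nu `]-oo, x[%classic + nu [set x])%E; last by rewrite nux adde0.
  by apply: measureU; [exact: measurable_itv|exact: measurable_set1|exact: dis].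
exists nu => f cf.
have [M fM] := within_bounded cf.
have mf := within_measurable cf.
apply/cvgrPdist_le => e e0.
have e30 : 0 < e / 3 by rewrite divr_gt0.
have [N fN] := heine_within cf e30.
have x_ex j : exists x, (j%:R - 1) / N.+1%:R < x < j%:R / N.+1%:R /\ nu [set x] = 0%E.
  by apply: prob01_nonatom; rewrite ltr_pM2r ?invr_gt0// gtrBl.
pose x j := sval (cid (x_ex j)).
have xP j : (j%:R - 1) / N.+1%:R < x j < j%:R / N.+1%:R /\ nu [set x j] = 0%E.
  by rewrite /x; case: cid.
have ix : interlaced N x by move=> j; have [] := xP j.
have cS : (fun mu : prob01 R => step_sum mu N x f) @ F --> step_sum nu N x f.
  rewrite /step_sum; apply: (@cvg_sum_ord _ _ F _ (fun j (mu : prob01 R) =>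
    f (j%:R / N.+1%:R) * (cdfm mu (x j.+1) - cdfm mu (x j)))
    (fun j => f (j%:R / N.+1%:R) * (cdfm nu (x j.+1) - cdfm nu (x j)))) => j.
  apply: cvgM; first exact: cvg_cst.
  rewrite -!GnuE; [|by case: (xP j)|by case: (xP j.+1)].
  by apply: cvgB.
have nearS : F [set mu : prob01 R | `|step_sum nu N x f - step_sum mu N x f| <= e / 3].
  by move/cvgrPdist_le : cS => /(_ _ e30).
apply: filterS nearS => mu /= hmu.
have h1 := step_sum_approx nu ix mf fM fN.
have h2 := step_sum_approx mu ix mf fM fN.
move: h1 h2 hmu; rewrite /E01 !ler_norml => /andP[? ?] /andP[? ?] /andP[? ?].
by apply/andP; split; lra.
Unshelve. all: by end_near. Qed.

Lemma weak_cvgP (F : set_system (prob01 R)) (nu : prob01 R) : Filter F ->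
  (forall f : R -> R, {within I01, continuous f} ->
    E01 mu f @[mu --> F] --> E01 nu f) ->
  F --> (nu : initial_topology (@weak_map R)).
Proof.
move=> FF Fnu A /= [_ [[B Bop <-] Bnu sBA]].
have : {ptws, (@weak_map R) @ F --> weak_map nu}.
  apply/cvg_sup => f U /= [_ [[D Dop <-] Dnu sDU]].
  have FD : F [set mu | D (E01 mu (proj1_sig f))].
    by apply: (Fnu (proj1_sig f) (proj2_sig f)); exact: open_nbhs_nbhs.
  by rewrite !nbhs_simpl /=; apply: filterS FD => mu Dmu; exact: sDU.
move=> /(_ B) H.
have FB : F (@weak_map R @^-1` B) by apply: H; apply: open_nbhs_nbhs.
by apply: filterS FB => mu Bmu; exact: sBA.
Qed.

(** Every ultrafilter of probabilities on [0, 1] has a weak limit, so only the stability of [W]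
    under such limits remains. *)
Lemma weakly_compact_ultra (W : set (prob01 R)) :
  (forall (F : set_system (prob01 R)) (nu : prob01 R), UltraFilter F -> F W ->
    (forall f : R -> R, {within I01, continuous f} ->
      E01 mu f @[mu --> F] --> E01 nu f) -> W nu) ->
  weakly_compact W.
Proof.
move=> Wcl; rewrite /weakly_compact compact_ultra => F UF FW.
have [nu nuP] := prob01_ultra_cvg UF.
by exists nu; split; [exact: (Wcl F nu)|exact: weak_cvgP].
Qed.

End weak_limits.

(** * Continuity of the Gaussian characteristic function in the variance *)

Section gcf_continuity.
Context {R : realType}.
Local Notation N := (@cnormal R).

Lemma cvg0P (f : nat -> R) : (forall e, 0 < e -> exists n0, forall n, (n0 <= n)%N -> `|f n| <= e) ->
  f @ \oo --> (0 : R).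
Proof.
move=> H; apply/cvgr0Pnorm_le => e e0; have [n0 n0P] := H e e0.
by exists n0 => // n /= nn; exact: n0P.
Qed.

Lemma cvgr_ltP (f : nat -> R) (l : R) : f @ \oo --> l ->
  forall e, 0 < e -> exists n0, forall n, (n0 <= n)%N -> `|f n - l| <= e.
Proof.
by move=> /cvgrPdist_le H e e0; have [n0 _ n0P] := H _ e0; exists n0 => n nn; rewrite distrC; exact: n0P.
Qed.

(** Continuity at 0 when |x| < dl, and 1 - cos x <= 2 <= 2 x^2 / dl^2 beyond. A quadratic majorant
    integrates to a function of the variance. *)
Lemma cos_near1 (e : R) : 0 < e -> exists2 dl : R, 0 < dl &
  forall x, 1 - cos x <= e + 2 / dl ^+ 2 * x ^+ 2.
Proof.
move=> e0; have := @continuous_cos R 0.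
rewrite /continuous_at cos0 => /cvgrPdist_le /(_ e e0) [dl /= dl0 H].
exists dl => // x; have [xd|xd] := ltP `|x| dl.
  have := H x; rewrite /= sub0r normrN => /(_ xd); rewrite ler_norml => /andP[_ h].
  by rewrite (le_trans h)// lerDl mulr_ge0 ?sqr_ge0// divr_ge0// sqr_ge0.
have h1 : 1 <= (dl ^+ 2)^-1 * x ^+ 2.
  rewrite mulrC ler_pdivlMr ?exprn_gt0// mul1r -[x ^+ 2]real_normK ?num_real//.
  by rewrite ler_sqr ?nnegrE// ltW.
have := cos_max x; rewrite ler_norml => /andP[? ?].
rewrite -mulrA; lra.
Qed.

Lemma gcf_le1 v : 0 <= v -> `|@gcf R v| <= 1.
Proof.
move=> v0; rewrite /gcf; case: ifP => _; first by rewrite normr1.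
have ic : (N (Num.sqrt v)).-integrable setT (EFin \o @cos R).
  apply: (@bounded_integrable _ _ _ _ _ 1) => [|x]; last exact: cos_max.
  exact: measurable_cos.
apply: (le_trans (le_normr_Rintegral measurableT ic)).
rewrite -[leRHS](@Rintegral_cst1 _ _ _ (N (Num.sqrt v))); apply: le_Rintegral => //.
- exact: integrable_norm.
- by apply: (@bounded_integrable _ _ _ _ _ 1) => // x; rewrite normr1.
- by move=> x _; exact: cos_max.
Qed.

Lemma gcf_near1 (e dl : R) : 0 < e -> 0 < dl ->
  (forall x, 1 - cos x <= e + 2 / dl ^+ 2 * x ^+ 2) ->
  forall b, 0 <= b -> 1 - gcf b <= e + 2 / dl ^+ 2 * b.
Proof.
move=> e0 dl0 H b; rewrite le_eqVlt => /predU1P[<-|b0].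
  by rewrite gcf0 subrr mulr0 addr0 ltW.
have s0 : 0 < Num.sqrt b by rewrite sqrtr_gt0.
rewrite /gcf gt_eqF//.
have ic : (N (Num.sqrt b)).-integrable setT (EFin \o @cos R).
  apply: (@bounded_integrable _ _ _ _ _ 1) => [|x]; last exact: cos_max.
  exact: measurable_cos.
have i1 r : (N (Num.sqrt b)).-integrable setT (EFin \o (fun=> r : R)).
  by apply: (@bounded_integrable _ _ _ _ _ `|r|).
have i2 := normal_sqr_integrable s0.
have V2 := normal_second_moment s0; rewrite sqr_sqrtr ?ltW// in V2.
have i3 := integrable_rscale (2 / dl ^+ 2) i2.
have E1 : 1 - \int[N (Num.sqrt b)]_x cos x = \int[N (Num.sqrt b)]_x (1 - cos x).
  by rewrite (RintegralB measurableT (i1 1) ic) Rintegral_cst1.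
have E2 : e + 2 / dl ^+ 2 * b = \int[N (Num.sqrt b)]_x (e + 2 / dl ^+ 2 * x ^+ 2).
  by rewrite (RintegralD measurableT (i1 e) i3) Rintegral_cst1 RintegralZl// V2.
rewrite E1 E2; apply: le_Rintegral; [exact: measurableT| | |by move=> x _; exact: H].
- exact: integrable_rsub.
- exact: integrable_radd.
Qed.

(** For a <= b multiplicativity gives gcf a - gcf b = gcf a (1 - gcf (b - a)), so the estimate near
    variance 0 serves everywhere. *)
Lemma gcf_cvg (v : nat -> R) (l : R) : (forall n, 0 <= v n) ->
  v @ \oo --> l -> (fun n => gcf (v n)) @ \oo --> gcf l.
Proof.
move=> v0 vl.
have l0 : 0 <= l.
  rewrite -(cvg_lim (@Rhausdorff R) vl); apply: limr_ge; last exact: nearW.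
  by apply/cvg_ex; exists l.
have lip (e dl : R) : 0 < e -> 0 < dl ->
    (forall x, 1 - cos x <= e + 2 / dl ^+ 2 * x ^+ 2) ->
    forall a b : R, 0 <= a -> a <= b -> `|gcf a - gcf b| <= e + 2 / dl ^+ 2 * (b - a).
  move=> e0 dl0 H a b a0 ab; have ba0 : 0 <= b - a by rewrite subr_ge0.
  have -> : gcf b = gcf a * gcf (b - a) by rewrite -(gcfD a0 ba0) addrC subrK.
  rewrite -{1}[gcf a]mulr1 -mulrBr.
  have h := gcf_near1 e0 dl0 H ba0.
  have /ler_normlW g1 := gcf_le1 ba0.
  rewrite normrM (ger0_norm (_ : 0 <= 1 - gcf (b - a))) ?subr_ge0//.
  by rewrite (le_trans _ h)// ler_piMl ?subr_ge0// gcf_le1.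
apply/cvgrPdist_le => e e0.
have e20 : 0 < e / 2 by rewrite divr_gt0.
have [dl dl0 H] := cos_near1 e20.
have k0 : 0 < 2 / dl ^+ 2 by rewrite divr_gt0// exprn_gt0.
have e3 : 0 < (e / 2) / (2 / dl ^+ 2) by rewrite divr_gt0.
move/cvgrPdist_le : vl => /(_ _ e3); apply: filterS => n.
rewrite ler_pdivlMr// => hn.
have [vl|lv] := leP (v n) l.
  rewrite distrC (le_trans (lip _ _ e20 dl0 H _ _ (v0 n) vl))//.
  by rewrite ger0_norm ?subr_ge0// in hn; lra.
rewrite (le_trans (lip _ _ e20 dl0 H _ _ l0 (ltW lv)))//.
by rewrite distrC gtr0_norm ?subr_gt0// in hn; lra.
Qed.

End gcf_continuity.

(** * Limits in L2 *)

Section L2_limits.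
Context {R : realType} {d : measure_display} {T : measurableType d}.
Variable P : probability T R.
Implicit Types Y : T -> R.

Definition nrm Y : R := Num.sqrt (ip P Y Y).

Lemma nrm_ge0 Y : 0 <= nrm Y. Proof. exact: sqrtr_ge0. Qed.

Lemma nrm_sqr Y : nrm Y ^+ 2 = ip P Y Y. Proof. by rewrite sqr_sqrtr// ip_ge0. Qed.

Lemma nrm_le Y (e : R) : 0 <= e -> ip P Y Y <= e ^+ 2 -> nrm Y <= e.
Proof. by move=> e0 h; rewrite -(ger0_norm e0) -sqrtr_sqr ler_sqrt// sqr_ge0. Qed.

Lemma ip_add Y Z : L2 P Y -> L2 P Z ->
  ip P (fun w => Y w + Z w) (fun w => Y w + Z w) = ip P Y Y + 2 * ip P Y Z + ip P Z Z.
Proof.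
move=> LY LZ; have LA := L2_add LY LZ.
by rewrite ipDl// !ipDr// (ipC P Z Y); lra.
Qed.

Lemma nrm_add Y Z : L2 P Y -> L2 P Z -> nrm (fun w => Y w + Z w) <= nrm Y + nrm Z.
Proof.
move=> LY LZ; apply: nrm_le; first by rewrite addr_ge0// nrm_ge0.
have := le_trans (ler_norm _) (ip_le LY LZ); rewrite -/(nrm Y) -/(nrm Z) => h.
have E : (nrm Y + nrm Z) ^+ 2 = nrm Y ^+ 2 + 2 * (nrm Y * nrm Z) + nrm Z ^+ 2 by ring.
by rewrite ip_add// E !nrm_sqr; lra.
Qed.

Lemma nrm_dist Y1 Y2 Y3 : L2 P Y1 -> L2 P Y2 -> L2 P Y3 ->
  nrm (fun w => Y1 w - Y3 w) <= nrm (fun w => Y1 w - Y2 w) + nrm (fun w => Y2 w - Y3 w).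
Proof.
move=> L1 L2' L3; have := nrm_add (L2_sub L1 L2') (L2_sub L2' L3).
by under [X in nrm X <= _ -> _]eq_fun do rewrite addrA subrK.
Qed.

Lemma nrm_distC Y1 Y2 : nrm (fun w => Y1 w - Y2 w) = nrm (fun w => Y2 w - Y1 w).
Proof.
by rewrite /nrm; congr Num.sqrt; apply: eq_Rintegral => w _; rewrite -mulrNN !opprB.
Qed.

(** Fatou's lemma in the second index of the Cauchy condition identifies the L2 limit with the given
    pointwise limit. *)
Lemma L2_limit (S : nat -> T -> R) (Y : T -> R) :
  (forall n, L2 P (S n)) -> (forall w, S n w @[n --> \oo] --> Y w) ->
  (forall e, 0 < e -> exists n0, forall n m, (n0 <= n)%N -> (n0 <= m)%N ->
    ip P (fun w => S n w - S m w) (fun w => S n w - S m w) <= e) ->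
  L2 P Y /\ (fun n => nrm (fun w => S n w - Y w)) @ \oo --> (0 : R).
Proof.
move=> LS SY Cau.
have mS n : measurable_fun setT (S n) by exact: L2_meas (LS n).
have mY : measurable_fun setT Y.
  by apply: (measurable_fun_cvg (h := S)) => // w _; exact: SY.
have key e : 0 < e -> exists n0, forall n, (n0 <= n)%N ->
    (\int[P]_w ((S n w - Y w) ^+ 2)%:E <= e%:E)%E.
  move=> e0; have [n0 n0P] := Cau _ e0; exists n0 => n nn.
  apply: (@fatou_le _ _ _ P (fun m w => (S n w - S m w) ^+ 2)) => //.
  - by move=> m; apply: measurable_funX; exact: measurable_funB.
  - by move=> m w; exact: sqr_ge0.
  - move=> w; apply: cvgM; (apply: cvgB; [exact: cvg_cst|exact: SY]).
  - exists n0 => // m /= mm.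
    by rewrite -/(sqexp P (fun w => S n w - S m w)) sqexpE ?lee_fin ?n0P//; exact: L2_sub.
have LSY n e : (\int[P]_w ((S n w - Y w) ^+ 2)%:E <= e%:E)%E -> L2 P (fun w => S n w - Y w).
  by move=> h; apply: sqexp_L2; [exact: measurable_funB|exact: le_lt_trans h (ltry _)].
have LY : L2 P Y.
  have [n0 n0P] := key 1 ltr01.
  have := L2_sub (LS n0) (LSY _ _ (n0P _ (leqnn _))).
  by under eq_fun do rewrite opprB subrKC.
split=> //; apply: cvg0P => e e0.
have [n0 n0P] := key (e ^+ 2) (exprn_gt0 2 e0).
exists n0 => n nn; rewrite ger0_norm ?nrm_ge0//; apply: nrm_le; first exact: ltW.
have := n0P _ nn; rewrite -/(sqexp P (fun w => S n w - Y w)) sqexpE ?lee_fin//.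
exact: L2_sub.
Qed.

Lemma ip_cvg (S : nat -> T -> R) (Y V : T -> R) : (forall n, L2 P (S n)) -> L2 P Y -> L2 P V ->
  (fun n => nrm (fun w => S n w - Y w)) @ \oo --> (0 : R) ->
  (fun n => ip P (S n) V) @ \oo --> ip P Y V.
Proof.
move=> LS LY LV SY; apply/cvgrPdist_le => e e0.
have e1 : 0 < e / (nrm V + 1) by rewrite divr_gt0// ltr_wpDl// nrm_ge0.
move/cvgr0Pnorm_le : SY => /(_ _ e1); apply: filterS => n.
rewrite ger0_norm ?nrm_ge0// ler_pdivlMr ?ltr_wpDl ?nrm_ge0// => h.
rewrite distrC -ipBl//; apply: le_trans (ip_le (L2_sub (LS n) LY) LV) _.
rewrite -/(nrm _) -/(nrm V).
by have := nrm_ge0 (fun w => S n w - Y w); lra.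
Qed.

Lemma ip_cvg2 (S : nat -> T -> R) (Y : T -> R) : (forall n, L2 P (S n)) -> L2 P Y ->
  (fun n => nrm (fun w => S n w - Y w)) @ \oo --> (0 : R) ->
  (fun n => ip P (S n) (S n)) @ \oo --> ip P Y Y.
Proof.
move=> LS LY SY.
have E n : ip P (S n) (S n) =
    nrm (fun w => S n w - Y w) * nrm (fun w => S n w - Y w) + 2 * ip P (S n) Y - ip P Y Y.
  by rewrite -expr2 nrm_sqr ip_sub//; ring.
have -> : (fun n => ip P (S n) (S n)) = (fun n =>
    nrm (fun w => S n w - Y w) * nrm (fun w => S n w - Y w) + 2 * ip P (S n) Y - ip P Y Y).
  by apply/funext.
have : (fun n => nrm (fun w => S n w - Y w) * nrm (fun w => S n w - Y w)
    + 2 * ip P (S n) Y - ip P Y Y) @ \oo --> 0 * 0 + 2 * ip P Y Y - ip P Y Y.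
  apply: cvgB; last exact: cvg_cst.
  apply: cvgD; first exact: cvgM.
  by apply: cvgM; [exact: cvg_cst|exact: ip_cvg].
by have -> : 0 * 0 + 2 * ip P Y Y - ip P Y Y = ip P Y Y by ring.
Qed.

End L2_limits.

Lemma within_modulus {R : realType} (f : R -> R) :
  (forall p e : R, `[0, 1]%classic p -> 0 < e ->
    exists2 dl : R, 0 < dl & forall v, `[0, 1]%classic v -> `|v - p| < dl -> `|f p - f v| <= e) ->
  {within `[0, 1]%classic, continuous f}.
Proof.
move=> H; apply/subspace_continuousP => p Ip; apply/cvgrPdist_le => e e0.
have [dl dl0 dlP] := H p e Ip e0.
by exists dl => //= v /= pv Iv; apply: dlP => //; rewrite distrC.
Qed.

Lemma within_small_cvg {R : realType} (f : R -> R) (v : nat -> R) (p : R) :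
  {within `[0, 1]%classic, continuous f} -> `[0, 1]%classic p ->
  (forall n, `[0, 1]%classic (v n)) -> (forall n, `|v n - p| < n.+1%:R^-1) ->
  f (v n) @[n --> \oo] --> f p.
Proof.
move=> cf Ip Iv vp; apply/cvgrPdist_le => e e0.
have [dl dl0 dlP] := within_continuousP cf Ip e0.
exists (Num.bound dl^-1) => // n /= nn; apply: dlP => //; apply: lt_trans (vp n) _.
rewrite invf_plt ?posrE//; apply: lt_le_trans (archi_boundP _) _; first by rewrite invr_ge0 ltW.
by rewrite ler_nat (leq_trans nn).
Qed.

Lemma measurable_ge_set {R : realType} {d : measure_display} {T : measurableType d}
  (f : T -> R) (c : R) : measurable_fun setT f -> measurable [set w | c <= f w].
Proof.
move=> mf; have := mf measurableT `[c, +oo[%classic (measurable_itv _).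
by congr measurable; apply/seteqP; split=> w; rewrite /= in_itv/= andbT => // -[].
Qed.

(** * Gaussian processes with continuous paths *)

Section process.
Context {R : realType} {d : measure_display} {T : measurableType d}.
Variable P : probability T R.
Variable Z : R -> T -> R.
Local Notation I01 := (`[0, 1]%classic : set R).
Implicit Types (s : seq (R * R)) (Y V : T -> R).

Definition lz s : T -> R := fun w => \sum_(p <- s) p.1 * Z p.2 w.

Definition tagged01 s : Prop := forall p, p \in s -> I01 p.2.

Lemma lz_cat s1 s2 w : lz (s1 ++ s2) w = lz s1 w + lz s2 w.
Proof. by rewrite /lz big_cat. Qed.

Lemma lz_scale r s w : lz [seq (r * p.1, p.2) | p <- s] w = r * lz s w.
Proof. by rewrite /lz big_map mulr_sumr; apply: eq_bigr => p _; rewrite mulrA. Qed.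

Lemma lz1 v : lz [:: (1, v)] = Z v.
Proof. by apply/funext => w; rewrite /lz big_seq1 mul1r. Qed.

Lemma lz2 u v : lz [:: (1, u); (-1, v)] = fun w => Z u w - Z v w.
Proof. by apply/funext => w; rewrite /lz big_cons big_seq1/= mul1r mulN1r. Qed.

Lemma tagged_cat s1 s2 : tagged01 s1 -> tagged01 s2 -> tagged01 (s1 ++ s2).
Proof. by move=> h1 h2 p; rewrite mem_cat => /orP[/h1|/h2]. Qed.

Lemma tagged_scale r s : tagged01 s -> tagged01 [seq (r * p.1, p.2) | p <- s].
Proof. by move=> h p /mapP[q qs ->]; exact: (h q). Qed.

Lemma tagged1 r v : I01 v -> tagged01 [:: (r, v)].
Proof. by move=> Iv p; rewrite inE => /eqP ->. Qed.

Hypothesis Zc : forall w, {within I01, continuous (fun v => Z v w)}.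
Hypothesis Zg : forall s, tagged01 s -> centered_gaussian P (lz s).

Lemma lz_L2 s : tagged01 s -> L2 P (lz s).
Proof. by move=> /Zg /gaussianP[]. Qed.

Lemma Z_L2 v : I01 v -> L2 P (Z v).
Proof. by move=> Iv; rewrite -lz1; apply: lz_L2; exact: tagged1. Qed.

Lemma ip_lz s V : tagged01 s -> L2 P V ->
  ip P (lz s) V = \sum_(p <- s) p.1 * ip P (Z p.2) V.
Proof.
move=> + LV; elim: s => [|p s IH] ts.
  rewrite big_nil /ip (_ : lz [::] = fun=> 0).
    by under eq_Rintegral do rewrite mul0r; exact: Rintegral_cst1.
  by apply/funext => w; rewrite /lz big_nil.
have ts' : tagged01 s by move=> q qs; apply: ts; rewrite inE qs orbT.
have Ip : I01 p.2 by apply: ts; rewrite mem_head.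
rewrite big_cons -IH//.
have -> : lz (p :: s) = fun w => (p.1 * Z p.2 w) + lz s w.
  by apply/funext => w; rewrite /lz big_cons.
rewrite ipDl ?ipZl//; first exact: Z_L2.
- by apply: L2_scale; exact: Z_L2.
- exact: lz_L2.
Qed.

(* If Z(v_n) stayed at L2-distance e from Z(p), the Gaussian variables Z(p) - Z(v_n)
   would put mass at most 1/2 on [-e/2, e/2], against their pointwise convergence to 0. *)
Lemma Z_L2_continuous (p e : R) : I01 p -> 0 < e ->
  exists2 dl : R, 0 < dl & forall v, I01 v -> `|v - p| < dl ->
    nrm P (fun w => Z p w - Z v w) <= e.
Proof.
move=> Ip e0; apply: contrapT => H.
have {}H n : exists v, [/\ I01 v, `|v - p| < n.+1%:R^-1 & e < nrm P (fun w => Z p w - Z v w)].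
  apply: contrapT => H'; apply: H; exists n.+1%:R^-1 => // v Iv vp.
  by rewrite leNgt; apply/negP => h; apply: H'; exists v.
pose v n := sval (cid (H n)).
have vP n : [/\ I01 (v n), `|v n - p| < n.+1%:R^-1 & e < nrm P (fun w => Z p w - Z (v n) w)].
  by rewrite /v; case: cid.
pose D n w := Z p w - Z (v n) w.
have gD n : centered_gaussian P (D n).
  rewrite /D -lz2; apply: Zg => q; rewrite !inE => /orP[|] /eqP -> //=.
  by have [] := vP n.
have mD n : measurable_fun setT (D n) by case: (gD n).
pose A n : set T := [set w | (`|D n w| <= e / 2)%R].
have mA n : measurable (A n).
  have mN : measurable_fun setT (fun w => - `|D n w|).
    by apply: measurableT_comp => //; exact: measurableT_comp.
  have := measurable_ge_set (- (e / 2)) mN.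
  by congr measurable; apply/seteqP; split=> w /=; rewrite lerN2.
have half n : \int[P]_w (\1_(A n) w : R) <= 1 / 2.
  have [_ _ _ /(_ (e / 2) _) h _] := gaussianP (gD n).
  have := h (ltW (divr_gt0 e0 (ltr0n _ 2))).
  rewrite -/(A n) -/(nrm P (D n)).
  have fA : P (A n) \is a fin_num by exact: fin_num_measure.
  rewrite /Rintegral integral_indic// setIT -{1}(fineK fA) -EFinM lee_fin => h1.
  have [_ _ h2] := vP n; rewrite -/(D n) in h2.
  have p0 : 0 <= fine (P (A n)) by exact/fine_ge0/measure_ge0.
  have h3 : e * fine (P (A n)) <= e * (1 / 2).
    by apply: le_trans (_ : nrm P (D n) * fine (P (A n)) <= _); [rewrite ler_wpM2r// ltW|lra].
  by rewrite ler_pM2l in h3.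
have [|n w|w|_ cvI] := @bounded_convergence _ _ _ P (fun n w => \1_(A n) w) (fun=> 1) 1.
- by move=> n; exact: measurable_indic.
- by rewrite indicE; case: (_ \in _); rewrite ?normr1 ?normr0.
- have Dw : D n w @[n --> \oo] --> Z p w - Z p w.
    apply: cvgB; first exact: cvg_cst.
    have Iv n' : I01 (v n') by have [] := vP n'.
    have pv n' : `|v n' - p| < n'.+1%:R^-1 by have [] := vP n'.
    exact: (within_small_cvg (@Zc w) Ip Iv pv).
  rewrite subrr in Dw.
  have e20 : 0 < e / 2 by rewrite divr_gt0.
  move/cvgr0Pnorm_le : Dw => /(_ _ e20) [n0 _ n0P].
  apply: cvg_near_cst; exists n0 => // n /= nn.
  by rewrite indicE mem_set//; exact: n0P.
rewrite Rintegral_cst1 in cvI.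
have h : (1 : R) <= 1 / 2 by apply: (cvg_ler cvI (cvg_cst _) half).
lra.
Qed.

Lemma Z_heine (e : R) : 0 < e -> exists n0 : nat, forall u v, I01 u -> I01 v ->
  `|u - v| <= n0.+1%:R^-1 -> nrm P (fun w => Z u w - Z v w) <= e.
Proof.
(* The process is frozen at [Z 0] outside [0, 1], so that the L2 distance obeys the triangle
   inequality on the whole line, as [heine01] requires. *)
move=> e0; pose C v := if (0 <= v <= 1) then Z v else Z 0.
have I0 : I01 0 by rewrite /= in_itv/= lexx ler01.
have CE v : I01 v -> C v = Z v by rewrite /C /= in_itv/= => ->.
have LC v : L2 P (C v).
  by rewrite /C; case: ifPn => h; apply: Z_L2 => //; rewrite /= in_itv.
have [|||n0 n0P] := @heine01 _ (fun u v => nrm P (fun w => C u w - C v w)) _ _ _ e e0.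
- by move=> u v; exact: nrm_distC.
- by move=> u v w; exact: nrm_dist.
- move=> p e' Ip /(Z_L2_continuous Ip)[dl dl0 H]; exists dl => // v Iv vp.
  by rewrite !CE//; exact: H.
by exists n0 => u v Iu Iv /(n0P u v Iu Iv); rewrite !CE.
Qed.

Lemma nrm_lipschitz Y V : L2 P Y -> L2 P V ->
  `|nrm P Y - nrm P V| <= nrm P (fun w => Y w - V w).
Proof.
have key A B : L2 P A -> L2 P B -> nrm P A - nrm P B <= nrm P (fun w => A w - B w).
  move=> LA LB; have := nrm_add (L2_sub LA LB) LB.
  rewrite (_ : (fun w => _) = A); first lra.
  by apply/funext => w; rewrite subrK.
move=> LY LV; rewrite ler_norml; have := key _ _ LY LV; have := key _ _ LV LY.
rewrite (nrm_distC P V Y); lra.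
Qed.

Lemma nrm_Z_bounded : exists2 M : R, 0 < M & forall v, I01 v -> nrm P (Z v) <= M.
Proof.
have [|M MP] := @within_bounded _ (fun v => nrm P (Z v)).
  apply: within_modulus => p e Ip e0; have [dl dl0 H] := Z_L2_continuous Ip e0.
  exists dl => // v Iv vp; apply: le_trans (nrm_lipschitz (Z_L2 Ip) (Z_L2 Iv)) (H v Iv vp).
exists (`|M| + 1); first by rewrite ltr_wpDl.
move=> v Iv; apply: le_trans (ler_norm _) _.
by rewrite (le_trans (MP v Iv))// (le_trans (ler_norm _))// lerDl.
Qed.

Lemma ip_Z_continuous V : L2 P V -> {within I01, continuous (fun v => ip P (Z v) V)}.
Proof.
move=> LV; apply: within_modulus => p e Ip e0.
have e1 : 0 < e / (nrm P V + 1) by rewrite divr_gt0// ltr_wpDl// nrm_ge0.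
have [dl dl0 H] := Z_L2_continuous Ip e1.
exists dl => // v Iv vp; rewrite -ipBl ?Z_L2//; [|exact: Z_L2|exact: Z_L2].
apply: le_trans (ip_le (L2_sub (Z_L2 Ip) (Z_L2 Iv)) LV) _.
rewrite -/(nrm P _) -/(nrm P V).
have := H v Iv vp; rewrite ler_pdivlMr ?ltr_wpDl ?nrm_ge0// => h.
by have := nrm_ge0 P (fun w => Z p w - Z v w); lra.
Qed.

(* The closure of the span of Z under limits that are both pointwise and in L2:
   it contains every variable below and its elements are genuine functions, not classes. *)
Definition gsp Y : Prop := exists c : nat -> seq (R * R),
  [/\ forall n, tagged01 (c n), forall w, lz (c n) w @[n --> \oo] --> Y w, L2 P Y &
      (fun n => nrm P (fun w => lz (c n) w - Y w)) @ \oo --> (0 : R)].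

Lemma gsp_L2 Y : gsp Y -> L2 P Y. Proof. by case=> c []. Qed.

Lemma gsp_add Y V : gsp Y -> gsp V -> gsp (fun w => Y w + V w).
Proof.
move=> [c [tc cY LY nY]] [c' [tc' cV LV nV]]; exists (fun n => c n ++ c' n).
have E n : lz (c n ++ c' n) = fun w => lz (c n) w + lz (c' n) w.
  by apply/funext => w; exact: lz_cat.
split.
- by move=> n; exact: tagged_cat.
- by move=> w; under eq_fun do rewrite lz_cat; exact: cvgD.
- exact: L2_add.
- have : (fun n => nrm P (fun w => lz (c n) w - Y w) + nrm P (fun w => lz (c' n) w - V w))
      @ \oo --> 0 + (0 : R) by exact: cvgD.
  rewrite addr0; apply: squeeze_cvgr; last exact: cvg_cst.
  apply: nearW => n; rewrite nrm_ge0/= E.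
  rewrite (_ : (fun w => _) = fun w => (lz (c n) w - Y w) + (lz (c' n) w - V w)).
    by apply: nrm_add; apply: L2_sub => //; exact: lz_L2.
  by apply/funext => w; rewrite opprD addrACA.
Qed.

Lemma nrm_scale r Y : L2 P Y -> nrm P (fun w => r * Y w) = `|r| * nrm P Y.
Proof.
move=> LY; have LrY := L2_scale r LY.
by rewrite /nrm ipZl// ipZr// mulrA -expr2 sqrtrM ?sqr_ge0// sqrtr_sqr.
Qed.

Lemma gsp_scale r Y : gsp Y -> gsp (fun w => r * Y w).
Proof.
move=> [c [tc cY LY nY]]; exists (fun n => [seq (r * p.1, p.2) | p <- c n]).
have E n : lz [seq (r * p.1, p.2) | p <- c n] = fun w => r * lz (c n) w.
  by apply/funext => w; exact: lz_scale.
split.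
- by move=> n; exact: tagged_scale.
- by move=> w; under eq_fun do rewrite lz_scale; apply: cvgM => //; exact: cvg_cst.
- exact: L2_scale.
- have : (fun n => `|r| * nrm P (fun w => lz (c n) w - Y w)) @ \oo --> `|r| * (0 : R).
    by apply: cvgM => //; exact: cvg_cst.
  rewrite mulr0 (_ : (fun n => _) = (fun n =>
    nrm P (fun w => lz [seq (r * p.1, p.2) | p <- c n] w - r * Y w)))//.
  apply/funext => n; rewrite E -nrm_scale; last by apply: L2_sub => //; exact: lz_L2.
  by congr nrm; apply/funext => w; rewrite mulrBr.
Qed.

Lemma gsp_sub Y V : gsp Y -> gsp V -> gsp (fun w => Y w - V w).
Proof.
move=> gY gV; have := gsp_add gY (gsp_scale (-1) gV).
by under [X in gsp X -> _]eq_fun do rewrite mulN1r.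
Qed.

Lemma gsp_lz s : tagged01 s -> gsp (lz s).
Proof.
move=> ts; exists (fun=> s); split=> //.
- by move=> w; exact: cvg_cst.
- exact: lz_L2.
- have -> : (fun=> nrm P (fun w => lz s w - lz s w)) = fun _ : nat => (0 : R).
    apply/funext => n; rewrite /nrm /ip.
    by under eq_Rintegral do rewrite subrr mulr0; rewrite Rintegral_cst1 sqrtr0.
  exact: cvg_cst.
Qed.

Lemma gsp_Z v : I01 v -> gsp (Z v).
Proof. by move=> Iv; rewrite -lz1; apply: gsp_lz; exact: tagged1. Qed.

Lemma gsp_char Y : gsp Y -> \int[P]_w cos (Y w) = gcf (ip P Y Y) /\ \int[P]_w sin (Y w) = 0.
Proof.
move=> [c [tc cY LY nY]].
have Ls n := lz_L2 (tc n).
have C n := gaussianP (Zg (tc n)).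
have [mc ccos] : measurable_fun setT (fun w => cos (Y w)) /\
    \int[P]_w cos (lz (c n) w) @[n --> \oo] --> \int[P]_w cos (Y w).
  apply: (@bounded_convergence _ _ _ P (fun n w => cos (lz (c n) w)) _ 1).
  - move=> n; apply: measurableT_comp (L2_meas (Ls n)).
    exact: measurable_cos.
  - by move=> n w; exact: cos_max.
  - by move=> w; apply: continuous_cvg => //; exact: continuous_cos.
have [ms csin] : measurable_fun setT (fun w => sin (Y w)) /\
    \int[P]_w sin (lz (c n) w) @[n --> \oo] --> \int[P]_w sin (Y w).
  apply: (@bounded_convergence _ _ _ P (fun n w => sin (lz (c n) w)) _ 1).
  - move=> n; apply: measurableT_comp (L2_meas (Ls n)).
    exact: measurable_sin.
  - by move=> n w; exact: sin_max.
  - by move=> w; apply: continuous_cvg => //; exact: continuous_sin.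
split.
  have cg := gcf_cvg (fun n => ip_ge0 P (lz (c n))) (ip_cvg2 Ls LY nY).
  have E : (fun n => \int[P]_w cos (lz (c n) w)) = fun n => gcf (ip P (lz (c n)) (lz (c n))).
    by apply/funext => n; have [_ _ [-> _] _ _] := C n.
  rewrite E in ccos; exact: (cvg_unique _ ccos cg).
have E : (fun n => \int[P]_w sin (lz (c n) w)) = fun=> 0.
  by apply/funext => n; have [_ _ [_ ->] _ _] := C n.
rewrite E in csin; exact: (cvg_unique _ csin (cvg_cst (0 : R))).
Qed.

(** Markov's inequality for exp(t Y). Fatou carries the Laplace transform over to the limit as an
    upper bound, which is the direction required. *)
Lemma gsp_chernoff Y h : gsp Y -> 0 < ip P Y Y -> 0 <= h ->
  (P [set w | (h <= Y w)%R] <= (expR (- (h ^+ 2 / (2 * ip P Y Y))))%:E)%E.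
Proof.
move=> [c [tc cY LY nY]] v0 h0; set v := ip P Y Y.
have Ls n := lz_L2 (tc n).
(* This [t] minimizes the exponent t^2 v / 2 - t h. *)
set t := h / v; have t0 : 0 <= t by rewrite divr_ge0// ltW.
have mA : measurable [set w | (h <= Y w)%R].
  exact: measurable_ge_set (L2_meas LY).
have key e : 0 < e -> (\int[P]_w (expR (t * Y w))%:E <= (expR (t ^+ 2 * v / 2) + e)%:E)%E.
  move=> e0; apply: (@fatou_le _ _ _ P (fun n w => expR (t * lz (c n) w))).
  - move=> n; apply: measurableT_comp => //; apply: measurable_funM => //; exact: L2_meas.
  - by move=> n w; exact: expR_ge0.
  - move=> w; apply: continuous_cvg; first exact: continuous_expR.
    by apply: cvgM => //; exact: cvg_cst.
  - have : (fun n => expR (t ^+ 2 * ip P (lz (c n)) (lz (c n)) / 2)) @ \oo -->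
        expR (t ^+ 2 * v / 2).
      apply: continuous_cvg; first exact: continuous_expR.
      apply: cvgM; last exact: cvg_cst.
      by apply: cvgM; [exact: cvg_cst|exact: ip_cvg2].
    move/cvgrPdist_le => /(_ e e0); apply: filterS => n.
    have [_ -> _ _ _] := gaussianP (Zg (tc n)).
    by rewrite lee_fin distrC => /ler_normlW; lra.
have key0 : (\int[P]_w (expR (t * Y w))%:E <= (expR (t ^+ 2 * v / 2))%:E)%E.
  by apply/lee_addgt0Pr => e e0; rewrite -EFinD; exact: key.
have mf : measurable_fun setT (fun w => expR (t * Y w)).
  by apply: measurableT_comp => //; apply: measurable_funM => //; exact: L2_meas LY.
have H : ((expR (t * h))%:E * P [set w | (h <= Y w)%R] <= (expR (t ^+ 2 * v / 2))%:E)%E.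
  apply: le_trans key0; apply: markov_set => // w /= hw.
  by rewrite ler_expR ler_wpM2l.
have fA : P [set w | (h <= Y w)%R] \is a fin_num by exact: fin_num_measure.
move: H; rewrite -(fineK fA) -EFinM !lee_fin => H.
have -> : - (h ^+ 2 / (2 * v)) = t ^+ 2 * v / 2 - t * h.
  by rewrite /t; field; rewrite gt_eqF.
by rewrite expRD expRN ler_pdivlMr ?expR_gt0// mulrC.
Qed.

End process.

(** * Riemann sums against a probability on [0, 1] *)

Section discretization.
Context {R : realType}.
Local Notation I01 := (`[0, 1]%classic : set R).
Implicit Types (mu nu : prob01 R) (f : R -> R).

Let mI01 : measurable I01. Proof. exact: measurable_itv. Qed.

(** Division points common to all measures: the sums are then linear in the measure, whence
    [E01_mixture]. *)
Definition midpt (n j : nat) : R := (j%:R - 2^-1) / n.+1%:R.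

Lemma midpt_interlaced n : interlaced n (midpt n).
Proof.
by move=> j; rewrite /midpt !ltr_pM2r ?invr_gt0 ?ltr0n//; apply/andP; split; lra.
Qed.

Definition disc mu (n : nat) : seq (R * R) :=
  [seq (cdfm mu (midpt n j.+1) - cdfm mu (midpt n j), j%:R / n.+1%:R) | j <- iota 0 n.+2].

Lemma disc_sum mu n f : \sum_(p <- disc mu n) p.1 * f p.2 = step_sum mu n (midpt n) f.
Proof.
rewrite /disc /step_sum big_map (_ : iota 0 n.+2 = index_iota 0 n.+2).
  by rewrite big_mkord; apply: eq_bigr => j _; rewrite mulrC.
by rewrite /index_iota subn0.
Qed.

Lemma disc_tagged mu n : tagged01 (disc mu n).
Proof.
move=> p /mapP[j + ->]; rewrite mem_iota add0n => /andP[_ jn].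
exact: interlaced_tag.
Qed.

Lemma step_sum_norm_le mu n f (e : R) : 0 <= e -> (forall v, I01 v -> `|f v| <= e) ->
  `|step_sum mu n (midpt n) f| <= e.
Proof.
move=> e0 fe; apply: le_trans (ler_norm_sum _ _ _) _.
have w0 j : 0 <= cdfm mu (midpt n j.+1) - cdfm mu (midpt n j).
  by rewrite subr_ge0; apply: cdfm_le; apply: interlaced_le; exact: midpt_interlaced.
apply: (@le_trans _ _ (\sum_(j < n.+2) e * (cdfm mu (midpt n j.+1) - cdfm mu (midpt n j)))).
  apply: ler_sum => j _; rewrite normrM (ger0_norm (w0 _)) ler_wpM2r//.
  by apply: fe; exact: interlaced_tag.
rewrite -mulr_sumr ler_piMr//.
rewrite -(big_mkord xpredT (fun j => cdfm mu (midpt n j.+1) - cdfm mu (midpt n j))).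
rewrite telescope_sumr//.
by have := cdfm_le1 mu (midpt n n.+2); have := cdfm_ge0 mu (midpt n 0); lra.
Qed.

Lemma step_sum_approxE mu n0 n f (e : R) : (n0 <= n)%N -> {within I01, continuous f} ->
  (forall u v, I01 u -> I01 v -> `|u - v| <= n0.+1%:R^-1 -> `|f u - f v| <= e) ->
  `|E01 mu f - step_sum mu n (midpt n) f| <= e.
Proof.
move=> nn cf fe; have [M fM] := within_bounded cf.
apply: (@step_sum_approx R mu n (midpt n) f e M (midpt_interlaced n) (within_measurable cf) fM).
move=> u v Iu Iv uv; apply: fe => //; apply: le_trans uv _.
by rewrite lef_pV2 ?posrE ?ltr0n// ler_nat.
Qed.

Lemma step_sum_cvg mu f : {within I01, continuous f} ->
  step_sum mu n (midpt n) f @[n --> \oo] --> E01 mu f.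
Proof.
move=> cf; apply/cvgrPdist_le => e e0; have [n0 n0P] := heine_within cf e0.
by exists n0 => // n /= nn; exact: step_sum_approxE n0P.
Qed.

Lemma within_integrable mu f : {within I01, continuous f} -> mu.-integrable I01 (EFin \o f).
Proof.
move=> cf; have [M fM] := within_bounded cf.
by apply: prob01_integrable fM; exact: within_measurable.
Qed.

Lemma E01_cst mu (c : R) : E01 mu (fun=> c) = c.
Proof.
have h n : step_sum mu n.+1 (midpt n.+1) (fun=> c) = c.
  rewrite /step_sum -mulr_sumr.
  rewrite -(big_mkord xpredT (fun j => cdfm mu (midpt n.+1 j.+1) - cdfm mu (midpt n.+1 j))).
  rewrite telescope_sumr// cdfm_ge1 ?cdfm_lt0 ?subr0 ?mulr1//.
    by rewrite /midpt mulrC pmulr_rlt0 ?invr_gt0 ?ltr0n// add0r; lra.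
  rewrite /midpt ler_pdivlMr ?ltr0n// mul1r -[n.+3]addn1 natrD; lra.
have cc : {within I01, continuous (cst c)} by move=> ?; exact: cst_continuous.
have := @step_sum_cvg mu _ cc; rewrite -(cvg_shiftS (fun n => step_sum mu n (midpt n) (cst c))) => cv.
apply: esym; apply: (cvg_unique _ _ cv) => //=.
have -> : (fun n => step_sum mu n.+1 (midpt n.+1) (cst c)) = fun=> c.
  by apply/funext => n; exact: h.
exact: cvg_cst.
Qed.

Lemma E01_le mu f g : {within I01, continuous f} -> {within I01, continuous g} ->
  (forall v, I01 v -> f v <= g v) -> E01 mu f <= E01 mu g.
Proof. by move=> cf cg fg; apply: le_Rintegral => //; exact: within_integrable. Qed.

Lemma E01_ge_cst mu f (c : R) : {within I01, continuous f} ->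
  (forall v, I01 v -> c <= f v) -> c <= E01 mu f.
Proof.
move=> cf fc; rewrite -(E01_cst mu c); apply: E01_le => //.
by move=> ?; exact: cst_continuous.
Qed.

Lemma E01_sharp mu f : {within I01, continuous f} -> (forall v, I01 v -> 1 <= f v) ->
  E01 mu f = 1 -> mu [set v | I01 v /\ 1 < f v] = 0%E.
Proof.
move=> cf f1 Ef.
have c1 : {within I01, continuous (fun=> 1 : R)} by move=> ?; exact: cst_continuous.
have mg : measurable_fun I01 (fun v => (f v - 1)%:E : \bar R).
  by apply/measurable_EFinP; apply: measurable_funB => //; exact: within_measurable.
have i1 := within_integrable mu cf; have i2 := within_integrable mu c1.
have ig : mu.-integrable I01 (EFin \o (fun v => f v - 1)).
  have := integrableB mI01 i1 i2.
  by congr (_.-integrable _ _); apply/funext => v /=; rewrite EFinB.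
have g0 : (\int[mu]_(v in I01) `|(f v - 1)%:E| = 0)%E.
  transitivity (\int[mu]_(v in I01) (f v - 1)%:E)%E.
    by apply: eq_integral => v; rewrite inE => Iv; rewrite gee0_abs// lee_fin subr_ge0 f1.
  rewrite -[LHS]fineK; last exact: integrable_fin_num.
  rewrite -[fine _]/(\int[mu]_(v in I01) (f v - 1)) RintegralB//.
  by rewrite -/(E01 mu f) -/(E01 mu (fun=> 1)) Ef E01_cst subrr.
have [N [mN N0 sN]] := (ae_eq_integral_abs mu mI01 mg).1 g0.
have mA : measurable [set v | I01 v /\ 1 < f v].
  have -> : [set v | I01 v /\ 1 < f v] = I01 `&` f @^-1` `]1, +oo[%classic.
    by apply/seteqP; split=> v /= [Iv]; rewrite ?in_itv/= ?andbT.
  by apply: within_measurable cf mI01 _ _; exact: measurable_itv.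
apply: (subset_measure0 mA mN _ N0) => v [Iv fv]; apply: sN => /= /(_ Iv) [].
lra.
Qed.

Definition is_mixture (l : R) mu1 mu2 nu : Prop :=
  forall A, measurable A -> nu A = (l%:E * mu1 A + (1 - l)%:E * mu2 A)%E.

Lemma E01_mixture l mu1 mu2 nu f : is_mixture l mu1 mu2 nu -> {within I01, continuous f} ->
  E01 nu f = l * E01 mu1 f + (1 - l) * E01 mu2 f.
Proof.
move=> H cf.
have cE x : cdfm nu x = l * cdfm mu1 x + (1 - l) * cdfm mu2 x.
  by apply: EFin_inj; rewrite EFinD !EFinM !cdfmE; exact: H.
have c1 : step_sum nu n (midpt n) f @[n --> \oo] --> l * E01 mu1 f + (1 - l) * E01 mu2 f.
  have -> : (fun n => step_sum nu n (midpt n) f) = (fun n =>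
      l * step_sum mu1 n (midpt n) f + (1 - l) * step_sum mu2 n (midpt n) f).
    apply/funext => n; rewrite /step_sum !mulr_sumr -big_split; apply: eq_bigr => j _.
    by rewrite /= !cE; ring.
  by apply: cvgD; (apply: cvgM; [exact: cvg_cst|exact: step_sum_cvg]).
exact: (cvg_unique _ (@step_sum_cvg nu f cf) c1).
Qed.

Lemma mixture_exists (l : R) mu1 mu2 : 0 <= l <= 1 -> exists nu, is_mixture l mu1 mu2 nu.
Proof.
move=> l01.
have H : mixture mu1 mu2 l01 I01 = 1%E.
  rewrite /mixture (p01_supp mu1) (p01_supp mu2) !mule1 -EFinD.
  by congr EFin; lra.
by exists (@Prob01 R (mixture mu1 mu2 l01) H).
Qed.

Lemma dirac01_exists v : I01 v -> exists nu, forall f, {within I01, continuous f} ->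
  E01 nu f = f v.
Proof.
move=> Iv.
have H : [the probability R R of \d_v] I01 = 1%E by rewrite /= diracE mem_set.
exists (@Prob01 R [the probability R R of \d_v] H) => f cf.
rewrite /E01 /Rintegral /= integral_dirac//.
  by rewrite diracE mem_set// mul1e.
by apply/measurable_EFinP; exact: within_measurable.
Qed.

End discretization.

(** * Duality with the minimal energy *)

Section duality.
Context {R : realType} {d : measure_display} {T : measurableType d}.
Variable P : probability T R.
Variable Z : R -> T -> R.
Local Notation I01 := (`[0, 1]%classic : set R).
Hypothesis Zc : forall w, {within I01, continuous (fun v => Z v w)}.
Hypothesis Zg : forall s, tagged01 s -> centered_gaussian P (lz Z s).
Implicit Types (mu nu : prob01 R) (H V : T -> R).

Definition HZ mu : T -> R := fun w => E01 mu (fun v => Z v w).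

Let S mu n := lz Z (disc mu n).

Let SE mu n w : S mu n w = step_sum mu n (midpt n) (fun v => Z v w).
Proof. by rewrite /S /lz -disc_sum. Qed.

Let S_L2 mu n : L2 P (S mu n). Proof. by apply: lz_L2 => //; exact: disc_tagged. Qed.

Let ip_S mu n V : L2 P V -> ip P (S mu n) V = step_sum mu n (midpt n) (fun v => ip P (Z v) V).
Proof.
move=> LV; rewrite /S (ip_lz Zg)//; last exact: disc_tagged.
exact: (disc_sum mu n (fun v => ip P (Z v) V)).
Qed.

(** E[S_n Z_u] converges uniformly in u, by Heine and the bound on the norms of Z_u. Hence
    E[Z_u (S_n - S_m)] is at most e/2 for all u, and so is its average against the weights of S_n or
    of S_m. *)
Let S_cauchy mu (e : R) : 0 < e -> exists n0, forall n m, (n0 <= n)%N -> (n0 <= m)%N ->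
  ip P (fun w => S mu n w - S mu m w) (fun w => S mu n w - S mu m w) <= e.
Proof.
move=> e0; have [M M0 ZM] := nrm_Z_bounded Zc Zg.
have e1 : 0 < e / 4 / M by rewrite !divr_gt0.
have [n0 n0P] := Z_heine Zc Zg e1.
have approx n u : (n0 <= n)%N -> I01 u ->
    `|E01 mu (fun v => ip P (Z v) (Z u)) - ip P (S mu n) (Z u)| <= e / 4.
  move=> nn Iu; have LU := Z_L2 Zg Iu; rewrite ip_S//.
  apply: (@step_sum_approxE _ mu n0 n (fun v => ip P (Z v) (Z u)) (e / 4) nn).
    exact: (ip_Z_continuous Zc Zg).
  move=> v v' Iv Iv' vv.
  have Lv := Z_L2 Zg Iv; have Lv' := Z_L2 Zg Iv'.
  rewrite -ipBl//; apply: le_trans (ip_le (L2_sub Lv Lv') LU) _.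
  rewrite -/(nrm P _) -/(nrm P (Z u)).
  have h1 := n0P v v' Iv Iv' vv; have h2 := ZM u Iu.
  have -> : e / 4 = e / 4 / M * M by rewrite divfK// gt_eqF.
  by apply: ler_pM => //; exact: nrm_ge0.
exists n0 => n m nn mm.
have LD := L2_sub (S_L2 mu n) (S_L2 mu m).
have small k : (n0 <= k)%N ->
    `|ip P (S mu k) (fun w => S mu n w - S mu m w)| <= e / 2.
  move=> kk; rewrite ip_S//; apply: step_sum_norm_le; first by rewrite ltW// divr_gt0.
  move=> v Iv; have LV := Z_L2 Zg Iv.
  rewrite ipBr// (ipC P (Z v)) (ipC P (Z v)).
  have := approx n v nn Iv; have := approx m v mm Iv.
  rewrite !ler_norml; lra.
rewrite ipBl//.
by have := small n nn; have := small m mm; rewrite !ler_norml; lra.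
Qed.

Lemma HZ_gsp mu : gsp P Z (HZ mu).
Proof.
have SY w : S mu n w @[n --> \oo] --> HZ mu w.
  by under eq_fun do rewrite SE; exact: (step_sum_cvg (@Zc w)).
have [LH nH] := L2_limit (S_L2 mu) SY (S_cauchy mu).
by exists (disc mu); split=> // n; exact: disc_tagged.
Qed.

Lemma HZ_L2 mu : L2 P (HZ mu). Proof. exact: gsp_L2 (HZ_gsp mu). Qed.

(** Expectation and integration against [mu] commute because both sides are the limit of the
    pairings of [V] with the same Riemann sums. *)
Lemma ip_HZ mu V : L2 P V -> ip P (HZ mu) V = E01 mu (fun v => ip P (Z v) V).
Proof.
move=> LV.
have SY w : S mu n w @[n --> \oo] --> HZ mu w.
  by under eq_fun do rewrite SE; exact: (step_sum_cvg (@Zc w)).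
have [LH nH] := L2_limit (S_L2 mu) SY (S_cauchy mu).
have c1 := ip_cvg (S_L2 mu) LH LV nH.
have c2 := @step_sum_cvg _ mu _ (ip_Z_continuous Zc Zg LV).
have E : (fun n => ip P (S mu n) V) = fun n => step_sum mu n (midpt n) (fun v => ip P (Z v) V).
  by apply/funext => n; exact: ip_S.
by rewrite E in c1; exact: (cvg_unique _ c1 c2).
Qed.

Lemma energyE mu : energy (fun u v => ip P (Z u) (Z v)) mu = (ip P (HZ mu) (HZ mu))%:E.
Proof.
have LH := HZ_L2 mu; have cH := ip_Z_continuous Zc Zg LH.
rewrite /energy ip_HZ//.
transitivity (\int[mu]_(u in I01) (ip P (Z u) (HZ mu))%:E)%E; last first.
  by rewrite /E01 /Rintegral fineK//; apply: integrable_fin_num => //; exact: within_integrable.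
apply: eq_integral => u; rewrite inE => Iu; have LU := Z_L2 Zg Iu.
rewrite ipC ip_HZ// /E01 /Rintegral fineK.
  by apply: eq_integral => v _; rewrite ipC.
apply: integrable_fin_num; first exact: measurable_itv.
exact: within_integrable (ip_Z_continuous Zc Zg LU).
Qed.

Definition minimizer mu : Prop := forall nu, ip P (HZ mu) (HZ mu) <= ip P (HZ nu) (HZ nu).

(** The semicontinuity inequality is used with S = H_nu: E[H_mu H_nu] is the integral against mu of
    the continuous function E[Z_v H_nu], hence converges to E[H_nu^2]. *)
Lemma energy_lsc (F : set_system (prob01 R)) nu (c : R) : ProperFilter F ->
  (forall f, {within I01, continuous f} -> (fun mu : prob01 R => E01 mu f) @ F --> E01 nu f) ->
  F [set mu : prob01 R | ip P (HZ mu) (HZ mu) <= c] -> ip P (HZ nu) (HZ nu) <= c.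
Proof.
move=> PF Fnu Fc; have LN := HZ_L2 nu.
have cv := Fnu _ (ip_Z_continuous Zc Zg LN); rewrite -ip_HZ// in cv.
apply/ler_addgt0Pr => e e0.
have e2 : 0 < e / 2 by rewrite divr_gt0.
move/cvgrPdist_le : cv => /(_ _ e2) FE.
have [mu [/= h1]] := filter_ex (filterI Fc FE).
have LM := HZ_L2 mu; rewrite -ip_HZ// ler_norml => /andP[h2 h3].
have := ip_ge0 P (fun w => HZ mu w - HZ nu w); rewrite ip_sub//; lra.
Qed.

Lemma minimizer_exists : exists mu, minimizer mu.
Proof.
pose E := [set ip P (HZ mu) (HZ mu) | mu in [set: prob01 R]].
have I0 : I01 0 by rewrite /= in_itv/= lexx ler01.
have [mu0 _] := dirac01_exists I0.
have E0 : E (ip P (HZ mu0) (HZ mu0)) by exists mu0.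
have lE : lbound E 0 by move=> _ [mu _ <-]; exact: ip_ge0.
have hE : has_inf E by split; [exists (ip P (HZ mu0) (HZ mu0))|exists 0].
(* The filter of nearly minimizing measures; an ultrafilter refining it plays the role of a
   minimizing sequence. *)
pose F0 := filter_from [set e : R | 0 < e]
  (fun e => [set mu : prob01 R | ip P (HZ mu) (HZ mu) <= inf E + e]).
have FF0 : Filter F0.
  apply: filter_from_filter; first by exists 1 => /=.
  move=> e e' /= e0 e'0; exists (Num.min e e'); first by rewrite /= lt_min e0.
  move=> mu /= h; split; apply: le_trans h _; by rewrite lerD2l ge_min lexx ?orbT.
have PF0 : ProperFilter F0.
  apply: filter_from_proper => e /= e0.
  by have [_ [mu _ <-] h] := inf_adherent e0 hE; exists mu => /=; exact: ltW.
have [F [UF F0F]] := ultraFilterLemma PF0.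
have [nu nuP] := prob01_ultra_cvg UF.
exists nu => mu; apply: (@le_trans _ _ (inf E)); last first.
  by apply: ge_inf; [exists 0|exists mu].
apply/ler_addgt0Pr => e e0; apply: (energy_lsc _ nuP).
by apply: F0F; exists e.
Qed.

Lemma minimizer_weakly_compact : weakly_compact minimizer.
Proof.
apply: weakly_compact_ultra => F nu UF FW nuP nu'.
apply: (energy_lsc _ nuP); apply: filterS FW => mu; exact.
Qed.

Lemma ip_HZ_mixture l mu1 mu2 nu V : is_mixture l mu1 mu2 nu -> L2 P V ->
  ip P (HZ nu) V = l * ip P (HZ mu1) V + (1 - l) * ip P (HZ mu2) V.
Proof.
move=> Hm LV; rewrite !ip_HZ//; apply: E01_mixture => //.
exact: (ip_Z_continuous Zc Zg).
Qed.

Lemma energy_mixture l mu1 mu2 nu : is_mixture l mu1 mu2 nu ->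
  ip P (HZ nu) (HZ nu) = l ^+ 2 * ip P (HZ mu1) (HZ mu1)
    + 2 * l * (1 - l) * ip P (HZ mu1) (HZ mu2) + (1 - l) ^+ 2 * ip P (HZ mu2) (HZ mu2).
Proof.
move=> Hm; have L1 := HZ_L2 mu1; have L2' := HZ_L2 mu2; have LN := HZ_L2 nu.
rewrite (ip_HZ_mixture Hm)// (ipC P (HZ mu1)) (ipC P (HZ mu2)) !(ip_HZ_mixture Hm)//.
rewrite (ipC P (HZ mu2) (HZ mu1)); ring.
Qed.

(** The energy of a mixture is quadratic in the weight, and Cauchy-Schwarz bounds its cross term by
    the common minimal energy. *)
Lemma minimizer_convex : convex_prob01 minimizer.
Proof.
move=> mu1 mu2 nu l W1 W2 /andP[l0 l1] Hm nu'.
apply: le_trans (W1 nu'); rewrite (energy_mixture Hm).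
have E : ip P (HZ mu2) (HZ mu2) = ip P (HZ mu1) (HZ mu1) by apply/eqP; rewrite eq_le W1 W2.
have := le_trans (ler_norm _) (ip_le (HZ_L2 mu1) (HZ_L2 mu2)).
rewrite E -expr2 sqr_sqrtr ?ip_ge0// => h.
have h' : l * (1 - l) * ip P (HZ mu1) (HZ mu2) <= l * (1 - l) * ip P (HZ mu1) (HZ mu1).
  by rewrite ler_wpM2l// mulr_ge0// subr_ge0.
nra.
Qed.

(* First-order optimality, along the segment from mu to the Dirac mass at v. *)
Lemma minimizer_potential mu v : minimizer mu -> I01 v ->
  ip P (HZ mu) (HZ mu) <= ip P (Z v) (HZ mu).
Proof.
move=> Wmu Iv; have [dv dvP] := dirac01_exists Iv.
have E : HZ dv = Z v by apply/funext => w; exact: (dvP _ (@Zc w)).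
rewrite leNgt; apply/negP => h.
set m := ip P (HZ mu) (HZ mu) in h *; set b := ip P (Z v) (HZ mu) in h *.
set q := ip P (Z v) (Z v) - 2 * b + m.
have q0 : 0 <= q by rewrite /q /b /m -ip_sub ?ip_ge0//; [exact: (Z_L2 Zg)|exact: HZ_L2].
have mb : 0 < m - b by rewrite subr_gt0.
have D0 : 0 < q + (m - b) by rewrite ltr_wpDl.
(* The energy at weight l on the Dirac mass is m - 2 l (m - b) + l^2 q. This l gives l q <= m - b,
   so the energy drops; the added m - b keeps l <= 1 and covers q = 0. *)
pose l := (m - b) / (q + (m - b)).
have l0 : 0 < l by rewrite divr_gt0.
have l1 : l <= 1 by rewrite ler_pdivrMr// mul1r lerDr.
have l01 : 0 <= l <= 1 by rewrite ltW.
have [nu Hm] := mixture_exists dv mu l01.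
have := Wmu nu; rewrite (energy_mixture Hm) E -/m -/b.
have lq : l * (q + (m - b)) = m - b by rewrite divfK// gt_eqF.
move: lq; rewrite /q; set a := ip P (Z v) (Z v) => lq k.
have k1 : 0 <= l * (l * (a - 2 * b + m) - 2 * (m - b)) by lra.
rewrite pmulr_rge0// in k1.
have : 0 < l * (m - b) by rewrite mulr_gt0.
lra.
Qed.

Lemma feasible_pairing mu H : L2 P H -> (forall v, I01 v -> 1 <= ip P (Z v) H) ->
  1 <= ip P (HZ mu) H.
Proof.
by move=> LH fH; rewrite ip_HZ//; apply: E01_ge_cst => //; exact: (ip_Z_continuous Zc Zg).
Qed.

Lemma feasible_energy_gt0 mu H : L2 P H -> (forall v, I01 v -> 1 <= ip P (Z v) H) ->
  0 < ip P (HZ mu) (HZ mu).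
Proof.
move=> LH fH; have h := feasible_pairing mu LH fH.
have := ip_CS (HZ_L2 mu) LH; have := ip_ge0 P (HZ mu); rewrite le_eqVlt => /predU1P[<-|//].
by rewrite mul0r => h2; have := sqr_ge0 (ip P (HZ mu) H); nra.
Qed.

(** At zero energy the inverse is 0 by convention and this is the zero variable, so integrability
    holds without a sign condition. *)
Definition Hstar mu : T -> R := fun w => (ip P (HZ mu) (HZ mu))^-1 * HZ mu w.

Lemma Hstar_gsp mu : gsp P Z (Hstar mu).
Proof. by apply: (gsp_scale Zg); exact: HZ_gsp. Qed.

Lemma Hstar_L2 mu : L2 P (Hstar mu). Proof. exact: gsp_L2 (Hstar_gsp mu). Qed.

Section positive_energy.
Variable mu : prob01 R.
Hypotheses (Wmu : minimizer mu) (m0 : 0 < ip P (HZ mu) (HZ mu)).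
Local Notation m := (ip P (HZ mu) (HZ mu)).

Lemma ip_Hstar : ip P (Hstar mu) (Hstar mu) = m^-1.
Proof.
have LH := HZ_L2 mu; have LS := Hstar_L2 mu.
rewrite {1}/Hstar ipZl// ipC /Hstar ipZl//.
by rewrite mulVf ?mulr1// gt_eqF.
Qed.

Lemma Hstar_feasible v : I01 v -> 1 <= ip P (Z v) (Hstar mu).
Proof.
move=> Iv; have LH := HZ_L2 mu; have LZ := Z_L2 Zg Iv.
by rewrite /Hstar ipZr// mulrC ler_pdivlMr// mul1r minimizer_potential.
Qed.

Lemma feasible_Hstar H : L2 P H -> (forall v, I01 v -> 1 <= ip P (Z v) H) ->
  m^-1 <= ip P H (Hstar mu).
Proof.
move=> LH fH; have LM := HZ_L2 mu.
rewrite /Hstar ipZr// ler_pMr ?invr_gt0// ipC.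
exact: feasible_pairing.
Qed.

(** Expand the square of H - Hstar and insert E[H Hstar] >= 1/m. In case of equality the same
    expansion leaves a square of expectation 0, which gives uniqueness. *)
Lemma feasible_norm H : L2 P H -> (forall v, I01 v -> 1 <= ip P (Z v) H) -> m^-1 <= ip P H H.
Proof.
move=> LH fH; have LS := Hstar_L2 mu; have := feasible_Hstar LH fH.
have := ip_ge0 P (fun w => H w - Hstar mu w); rewrite ip_sub// ip_Hstar; lra.
Qed.

Lemma feasible_unique H : L2 P H -> (forall v, I01 v -> 1 <= ip P (Z v) H) ->
  ip P H H = m^-1 -> {ae P, forall w, H w = Hstar mu w}.
Proof.
move=> LH fH nH; have LS := Hstar_L2 mu; apply: ae_eq_L2 => //.
have := feasible_Hstar LH fH; have := ip_ge0 P (fun w => H w - Hstar mu w).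
rewrite ip_sub// ip_Hstar nH => h1 h2; apply/eqP; rewrite eq_le h1 andbT; lra.
Qed.

(** The integral of E[Z_v Hstar] against mu is E[H_mu Hstar] = 1, while the integrand is at least
    1. *)
Lemma minimizer_sharp : mu [set v | I01 v /\ 1 < ip P (Z v) (Hstar mu)] = 0%E.
Proof.
have LS := Hstar_L2 mu; have LM := HZ_L2 mu.
apply: E01_sharp; first exact: (ip_Z_continuous Zc Zg).
- exact: Hstar_feasible.
- by rewrite -ip_HZ// /Hstar ipZr// mulVf// gt_eqF.
Qed.

End positive_energy.

End duality.

(** * Two independent copies on the product space *)

Section product_space.
Context {R : realType} {d : measure_display} {T : measurableType d}.
Variable P : probability T R.

Definition PP : probability (T * T)%type R := [the probability _ _ of (P \x P)%E].

Lemma PP_rect A B : measurable A -> measurable B -> PP (A `*` B) = (P A * P B)%E.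
Proof. exact: product_measure1E. Qed.

Lemma PP_Rintegral (f g : T -> R) : measurable_fun setT f -> measurable_fun setT g ->
  (forall w, `|f w| <= 1) -> (forall w, `|g w| <= 1) ->
  \int[PP]_w (f w.1 * g w.2) = \int[P]_w f w * \int[P]_w g w.
Proof.
move=> mf mg f1 g1.
have mfg : measurable_fun setT (fun w : T * T => f w.1 * g w.2).
  by apply: measurable_funM; apply: measurableT_comp.
have iF : P.-integrable setT (EFin \o f) by exact: bounded_integrable f1.
have iG : P.-integrable setT (EFin \o g) by exact: bounded_integrable g1.
have ifg : PP.-integrable setT (EFin \o (fun w : T * T => f w.1 * g w.2)).
  by apply: (@bounded_integrable _ _ _ _ _ 1) => // w; rewrite normrM mulr_ile1.
rewrite {1}/Rintegral -(integral12_prod_meas1 ifg) /fubini_F.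
transitivity (fine (\int[P]_x (f x * \int[P]_w g w)%:E)%E).
  congr fine; apply: eq_integral => x _ /=.
  rewrite -RintegralZl// -EFin_Rintegral//.
  exact: integrable_rscale.
rewrite -[LHS]/(\int[P]_x (f x * \int[P]_w g w)).
by under eq_Rintegral do rewrite mulrC; rewrite RintegralZl// mulrC.
Qed.

Lemma PP_cos_sin (A B : T -> R) : measurable_fun setT A -> measurable_fun setT B ->
  \int[P]_w sin (A w) = 0 -> \int[P]_w sin (B w) = 0 ->
  \int[PP]_w cos (A w.1 + B w.2) = \int[P]_w cos (A w) * \int[P]_w cos (B w) /\
  \int[PP]_w sin (A w.1 + B w.2) = 0.
Proof.
move=> mA mB sA sB.
have mc (Y : T -> R) : measurable_fun setT Y -> measurable_fun setT (fun w => cos (Y w)).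
  by move=> mY; apply: measurableT_comp mY; exact: measurable_cos.
have ms (Y : T -> R) : measurable_fun setT Y -> measurable_fun setT (fun w => sin (Y w)).
  by move=> mY; apply: measurableT_comp mY; exact: measurable_sin.
have i2 (f g : T -> R) : measurable_fun setT f -> measurable_fun setT g ->
    (forall w, `|f w| <= 1) -> (forall w, `|g w| <= 1) ->
    PP.-integrable setT (EFin \o (fun w : T * T => f w.1 * g w.2)).
  move=> mf mg f1 g1; apply: (@bounded_integrable _ _ _ _ _ 1).
    by apply: measurable_funM; apply: measurableT_comp.
  by move=> w; rewrite normrM mulr_ile1.
have cm x : `|@cos R x| <= 1 by exact: cos_max.
have sm x : `|@sin R x| <= 1 by exact: sin_max.
have mcA := mc _ mA; have mcB := mc _ mB; have msA := ms _ mA; have msB := ms _ mB.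
split.
  under eq_Rintegral do rewrite cosD.
  rewrite RintegralB//; [|exact: (i2 (fun w => cos (A w)) (fun w => cos (B w)))
    |exact: (i2 (fun w => sin (A w)) (fun w => sin (B w)))].
  rewrite (PP_Rintegral mcA mcB)// (PP_Rintegral msA msB)//.
  by rewrite sA mul0r subr0.
under eq_Rintegral do rewrite sinD.
rewrite RintegralD//; [|exact: (i2 (fun w => sin (A w)) (fun w => cos (B w)))
  |exact: (i2 (fun w => cos (A w)) (fun w => sin (B w)))].
rewrite (PP_Rintegral msA mcB)// (PP_Rintegral mcA msB)//.
by rewrite sA sB mul0r mulr0 addr0.
Qed.

End product_space.

(** * Independence and Fernique's theorem *)

Section gaussian_space.
Context {R : realType} {d : measure_display} {T : measurableType d}.
Variable P : probability T R.
Variable G : (T -> R) -> Prop.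
Hypothesis G_L2 : forall Y, G Y -> L2 P Y.
Hypothesis G_add : forall Y V, G Y -> G V -> G (fun w => Y w + V w).
Hypothesis G_scale : forall r Y, G Y -> G (fun w => r * Y w).
Hypothesis G_char : forall Y, G Y ->
  \int[P]_w cos (Y w) = gcf (ip P Y Y) /\ \int[P]_w sin (Y w) = 0.
Variable zeta : nat -> T -> R.
Hypothesis G_zeta : forall n, G (zeta n).
Hypothesis zeta_bounded : forall w, exists M : R, forall n, `|zeta n w| <= M.

Let G_meas Y : G Y -> measurable_fun setT Y. Proof. by move=> /G_L2; exact: L2_meas. Qed.

Definition below (t : R) : set T := [set w | forall n, `|zeta n w| <= t].

(** Both signs are listed so that two-sided bounds become half-spaces. *)
Let sgz (i : bool * nat) (w : T) : R := (-1) ^+ i.1 * zeta i.2 w.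

Let G_sgz i : G (sgz i). Proof. exact: G_scale. Qed.

Lemma belowE t : below t = [set w | forall i, - t <= sgz i w].
Proof.
apply/seteqP; split=> w /= h.
  by move=> [b n]; have := h n; rewrite /sgz ler_norml => /andP[h1 h2]; case: b => /=;
    rewrite ?expr0 ?expr1 ?mul1r ?mulN1r// lerNl opprK.
move=> n; rewrite ler_norml; have := h (false, n); have := h (true, n).
by rewrite /sgz/= expr0 expr1 mul1r mulN1r lerN2 => -> ->.
Qed.

Lemma measurable_below t : measurable (below t).
Proof.
have -> : below t = \bigcap_n [set w | - t <= - `|zeta n w|].
  apply/seteqP; split=> w /= h n => [_|]; first by rewrite /= lerN2.
  by have := h n I; rewrite /= lerN2.
apply: bigcap_measurableType => n _; apply: measurable_ge_set.
by apply: measurableT_comp => //; apply: measurableT_comp => //; exact: G_meas.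
Qed.

Let prod_meas A B : G A -> G B -> measurable_fun setT (fun w : T * T => A w.1 + B w.2).
Proof.
by move=> /G_meas mA /G_meas mB; apply: measurable_funD; apply: measurableT_comp.
Qed.

Let prod_char A B : G A -> G B ->
  \int[PP P]_w cos (A w.1 + B w.2) = gcf (ip P A A + ip P B B) /\
  \int[PP P]_w sin (A w.1 + B w.2) = 0.
Proof.
move=> GA GB; have [cA sA] := G_char GA; have [cB sB] := G_char GB.
have [-> ->] := PP_cos_sin (G_meas GA) (G_meas GB) sA sB.
by rewrite cA cB gcfD// ip_ge0.
Qed.

Section independence.
Variable H : T -> R.
Hypotheses (GH : G H) (H_zeta : forall n, ip P H (zeta n) = 0).

(** A combination of [H] and an orthogonal [B] is paired with the same combination of independent
    copies. The variances agree, hence the trigonometric moments, and equality of orthants becomes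
    independence. *)
Let V (Y : T -> R) (Y' : T * T -> R) : Prop := exists a B,
  [/\ G B, ip P H B = 0, Y = fun w => a * H w + B w & Y' = fun w => a * H w.1 + B w.2].

Lemma independent_ge_below (h t : R) :
  P ([set w | (h <= H w)%R] `&` below t) = (P [set w | (h <= H w)%R] * P (below t))%E.
Proof.
have LH := G_L2 GH.
have V_meas Y Y' : V Y Y' -> measurable_fun setT Y /\ measurable_fun setT Y'.
  move=> [a [B [GB _ -> ->]]]; split; first exact: G_meas (G_add (G_scale a GH) GB).
  exact: prod_meas (G_scale a GH) GB.
have V_char Y Y' : V Y Y' -> \int[P]_w cos (Y w) = \int[PP P]_w cos (Y' w) /\
    \int[P]_w sin (Y w) = \int[PP P]_w sin (Y' w).
  move=> [a [B [GB HB -> ->]]]; have GaH := G_scale a GH.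
  have LB := G_L2 GB; have LaH := G_L2 GaH.
  have [-> ->] := G_char (G_add GaH GB); have [-> ->] := prod_char GaH GB.
  by rewrite (ip_add LaH LB) (ipZl a LH LB) HB mulr0 mulr0 addr0.
have V_add Y1 Y1' Y2 Y2' : V Y1 Y1' -> V Y2 Y2' ->
    V (fun w => Y1 w + Y2 w) (fun w => Y1' w + Y2' w).
  move=> [a1 [B1 [G1 H1 -> ->]]] [a2 [B2 [G2 H2 -> ->]]].
  exists (a1 + a2), (fun w => B1 w + B2 w); split; first exact: G_add.
  - by rewrite ipDr ?H1 ?H2 ?addr0//; exact: G_L2.
  - by apply/funext => w; ring.
  - by apply/funext => w; ring.
have V_scale r Y Y' : V Y Y' -> V (fun w => r * Y w) (fun w => r * Y' w).
  move=> [a [B [GB HB -> ->]]]; exists (r * a), (fun w => r * B w); split; first exact: G_scale.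
  - by rewrite ipZr ?HB ?mulr0//; exact: G_L2.
  - by apply/funext => w; ring.
  - by apply/funext => w; ring.
pose Y (i : option (bool * nat)) := if i is Some j then sgz j else H.
pose Y' (i : option (bool * nat)) (w : T * T) := if i is Some j then sgz j w.2 else H w.1.
pose c (i : option (bool * nat)) := if i is Some j then - t else h.
have VY i : V (Y i) (Y' i).
  case: i => [j|]; last first.
    exists 1, (fun w => 0 * H w); split; first exact: G_scale.
    - by rewrite ipZr// mul0r.
    - by apply/funext => w; rewrite /Y; ring.
    - by apply/funext => w; rewrite /Y'; ring.
  exists 0, (sgz j); split; first exact: G_sgz.
  - by rewrite /sgz ipZr ?H_zeta ?mulr0//; exact: G_L2.
  - by apply/funext => w; rewrite /Y; ring.
  - by apply/funext => w; rewrite /Y'; ring.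
have mH : measurable [set w | h <= H w] by apply: measurable_ge_set; exact: G_meas.
have := prob_orthant_eq_count V_meas (fun _ _ v => proj1 (V_char _ _ v))
  (fun _ _ v => proj2 (V_char _ _ v)) V_add V_scale c None VY.
have -> : [set w | forall i, c i <= Y i w] = [set w | h <= H w] `&` below t.
  rewrite belowE; apply/seteqP; split=> w /=.
    by move=> hw; split; [exact: (hw None)|move=> i; exact: (hw (Some i))].
  by move=> [h1 h2] [i|]; [exact: h2|exact: h1].
move=> ->; rewrite -(PP_rect _ mH (measurable_below t)); congr (PP P _).
rewrite belowE; apply/seteqP; split=> w /=.
  by move=> hw; split; [exact: (hw None)|move=> i; exact: (hw (Some i))].
by move=> [h1 h2] [i|]; [exact: h2|exact: h1].
Qed.

Lemma independent_ge_not_below (h t : R) :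
  P ([set w | (h <= H w)%R] `\` below t) = (P [set w | (h <= H w)%R] * P (~` below t))%E.
Proof.
have mH : measurable [set w | h <= H w] by apply: measurable_ge_set; exact: G_meas.
have mB := measurable_below t.
have fH : P [set w | h <= H w] \is a fin_num by exact: fin_num_measure.
have fB : P (below t) \is a fin_num by exact: fin_num_measure.
have -> : P ([set w | (h <= H w)%R] `\` below t) =
    (P [set w | (h <= H w)%R] - P ([set w | (h <= H w)%R] `&` below t))%E.
  by apply: measureD => //; exact: le_lt_trans (probability_le1 P mH) (ltry _).
have -> : P (~` below t) = (1 - P (below t))%E by exact: probability_setC.
rewrite (independent_ge_below h t) -(fineK fH) -(fineK fB).
by rewrite -EFinM -!EFinB -EFinM; congr EFin; ring.
Qed.

End independence.

Section rotation.

Let sqrt2 : R := Num.sqrt 2.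

Let sqrt2_sqr : sqrt2 ^+ 2 = 2. Proof. by rewrite sqr_sqrtr. Qed.

(** The rotation by 45 degrees of two independent copies: the slot of A receives (X1 - X2) / sqrt 2
    and that of B receives (X1 + X2) / sqrt 2. Regrouped by coordinate, the variance is seen to be
    unchanged. *)
Let V (Y Y' : T * T -> R) : Prop := exists A B, [/\ G A, G B,
  Y = fun w => A w.1 + B w.2 &
  Y' = fun w => sqrt2^-1 * (A w.1 + B w.1) + sqrt2^-1 * (B w.2 - A w.2)].

Let rotated (b : bool) (n : nat) (w : T * T) : R :=
  if b then sqrt2^-1 * (zeta n w.1 - zeta n w.2) else sqrt2^-1 * (zeta n w.1 + zeta n w.2).

Let straight (b : bool) (n : nat) (w : T * T) : R := if b then zeta n w.1 else zeta n w.2.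

(** [f i] encodes a slot, an index and a sign. A free index type lets one statement serve
    constraints on both slots or on one only. *)
Let rotation_invariant (I : countType) (i0 : I) (f : I -> (bool * nat) * bool) (c : I -> R) :
  PP P [set w | forall i, c i <= (-1) ^+ (f i).2 * straight (f i).1.1 (f i).1.2 w] =
  PP P [set w | forall i, c i <= (-1) ^+ (f i).2 * rotated (f i).1.1 (f i).1.2 w].
Proof.
have G_rot A B : G A -> G B -> G (fun w => sqrt2^-1 * (A w + B w)) /\
    G (fun w => sqrt2^-1 * (B w - A w)).
  move=> GA GB; split; apply: G_scale; first exact: G_add.
  by have := G_add GB (G_scale (-1) GA); under eq_fun do rewrite mulN1r.
have V_meas Y Y' : V Y Y' -> measurable_fun setT Y /\ measurable_fun setT Y'.
  move=> [A [B [GA GB -> ->]]]; split; first exact: prod_meas.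
  by have [G1 G2] := G_rot _ _ GA GB; exact: (prod_meas G1 G2).
have V_char Y Y' : V Y Y' -> \int[PP P]_w cos (Y w) = \int[PP P]_w cos (Y' w) /\
    \int[PP P]_w sin (Y w) = \int[PP P]_w sin (Y' w).
  move=> [A [B [GA GB -> ->]]].
  have LA := G_L2 GA; have LB := G_L2 GB.
  have [G1 G2] := G_rot _ _ GA GB.
  have [-> ->] := prod_char GA GB; have [-> ->] := prod_char G1 G2.
  split; [congr gcf|by []].
  have LS := L2_add LA LB; have LD := L2_sub LB LA.
  have LS' := L2_scale sqrt2^-1 LS; have LD' := L2_scale sqrt2^-1 LD.
  rewrite (ipZl _ LS LS') (ipZr _ LS LS) (ipZl _ LD LD') (ipZr _ LD LD).
  rewrite (ip_add LA LB) (ip_sub LB LA) (ipC P B A) !mulrA -invfM -expr2 sqrt2_sqr.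
  by set x := ip P A A; set y := ip P B B; set z := ip P A B; lra.
have V_add Y1 Y1' Y2 Y2' : V Y1 Y1' -> V Y2 Y2' ->
    V (fun w => Y1 w + Y2 w) (fun w => Y1' w + Y2' w).
  move=> [A1 [B1 [GA1 GB1 -> ->]]] [A2 [B2 [GA2 GB2 -> ->]]].
  exists (fun w => A1 w + A2 w), (fun w => B1 w + B2 w).
  by split; [exact: G_add|exact: G_add|apply/funext => w; ring|apply/funext => w; ring].
have V_scale r Y Y' : V Y Y' -> V (fun w => r * Y w) (fun w => r * Y' w).
  move=> [A [B [GA GB -> ->]]]; exists (fun w => r * A w), (fun w => r * B w).
  by split; [exact: G_scale|exact: G_scale|apply/funext => w; ring|apply/funext => w; ring].
have Vb b n : V (straight b n) (rotated b n).
  have G0 := G_scale 0 (G_zeta n); have Gn := G_zeta n.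
  case: b.
    exists (zeta n), (fun w => 0 * zeta n w); split=> //.
    - by apply/funext => w; rewrite /straight; ring.
    - by apply/funext => w; rewrite /rotated; ring.
  exists (fun w => 0 * zeta n w), (zeta n); split=> //.
  - by apply/funext => w; rewrite /straight; ring.
  - by apply/funext => w; rewrite /rotated; ring.
apply: (prob_orthant_eq_count V_meas (fun _ _ v => proj1 (V_char _ _ v))
  (fun _ _ v => proj2 (V_char _ _ v)) V_add V_scale c i0) => i.
exact: V_scale.
Qed.

Let sign_boundE (x t : R) : (forall b : bool, - t <= (-1) ^+ b * x) <-> `|x| <= t.
Proof.
split=> [h|].
  have := h true; have := h false; rewrite expr0 expr1 mul1r mulN1r => h1 h2.
  by rewrite ler_norml h1; lra.
by rewrite ler_norml => /andP[h1 h2] [|]; rewrite ?expr0 ?expr1 ?mul1r ?mulN1r//; lra.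
Qed.

(* With U = (X1 - X2) / sqrt 2 and W = (X1 + X2) / sqrt 2 again independent copies,
   |U| <= s and |W_n| > t force both |X1_n| and |X2_n| above (t - s) / sqrt 2. *)
Lemma fernique_step (s t : R) :
  (P (below s) * P (~` below t) <= P (~` below ((t - s) / sqrt2)) ^+ 2)%E.
Proof.
have ms := measurable_below s; have mt := measurable_below t.
have mr := measurable_below ((t - s) / sqrt2).
pose E (X : bool -> nat -> T * T -> R) := [set w | (forall n, `|X true n w| <= s) /\
  (forall n, `|X false n w| <= t)].
pose E' (X : bool -> nat -> T * T -> R) := [set w | forall n, `|X true n w| <= s].
have EE : PP P (E straight) = PP P (E rotated).
  have := rotation_invariant (true, 0%N, false) id (fun i => - (if i.1.1 then s else t)).
  have H X : [set w | forall i : bool * nat * bool, - (if i.1.1 then s else t) <=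
      (-1) ^+ i.2 * X i.1.1 i.1.2 w] = E X.
    apply/seteqP; split=> w /=.
      move=> h; split=> n; apply/sign_boundE => b; first exact: (h (true, n, b)).
      exact: (h (false, n, b)).
    by move=> [h1 h2] [[[|] n] b] /=; [have := h1 n|have := h2 n] => /sign_boundE.
  by rewrite !H.
have EE' : PP P (E' straight) = PP P (E' rotated).
  have := rotation_invariant (0%N, false) (fun i : nat * bool => (true, i.1, i.2)) (fun=> - s).
  have H X : [set w | forall i : nat * bool, - s <= (-1) ^+ i.2 * X true i.1 w] = E' X.
    apply/seteqP; split=> w /=.
      by move=> h n; apply/sign_boundE => b; exact: (h (n, b)).
    by move=> h1 [n b] /=; have := h1 n => /sign_boundE.
  by rewrite !H.
have ES : E straight = below s `*` below t by apply/seteqP; split.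
have ES' : E' straight = below s `*` setT by apply/seteqP; split=> w //= [].
have mrot b n : measurable_fun setT (rotated b n).
  have mz := G_meas (G_zeta n).
  have m1 : measurable_fun setT (fun w : T * T => zeta n w.1) by exact: measurableT_comp.
  have m2 : measurable_fun setT (fun w : T * T => zeta n w.2) by exact: measurableT_comp.
  by rewrite /rotated; case: b; apply: measurable_funM => //;
    [exact: measurable_funB|exact: measurable_funD].
have mset b (c : R) : measurable [set w : T * T | forall n, `|rotated b n w| <= c].
  have -> : [set w : T * T | forall n, `|rotated b n w| <= c] =
      \bigcap_n [set w | - c <= - `|rotated b n w|].
    apply/seteqP; split=> w /= h n => [_|]; first by rewrite /= lerN2.
    by have := h n I; rewrite /= lerN2.
  apply: bigcap_measurableType => n _; apply: measurable_ge_set.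
  by apply: measurableT_comp => //; exact: measurableT_comp.
have mE : measurable (E rotated) by apply: measurableI; exact: mset.
have mE' : measurable (E' rotated) by exact: mset.
have sEE' : E rotated `<=` E' rotated by move=> w [].
have L : (P (below s) * P (~` below t) = PP P (E' rotated `\` E rotated))%E.
  have -> : PP P (E' rotated `\` E rotated) = (PP P (E' rotated) - PP P (E rotated))%E.
    rewrite -{2}(setIidr sEE'); apply: measureD => //.
    exact: le_lt_trans (probability_le1 _ mE') (ltry _).
  rewrite -EE -EE' ES ES' !PP_rect// probability_setT mule1.
  have -> : P (~` below t) = (1 - P (below t))%E by exact: probability_setC.
  have fs : P (below s) \is a fin_num by exact: fin_num_measure.
  by rewrite muleBr ?mule1//; exact: fin_num_adde_defr.
rewrite L expe2 -PP_rect; [|exact: measurableC|exact: measurableC].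
apply: le_prob; [exact: measurableD|by apply: measurableX; exact: measurableC|].
move=> w [h1 h2].
have {h2} [n hn] : exists n, t < `|rotated false n w|.
  apply: contrapT => /forallNP h; apply: h2; split=> // n.
  by rewrite leNgt; apply/negP; exact: h.
have {h1} h1 := h1 n; rewrite /= in h1 hn.
have r0 : 0 < sqrt2^-1 by rewrite invr_gt0 sqrtr_gt0.
have rr : sqrt2^-1 * sqrt2^-1 = 2^-1 by rewrite -invfM -expr2 sqrt2_sqr.
set r := sqrt2^-1 in h1 hn r0 rr *.
set x := zeta n w.1 in h1 hn *; set y := zeta n w.2 in h1 hn *.
have ex : r * (r * (x + y) + r * (x - y)) = x.
  rewrite mulrDr !mulrA rr; lra.
have ey : r * (r * (x + y) - r * (x - y)) = y.
  rewrite mulrBr !mulrA rr; lra.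
have big (u v : R) : `|u| <= s -> t < `|v| -> (t - s) * r < `|r * (v + u)|.
  move=> hu hv; rewrite normrM (gtr0_norm r0) mulrC ltr_pM2l//.
  have := lerB_normD v (- u); rewrite normrN => k.
  have := ler_normB v (- u); rewrite opprK normrN.
  have := ler_normD (v + u) (- u); rewrite addrK normrN; lra.
split=> /= /(_ n); apply/negP; rewrite -ltNge -/r -/x -/y.
  by have := big _ _ h1 hn; rewrite ex.
by have := big (- (r * (x - y))) _ _ hn; rewrite normrN ey; exact.
Qed.

End rotation.

Lemma dyadic_bracket (x : R) : 1 <= x -> exists n, 2 ^+ n <= x < 2 ^+ n.+1.
Proof.
move=> x1.
have ex : exists n, x < 2 ^+ n.
  exists (Num.bound x); apply: lt_le_trans (archi_boundP (le_trans ler01 x1)) _.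
  by rewrite -natrX ler_nat ltnW// ltn_expl.
have [[|n] nP nmin] := ex_minnP ex; first by rewrite expr0 ltNge x1 in nP.
exists n; rewrite nP andbT leNgt; apply/negP => /nmin.
by rewrite ltnn.
Qed.

Lemma below_cvg1 (e : R) : 0 < e -> exists2 s : R, 1 <= s & (P (~` below s) <= e%:E)%E.
Proof.
move=> e0.
have mB n : measurable (~` below n%:R) by apply: measurableC; exact: measurable_below.
have : (fun n => P (~` below n%:R)) @ \oo --> P (\bigcap_n ~` below n%:R).
  apply: nonincreasing_cvg_mu => //.
  - exact: le_lt_trans (probability_le1 P (mB 0%N)) (ltry _).
  - exact: bigcap_measurableType.
  - move=> m n mn; apply/subsetPset; apply: subsetC => w /= h k.
    by apply: le_trans (h k) _; rewrite ler_nat.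
have -> : \bigcap_n ~` below n%:R = set0.
  apply/seteqP; split=> // w h; have [M MP] := zeta_bounded w.
  apply: (h (Num.bound `|M|) I) => k; apply: le_trans (MP k) _.
  by apply: le_trans (ler_norm _) _; exact: ltW (archi_boundP _).
rewrite measure0 => h.
have [n0 _ n0P] : \forall n \near \oo, (P (~` below n%:R) < e%:E)%E.
  have /fine_cvgP[_ /cvgr0Pnorm_lt /(_ e e0)] := h; apply: filterS => n.
  have fn : P (~` below n%:R) \is a fin_num by exact: fin_num_measure.
  by rewrite /= -{2}(fineK fn) lte_fin; apply: le_lt_trans; exact: ler_norm.
exists (n0.+1%:R); first by rewrite ler1n.
by apply: ltW; apply: n0P => /=.
Qed.

(** Along t_(n+1) = s + sqrt 2 t_n the step inequality squares the ratio p / F, so p(t_n) <= F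
    exp(-2^n), whereas t_n grows only like 2^(n/2); this is a Gaussian tail. *)
Lemma fernique : exists k t0 : R, [/\ 0 < k, 0 < t0 & forall t, t0 <= t ->
  (P (~` below t) <= (expR (- (k * t ^+ 2)))%:E)%E].
Proof.
(* Then F = 1 - p(s) >= 1/2 and p(s) <= F / e, the base case of the squaring. *)
pose e : R := expR (-1) / 2.
have e0 : 0 < e by rewrite divr_gt0 ?expR_gt0.
have [s s1 sP] := below_cvg1 e0.
have s0 : 0 < s by exact: lt_le_trans ltr01 s1.
pose p t : R := fine (P (~` below t)).
have pE t : P (~` below t) = (p t)%:E.
  by rewrite fineK//; apply: fin_num_measure; apply: measurableC; exact: measurable_below.
have p0 t : 0 <= p t by apply: fine_ge0; exact: measure_ge0.
have pmono t t' : t <= t' -> p t' <= p t.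
  move=> tt; rewrite -lee_fin -!pE; apply: le_prob.
  - by apply: measurableC; exact: measurable_below.
  - by apply: measurableC; exact: measurable_below.
  - by apply: subsetC => w /= h n; exact: le_trans (h n) tt.
have F2 : 1 / 2 <= 1 - p s.
  have : p s <= e by rewrite -lee_fin -pE.
  have : expR (-1) <= expR 0 :> R by rewrite ler_expR; lra.
  rewrite expR0.
  rewrite /e; lra.
set F := 1 - p s in F2.
have step t : F * p t <= p ((t - s) / Num.sqrt 2) ^+ 2.
  have := fernique_step s t; rewrite !pE expe2 -EFinM.
  have -> : P (below s) = F%:E.
    have := pE s; rewrite /F EFinB -pE => _.
    have -> : P (~` below s) = (1 - P (below s))%E.
      by apply: probability_setC; exact: measurable_below.
    have fs : P (below s) \is a fin_num by apply: fin_num_measure; exact: measurable_below.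
    by rewrite -(fineK fs) -!EFinB; congr EFin; lra.
  by rewrite -EFinM lee_fin expr2.
pose q : R := Num.sqrt 2.
have q2 : q ^+ 2 = 2 by rewrite sqr_sqrtr.
have q0 : 0 < q by rewrite sqrtr_gt0.
(* This is what makes 4 s q^n - 3 s an upper bound stable under the recursion: it needs s - 3 q s <=
   - 3 s. *)
have q43 : 4 / 3 <= q.
  rewrite -(@ler_pXn2r _ 2)// ?nnegrE ?divr_ge0// ?ltW// q2.
  by rewrite expr2; lra.
pose t := fix t n := if n is n'.+1 then s + q * t n' else s.
have tb n : t n <= 4 * s * q ^+ n - 3 * s.
  elim: n => [|n IH] /=; first by rewrite expr0; lra.
  have h : q * t n <= q * (4 * s * q ^+ n - 3 * s) by rewrite ler_pM2l.
  rewrite exprS; have : 4 / 3 * s <= q * s by rewrite ler_pM2r.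
  move: h; rewrite mulrBr; set u := q ^+ n.
  have -> : q * (4 * s * u) = 4 * s * (q * u) by ring.
  have -> : q * (3 * s) = 3 * (q * s) by ring.
  lra.
have pt n : p (t n) <= F * expR (- (2 ^+ n)).
  elim: n => [|n IH].
    rewrite expr0 /=; have : p s <= e by rewrite -lee_fin -pE.
    rewrite /e; have := expR_gt0 (-1 : R) => h1 h2; nra.
  have tE : (t n.+1 - s) / Num.sqrt 2 = t n.
    by rewrite [t n.+1]/= -/q addrAC subrr add0r mulrC mulKf// gt_eqF.
  have h := step (t n.+1); rewrite tE in h.
  have F0 : 0 < F by lra.
  have h2 : p (t n) ^+ 2 <= (F * expR (- (2 ^+ n))) ^+ 2.
    by rewrite !expr2; apply: ler_pM.
  rewrite -(ler_pM2l F0); apply: le_trans h (le_trans h2 _).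
  by rewrite exprMn -expRM_natr expr2 -mulrA exprSr mulNr.
(* With x = T0^2 / (16 s^2) < 2^(n+1), the exponent 2^n exceeds x / 2 = T0^2 / (32 s^2). *)
pose k : R := (32 * s ^+ 2)^-1.
exists k, (4 * s); split; first by rewrite invr_gt0 mulr_gt0 ?exprn_gt0.
  by rewrite mulr_gt0.
move=> T0 hT; rewrite pE lee_fin.
have s40 : 0 < 4 * s by rewrite mulr_gt0.
pose x : R := (T0 / (4 * s)) ^+ 2.
have x1 : 1 <= x by rewrite -(expr1n _ 2) ler_pXn2r ?nnegrE ?divr_ge0 ?ler_pdivlMr ?mul1r//; lra.
have [n /andP[n1 n2]] := dyadic_bracket x1.
have qn : q ^+ n <= T0 / (4 * s).
  rewrite -(@ler_pXn2r _ 2)// ?nnegrE ?exprn_ge0 ?divr_ge0//; [|lra..].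
  by rewrite exprAC q2.
have tT : t n <= T0.
  move: qn; rewrite ler_pdivlMr// => qn; have := tb n; rewrite mulrC in qn.
  lra.
apply: le_trans (pmono _ _ tT) _; apply: le_trans (pt n) _.
apply: (@le_trans _ _ (expR (- (2 ^+ n)))).
  by rewrite ler_piMl ?expR_ge0//; have := p0 s; rewrite /F; lra.
rewrite ler_expR lerN2.
have -> : k * T0 ^+ 2 = x / 2.
  by rewrite /k /x; field; rewrite gt_eqF.
by rewrite exprS in n2; lra.
Qed.

End gaussian_space.

(** * A countable dense grid and events on paths *)

Section grid.
Context {R : realType}.
Local Notation I01 := (`[0, 1]%classic : set R).

(** The fractions j / (n + 1) of [0, 1] enumerated by codes of pairs: [minn] caps the numerator, and
    a code of no pair yields the point 0. *)
Definition gridpt (k : nat) : R :=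
  let: (n, j) := odflt (0%N, 0%N) (unpickle k : option (nat * nat)) in
  (minn j n.+1)%:R / n.+1%:R.

Lemma gridpt01 k : I01 (gridpt k).
Proof.
rewrite /gridpt; case: (odflt _ _) => n j; rewrite /= in_itv/= divr_ge0//=.
by rewrite ler_pdivrMr ?ltr0n// mul1r ler_nat geq_minr.
Qed.

Lemma gridpt_dense (v dl : R) : I01 v -> 0 < dl -> exists k, `|gridpt k - v| < dl.
Proof.
rewrite /= in_itv/= => /andP[v0 v1] dl0.
pose n := Num.bound dl^-1; have n0 : (0 : R) < n.+1%:R by rewrite ltr0n.
have hn : (n.+1%:R : R)^-1 < dl.
  rewrite invf_plt ?posrE//; apply: lt_le_trans (archi_boundP _) _; first by rewrite invr_ge0 ltW.
  by rewrite ler_nat.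
have x0 : 0 <= v * n.+1%:R by rewrite mulr_ge0.
have /andP[h1 h2] := truncn_itv x0; set j := Num.trunc _ in h1 h2.
have jn : (j <= n.+1)%N.
  by rewrite -(ler_nat R); apply: le_trans h1 _; rewrite ler_piMl// ltW.
exists (pickle (n, j)); rewrite /gridpt pickleK /= (minn_idPl jn).
apply: le_lt_trans hn; rewrite distrC ler_norml.
have -> : v - j%:R / n.+1%:R = (v * n.+1%:R - j%:R) / n.+1%:R.
  by rewrite mulrBl mulfK// gt_eqF.
have i0 : (0 : R) < n.+1%:R^-1 by rewrite invr_gt0.
have E : j.+1%:R = j%:R + 1 :> R by rewrite natr1.
rewrite E in h2; move: h1 h2 i0.
set i := n.+1%:R^-1; set x := v * n.+1%:R; set y : R := j%:R => h1 h2 i0.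
have k1 : 0 <= (x - y) * i by apply: mulr_ge0; [rewrite subr_ge0|exact: ltW].
have k2 : 0 <= (1 - (x - y)) * i by apply: mulr_ge0; [lra|exact: ltW].
apply/andP; split; lra.
Qed.

Lemma grid_le (f : R -> R) (c : R) : {within I01, continuous f} ->
  (forall k, c <= f (gridpt k)) -> forall v, I01 v -> c <= f v.
Proof.
move=> cf h v Iv; apply/ler_addgt0Pr => e e0.
have [dl dl0 dlP] := within_continuousP cf Iv e0.
have [k kP] := gridpt_dense Iv dl0.
have := dlP _ (gridpt01 k) kP; rewrite ler_norml; have := h k; lra.
Qed.

(** A strict inequality is not preserved by density, so the attained minimum supplies a uniform
    margin 1/(m+1). *)
Lemma grid_lt (f : R -> R) (u : R) : {within I01, continuous f} ->
  (forall v, I01 v -> u < f v) <-> exists m : nat, forall k, u + m.+1%:R^-1 <= f (gridpt k).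
Proof.
move=> cf; split=> [h|[m h] v Iv]; last first.
  by apply: lt_le_trans (grid_le cf h Iv); rewrite ltrDl invr_gt0 ltr0n.
have [c Ic cP] := @EVT_min R f 0 1 ler01 cf.
have fc : 0 < f c - u by rewrite subr_gt0; exact: h.
exists (Num.bound (f c - u)^-1) => k.
apply: (@le_trans _ _ (f c)); last exact: (cP _ (gridpt01 k)).
rewrite -lerBrDl invf_ple ?posrE ?ltr0n//.
apply: le_trans (ltW (archi_boundP _)) _; first by rewrite invr_ge0 ltW.
by rewrite ler_nat.
Qed.

Lemma measurable_all_gt {d : measure_display} {T : measurableType d} (F : R -> T -> R) (u : R) :
  (forall v, I01 v -> measurable_fun setT (F v)) ->
  (forall w, {within I01, continuous (fun v => F v w)}) ->
  measurable [set w | forall v, I01 v -> u < F v w].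
Proof.
move=> mF cF.
have -> : [set w | forall v, I01 v -> u < F v w] =
    \bigcup_m \bigcap_k [set w | u + m.+1%:R^-1 <= F (gridpt k) w].
  apply/seteqP; split=> w /=.
    by move=> /(grid_lt _ (cF w))[m mP]; exists m => // k _; exact: mP.
  by move=> [m _ mP]; apply/(grid_lt _ (cF w)); exists m => k; exact: mP.
apply: bigcupT_measurable => m; apply: bigcap_measurableType => k _.
by apply: measurable_ge_set; apply: mF; exact: gridpt01.
Qed.

(** The supremum is a maximum, so a strict bound at every point is a strict bound on the
    supremum. *)
Lemma ereal_sup_attained (f : R -> R) (e : R) : {within I01, continuous f} ->
  (e%:E <= ereal_sup [set (f v)%:E | v in I01])%E <-> ~ (forall v, I01 v -> f v < e).
Proof.
move=> cf; split=> [h H|H].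
  have [c Ic cP] := @EVT_max R f 0 1 ler01 cf.
  have := H c Ic; rewrite ltNge => /negP; apply.
  rewrite -lee_fin; apply: le_trans h _; apply: ge_ereal_sup => _ [v Iv <-].
  by rewrite lee_fin; exact: cP.
move: H => /existsNP[v /not_implyP[Iv /negP]]; rewrite -leNgt => ev.
apply: (@le_trans _ _ (f v)%:E); first by rewrite lee_fin.
by apply: ereal_sup_ubound; exists v.
Qed.

End grid.

Lemma within_continuous_affine {R : realType} (f g : R -> R) (a b : R) :
  {within `[0, 1]%classic, continuous f} -> {within `[0, 1]%classic, continuous g} ->
  {within `[0, 1]%classic, continuous (fun v => a * f v + b * g v)}.
Proof.
move=> /subspace_continuousP cf /subspace_continuousP cg; apply/subspace_continuousP => x Ix.
apply: cvgD; apply: cvgM; [exact: cvg_cst|exact: cf|exact: cvg_cst|exact: cg].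
Qed.

Lemma within_continuous_norm {R : realType} (f : R -> R) :
  {within `[0, 1]%classic, continuous f} ->
  {within `[0, 1]%classic, continuous (fun v => `|f v|)}.
Proof.
move=> /subspace_continuousP cf; apply/subspace_continuousP => x Ix.
by apply: cvg_norm; exact: cf.
Qed.

Lemma within_continuous_Nnorm {R : realType} (f : R -> R) :
  {within `[0, 1]%classic, continuous f} ->
  {within `[0, 1]%classic, continuous (fun v => - `|f v|)}.
Proof.
move=> /within_continuous_norm/subspace_continuousP cf; apply/subspace_continuousP => x Ix.
by apply: cvgN; exact: cf.
Qed.

(** * Regression on a Gaussian variable *)

Section residual.
Context {R : realType} {d : measure_display} {T : measurableType d}.
Variable P : probability T R.
Variable Z : R -> T -> R.
Local Notation I01 := (`[0, 1]%classic : set R).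
Hypothesis Zc : forall w, {within I01, continuous (fun v => Z v w)}.
Hypothesis Zg : forall s, tagged01 s -> centered_gaussian P (lz Z s).
Variable S : T -> R.
Hypotheses (gS : gsp P Z S) (S0 : 0 < ip P S S).

(* Z minus its regression on S; for a Gaussian family this is independent of S. *)
Definition resid (v : R) (w : T) : R := Z v w - ip P (Z v) S / ip P S S * S w.

Definition grid_resid (k : nat) : T -> R := resid (gridpt k).

Lemma resid_continuous w : {within I01, continuous (fun v => resid v w)}.
Proof.
have -> : (fun v => resid v w) = fun v => 1 * Z v w + - (S w / ip P S S) * ip P (Z v) S.
  by apply/funext => v; rewrite /resid; ring.
exact: (@within_continuous_affine _ _ _ 1 (- (S w / ip P S S)) (@Zc w) (ip_Z_continuous Zc Zg (gsp_L2 gS))).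
Qed.

Lemma resid_gsp v : I01 v -> gsp P Z (resid v).
Proof. by move=> Iv; apply: (gsp_sub Zg); [exact: (gsp_Z Zg)|exact: (gsp_scale Zg)]. Qed.

Lemma grid_resid_gsp k : gsp P Z (grid_resid k).
Proof. by apply: resid_gsp; exact: gridpt01. Qed.

Lemma grid_resid_orth k : ip P S (grid_resid k) = 0.
Proof.
have LS := gsp_L2 gS; have LZ := Z_L2 Zg (gridpt01 k).
rewrite /grid_resid /resid (ipBr LZ (L2_scale _ LS) LS) ipZr//.
by rewrite divfK ?gt_eqF// ipC subrr.
Qed.

Lemma grid_resid_bounded w : exists M : R, forall k, `|grid_resid k w| <= M.
Proof.
have [M MP] := within_bounded (@resid_continuous w).
by exists M => k; apply: MP; exact: gridpt01.
Qed.

Lemma below_resid t w v : below grid_resid t w -> I01 v -> `|resid v w| <= t.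
Proof.
move=> h Iv; rewrite -lerN2.
have cN : {within I01, continuous (fun v => - `|resid v w|)}.
  by apply: within_continuous_Nnorm; exact: resid_continuous.
by apply: (grid_le cN) => // k; rewrite lerN2; exact: h.
Qed.

Let G_L2 := @gsp_L2 R d T P Z.

Lemma resid_independent (h t : R) :
  P ([set w | h <= S w] `&` below grid_resid t) =
  (P [set w | (h <= S w)%R] * P (below grid_resid t))%E.
Proof.
exact: (independent_ge_below G_L2 (gsp_add Zg) (gsp_scale Zg) (gsp_char Zg)
  grid_resid_gsp gS grid_resid_orth).
Qed.

Lemma resid_independentC (h t : R) :
  P ([set w | h <= S w] `\` below grid_resid t) =
  (P [set w | (h <= S w)%R] * P (~` below grid_resid t))%E.
Proof.
exact: (independent_ge_not_below G_L2 (gsp_add Zg) (gsp_scale Zg) (gsp_char Zg)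
  grid_resid_gsp gS grid_resid_orth).
Qed.

Lemma resid_fernique : exists k t0 : R, [/\ 0 < k, 0 < t0 & forall t, t0 <= t ->
  (P (~` below grid_resid t) <= (expR (- (k * t ^+ 2)))%:E)%E].
Proof.
exact: (fernique G_L2 (gsp_add Zg) (gsp_scale Zg) (gsp_char Zg)
  grid_resid_gsp grid_resid_bounded).
Qed.

Lemma measurable_resid_below t : measurable (below grid_resid t).
Proof. exact: (measurable_below G_L2 grid_resid_gsp). Qed.

Lemma resid_half : exists s0 : R, forall t, s0 <= t ->
  ((1 / 2)%:E <= P (below grid_resid t))%E.
Proof.
have e0 : (0 : R) < 1 / 2 by lra.
have [s _ sP] := below_cvg1 G_L2 grid_resid_gsp grid_resid_bounded e0.
exists s => t st; apply: (@le_trans _ _ (P (below grid_resid s))).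
  have mb := measurable_resid_below s.
  have E : P (~` below grid_resid s) = (1 - P (below grid_resid s))%E by exact: probability_setC.
  have fs : P (below grid_resid s) \is a fin_num by exact: fin_num_measure.
  by move: sP; rewrite E -(fineK fs) -EFinB !lee_fin; lra.
apply: le_prob; [exact: measurable_resid_below|exact: measurable_resid_below|].
by move=> w h k; exact: le_trans (h k) st.
Qed.

End residual.

(** The exponent is u^2 v / 2 + u + 1 / (2v), and for large u the term e u^2 absorbs u + 1 / (2v)
    and the logarithm of p. The shift u v + 1 is that of the lower tail bound at height u v. *)
Lemma gaussian_density_lower {R : realType} (p v e a : R) : 0 < p -> 0 < v -> 0 < e ->
  v / 2 + e <= a -> exists2 u0 : R, 0 < u0 & forall u, u0 <= u ->
    expR (- (u ^+ 2 * a)) <= p * expR (- ((u * v + 1) ^+ 2 / (2 * v))).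
Proof.
move=> p0 v0 e0 va; pose c := `|ln p| + (2 * v)^-1.
have c0 : 0 <= c by rewrite addr_ge0// invr_ge0 mulr_ge0// ltW.
have ce0 : 0 <= (1 + c) / e by apply: divr_ge0; lra.
exists (1 + (1 + c) / e); first by lra.
move=> u hu.
have u1 : 1 <= u by lra.
have ue : 1 + c <= e * u.
  rewrite mulrC -ler_pdivrMr//; apply: le_trans hu; rewrite lerDr; lra.
have -> : p = expR (ln p) by rewrite lnK.
rewrite -expRD ler_expR.
have -> : (u * v + 1) ^+ 2 / (2 * v) = u ^+ 2 * (v / 2) + u + (2 * v)^-1.
  by field; rewrite gt_eqF.
have h1 : u ^+ 2 * (v / 2 + e) <= u ^+ 2 * a by rewrite ler_wpM2l// sqr_ge0.
have h2 : u * (1 + c) <= u ^+ 2 * e.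
  by rewrite expr2 -mulrA ler_pM2l ?(lt_le_trans ltr01)// mulrC.
have h3 : c <= u * c by rewrite ler_peMl.
have h4 := ler_norm (- ln p); rewrite normrN in h4.
rewrite mulrDr in h1; rewrite mulrDr mulr1 in h2; rewrite /c in h2 h3; lra.
Qed.

(** * Large deviations *)

Section tails.
Context {R : realType} {d : measure_display} {T : measurableType d}.
Variable P : probability T R.
Variable Z : R -> T -> R.
Local Notation I01 := (`[0, 1]%classic : set R).
Hypothesis Zc : forall w, {within I01, continuous (fun v => Z v w)}.
Hypothesis Zg : forall s, tagged01 s -> centered_gaussian P (lz Z s).

Definition above (u : R) : set T := [set w | forall v, I01 v -> u < Z v w].

Lemma measurable_above u : measurable (above u).
Proof. by apply: measurable_all_gt => // v Iv; exact: L2_meas (Z_L2 Zg Iv). Qed.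

Variable mu : prob01 R.
Hypothesis Wmu : minimizer P Z mu.
Local Notation m := (ip P (HZ Z mu) (HZ Z mu)).
Local Notation S := (HZ Z mu).
Local Notation LS := (HZ_L2 Zc Zg mu).

Lemma above_HZ u : above u `<=` [set w | u <= S w].
Proof.
move=> w h; apply: E01_ge_cst; first exact: Zc.
by move=> v Iv; exact: ltW (h v Iv).
Qed.

Lemma above_null (u : R) : m = 0 -> 0 < u -> P (above u) = 0%E.
Proof.
move=> m0 u0; have mS := L2_meas LS.
have mA : measurable [set w | u <= S w] by exact: measurable_ge_set.
suff h : (P (above u) <= 0)%E by apply/eqP; rewrite eq_le h measure_ge0.
apply: (le_trans (@le_prob _ _ _ P _ _ (measurable_above u) mA (@above_HZ u))).
have u20 : 0 < u ^+ 2 by rewrite exprn_gt0.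
have h : ((u ^+ 2)%:E * P [set w | (u <= S w)%R] <= 0)%E.
  have -> : 0%E = sqexp P S by rewrite (sqexpE LS) m0.
  apply: (@markov_set _ _ _ P (fun w => S w ^+ 2)) => //.
  - exact: measurable_funX.
  - by move=> w; exact: sqr_ge0.
  - exact: ltW.
  - by move=> w /= hw; rewrite !expr2; apply: ler_pM => //; exact: ltW.
have fA : P [set w | (u <= S w)%R] \is a fin_num by exact: fin_num_measure.
by move: h; rewrite -(fineK fA) -EFinM !lee_fin pmulr_rle0.
Qed.

Hypothesis m0 : 0 < m.

Lemma above_upper (u : R) : 0 <= u -> (P (above u) <= (expR (- (u ^+ 2 / (2 * m))))%:E)%E.
Proof.
move=> u0; apply: le_trans (gsp_chernoff Zg (HZ_gsp Zc Zg mu) m0 u0).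
apply: le_prob (@above_HZ u); first exact: measurable_above.
exact: measurable_ge_set (L2_meas LS).
Qed.

(** (1 + 2k) Hstar is feasible with margin 2k. Replacing it by a combination at L2 distance k / M,
    where M bounds the norms of the Z_v, costs at most k. *)
Lemma good_combination (e : R) : 0 < e -> exists c (k : R), [/\ 0 < k, tagged01 c,
  forall v, I01 v -> 1 + k <= ip P (Z v) (lz Z c) & ip P (lz Z c) (lz Z c) <= m^-1 + e].
Proof.
(* For k <= 1 one has (1 + 2k)^2 / m <= 1/m + 8 k / m <= 1/m + e/2; the other e/2 is for the
   approximation. *)
move=> e0; pose k := Num.min 1 (e * m / 16).
have k0 : 0 < k by rewrite lt_min ltr01 divr_gt0// mulr_gt0.
have k1 : k <= 1 by rewrite ge_min lexx.
have ke : k <= e * m / 16 by rewrite ge_min lexx orbT.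
have gH := gsp_scale Zg (1 + 2 * k) (Hstar_gsp Zc Zg mu).
have LH := gsp_L2 gH; have L0 := Hstar_L2 Zc Zg mu.
have [M M0 MP] := nrm_Z_bounded Zc Zg.
have [c [tc cY _ nY]] := gH.
have cn := ip_cvg2 (fun n => lz_L2 Zg (tc n)) LH nY.
set H := (fun w => (1 + 2 * k) * Hstar P Z mu w) in gH LH cY nY cn.
have HH : ip P H H <= m^-1 + e / 2.
  rewrite /H (ipZl _ L0 LH) (ipZr _ L0 L0) (ip_Hstar Zc Zg m0).
  have mi : 0 < m^-1 by rewrite invr_gt0.
  have h1 : k * m^-1 <= e / 16.
    by rewrite ler_pdivrMr// (le_trans ke)// mulrAC.
  have h2 : k * (k * m^-1) <= k * m^-1 by rewrite ler_piMl// mulr_ge0// ltW.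
  rewrite mulrA; set i := m^-1 in mi h1 h2 *.
  have -> : (1 + 2 * k) * (1 + 2 * k) * i = i + 4 * (k * i) + 4 * (k * (k * i)) by ring.
  lra.
have e20 : 0 < e / 2 by rewrite divr_gt0.
have kM : 0 < k / M by rewrite divr_gt0.
have [n1 n1P] := cvgr_ltP cn e20.
have [n2 n2P] := cvgr_ltP nY kM.
pose n := maxn n1 n2; exists (c n), k; split=> //; last first.
  have := n1P n (leq_maxl _ _); rewrite ler_norml; lra.
move=> v Iv; have LZ := Z_L2 Zg Iv; have Lc := lz_L2 Zg (tc n).
have h1 : 1 + 2 * k <= ip P (Z v) H.
  rewrite /H ipZr// ler_pMr; first exact: (Hstar_feasible Zc Zg).
  by rewrite addr_gt0// mulr_gt0.
have := ip_le LZ (L2_sub Lc LH); rewrite ipBr// -/(nrm P (Z v)) -/(nrm P _) => h2.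
have h3 : nrm P (fun w => lz Z (c n) w - H w) <= k / M.
  by have := n2P n (leq_maxr _ _); rewrite subr0; apply: le_trans; exact: ler_norm.
have h4 : nrm P (Z v) * nrm P (fun w => lz Z (c n) w - H w) <= M * (k / M).
  by apply: ler_pM => //; [exact: nrm_ge0|exact: nrm_ge0|exact: MP].
have E : M * (k / M) = k by rewrite mulrC divfK// gt_eqF.
have := le_trans h2 h4; rewrite E ler_norml; lra.
Qed.

Lemma above_lower (e : R) : 0 < e -> exists2 u0 : R, 0 < u0 & forall u, u0 <= u ->
  ((expR (- (u ^+ 2 * ((2 * m)^-1 + e))))%:E <= P (above u))%E.
Proof.
move=> e0; have [c [k [k0 tc kP nS]]] := good_combination e0.
set Y := lz Z c in kP nS.
have gY : gsp P Z Y := gsp_lz Zg tc.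
have LY := gsp_L2 gY.
have I0 : I01 0 by rewrite /= in_itv/= lexx ler01.
have Y0 : 0 < ip P Y Y.
  have := kP 0 I0; have := ip_CS (Z_L2 Zg I0) LY.
  have := ip_ge0 P Y; rewrite le_eqVlt => /predU1P[<-|//].
  rewrite mulr0 => h1 h2; have h3 : 0 < ip P (Z 0) Y by lra.
  by have := exprn_gt0 2 h3; lra.
set v := ip P Y Y in nS Y0.
have s0 : 0 < Num.sqrt v by rewrite sqrtr_gt0.
have [_ _ _ _ dens] := gaussianP (Zg tc).
have p0 : 0 < normal_peak (Num.sqrt v) / 2 by rewrite divr_gt0// normal_peak_gt0// gt_eqF.
(* Since v <= 1/m + e, half of the margin e is left to absorb the lower-order terms of the
   density. *)
have va : v / 2 + e / 2 <= (2 * m)^-1 + e by rewrite invfM; lra.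
have [u1 u10 u1P] := gaussian_density_lower p0 Y0 (divr_gt0 e0 (ltr0n _ 2)) va.
have [t0 t0P] := resid_half Zc Zg gY.
exists (Num.max u1 (2 * `|t0| / k)); first by rewrite lt_max u10.
move=> u; rewrite ge_max => /andP[hu1 hu2].
have u0 : 0 < u by exact: lt_le_trans hu1.
have tu : t0 <= u * k / 2.
  apply: le_trans (ler_norm _) _; move: hu2; rewrite ler_pdivrMr//; lra.
pose B := below (grid_resid P Z Y) (u * k / 2).
(* The regression part is at least u (1 + k) and the residual at least - u k / 2, so u k / 2 is to
   spare. *)
have sub : [set w | u * v <= Y w] `&` B `<=` above u.
  move=> w [/= h1 h2] x Ix; have := below_resid Zc Zg gY h2 Ix.
  rewrite /resid -/v ler_norml => /andP[h3 _].
  have h4 := kP x Ix.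
  have h5 : u * (1 + k) <= ip P (Z x) Y / v * Y w.
    apply: (@le_trans _ _ (ip P (Z x) Y / v * (u * v))).
      have -> : ip P (Z x) Y / v * (u * v) = u * ip P (Z x) Y by field; rewrite gt_eqF.
      by rewrite ler_pM2l.
    by rewrite ler_wpM2l// divr_ge0 ?ltW//; lra.
  have : 0 < u * k by rewrite mulr_gt0.
  lra.
have mY : measurable [set w | u * v <= Y w] by exact: measurable_ge_set (L2_meas LY).
have mB : measurable B by exact: (measurable_resid_below Zg gY).
apply: le_trans (@le_prob _ _ _ P _ _ (measurableI _ _ mY mB) (measurable_above u) sub).
have -> : P ([set w | u * v <= Y w] `&` B) = (P [set w | (u * v <= Y w)%R] * P B)%E.
  exact: (resid_independent Zg gY Y0).
have hB : ((1 / 2)%:E <= P B)%E by exact: t0P.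
have uv0 : 0 <= u * v by rewrite mulr_ge0// ltW.
have hY := dens (u * v) uv0 Y0; rewrite -/Y -/v in hY.
apply: (@le_trans _ _ ((normal_pdf 0 (Num.sqrt v) (u * v + 1))%:E * (1 / 2)%:E)%E); last first.
  by apply: lee_pmul => //; rewrite lee_fin ?normal_pdf_ge0//; lra.
rewrite -EFinM lee_fin normal_pdfE ?gt_eqF// /normal_fun subr0 (sqr_sqrtr (ltW Y0)).
apply: le_trans (u1P u hu1) _.
rewrite mulrAC mulrA mulr1 mulNr -[v *+ 2]mulr_natl.
by rewrite mulrAC.
Qed.

(** The bound is relative to P(above u), ready for division. The factor 2 counts two bad events:
    H_mu overshoots u (1 + dt), or H_mu >= u with a large independent residual. *)
Lemma concentration (eps : R) : 0 < eps -> exists c u0 : R, [/\ 0 < c, 0 < u0 & forall u, u0 <= u ->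
  (P (~` [set w | forall v, I01 v -> (`|Z v w / u - ip P (Z v) (Hstar P Z mu)| < eps)%R]
      `&` above u) <= (2 * expR (- (c * u ^+ 2)))%:E * P (above u))%E].
Proof.
move=> e0; have L0 := Hstar_L2 Zc Zg mu; have gS := HZ_gsp Zc Zg mu.
have [M MP] := within_bounded (ip_Z_continuous Zc Zg L0).
(* An overshoot below [dt] then moves the limit profile, bounded by |M| + 1, by at most eps / 4. *)
pose dt := eps / (4 * (`|M| + 1)).
have dt0 : 0 < dt by rewrite divr_gt0// mulr_gt0.
have [k [t0 [k0 t00 tail]]] := resid_fernique Zc Zg gS.
(* Each bad event gains at least 2 c in the rate; one c pays for the loss in the lower bound of
   P(above u), the other remains. *)
pose c := Num.min (dt / m) (k * eps ^+ 2 / 16) / 2.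
have c0 : 0 < c by rewrite divr_gt0// lt_min !divr_gt0// mulr_gt0// exprn_gt0.
have c1 : 2 * c <= dt / m by rewrite /c mulrCA divff// mulr1 ge_min lexx.
have c2 : 2 * c <= k * eps ^+ 2 / 16 by rewrite /c mulrCA divff// mulr1 ge_min lexx orbT.
have [u1 u10 u1P] := above_lower c0.
exists c, (Num.max u1 (4 * t0 / eps)); split=> //; first by rewrite lt_max u10.
move=> u; rewrite ge_max => /andP[hu1 hu2].
have u0 : 0 < u by exact: lt_le_trans hu1.
set good := [set w | _].
pose B := below (grid_resid P Z S) (u * eps / 4).
have mB : measurable B by exact: (measurable_resid_below Zg gS).
have mge (h : R) : measurable [set w | h <= S w] by exact: measurable_ge_set (L2_meas LS).
have mgood : measurable good.
  have -> : good = [set w | forall v, I01 v ->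
      - eps < - `|u^-1 * Z v w + -1 * ip P (Z v) (Hstar P Z mu)|].
    by apply/seteqP; split=> w /= h v Iv; have := h v Iv; rewrite ltrN2 mulN1r mulrC.
  apply: measurable_all_gt => [v Iv|w].
    apply: measurableT_comp => //; apply: measurableT_comp => //.
    apply: measurable_funD => //; apply: measurable_funM => //.
    exact: L2_meas (Z_L2 Zg Iv).
  apply: within_continuous_Nnorm.
  exact: (@within_continuous_affine _ _ _ u^-1 (-1) (@Zc w) (ip_Z_continuous Zc Zg L0)).
have sub : ~` good `&` above u `<=`
    [set w | u * (1 + dt) <= S w] `|` ([set w | u <= S w] `\` B).
  move=> w [h1 h2]; have h3 := above_HZ h2; rewrite /= in h3.
  have [h4|h4] := leP (u * (1 + dt)) (S w); [by left|right; split=> // h5; apply: h1 => v Iv].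
  have := below_resid Zc Zg gS h5 Iv; rewrite /resid => h6.
  have LZ := Z_L2 Zg Iv.
  have xE : ip P (Z v) S / m = ip P (Z v) (Hstar P Z mu).
    by rewrite /Hstar (ipZr _ LS LZ) mulrC.
  rewrite xE in h6; set x := ip P (Z v) (Hstar P Z mu) in h6 *.
  (* Residual plus relative overshoot, since the regression coefficient of Z_v on H_mu is [x]
     itself. *)
  have -> : Z v w / u - x = (Z v w - x * S w) / u + x * ((S w - u) / u).
    by field; rewrite gt_eqF.
  have xM : `|x| <= `|M| + 1.
    by apply: le_trans (MP v Iv) _; apply: le_trans (ler_norm _) _; rewrite lerDl.
  apply: le_lt_trans (ler_normD _ _) _.
  have k1 : `|(Z v w - x * S w) / u| <= eps / 4.
    rewrite normrM (gtr0_norm (_ : 0 < u^-1)) ?invr_gt0// ler_pdivrMr//.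
    by apply: le_trans h6 _; rewrite mulrC mulrA mulrAC; lra.
  have k2 : `|x * ((S w - u) / u)| <= (`|M| + 1) * dt.
    rewrite normrM; apply: ler_pM => //.
    rewrite ger0_norm; first by rewrite ler_pdivrMr//; lra.
    by apply: divr_ge0; [rewrite subr_ge0|exact: ltW].
  have k3 : (`|M| + 1) * dt = eps / 4 by rewrite /dt; field; rewrite gt_eqF.
  lra.
have mU : measurable ([set w | u * (1 + dt) <= S w] `|` ([set w | u <= S w] `\` B)).
  by apply: measurableU => //; exact: measurableD.
apply: (le_trans (@le_prob _ _ _ P _ _ (measurableI _ _ (measurableC mgood) (measurable_above u)) mU sub)).
apply: (@le_trans _ _ (P [set w | (u * (1 + dt) <= S w)%R]
    + P ([set w | (u <= S w)%R] `\` B))%E).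
  by apply: measureU2 => //; exact: measurableD.
have -> : P ([set w | (u <= S w)%R] `\` B) = (P [set w | (u <= S w)%R] * P (~` B))%E.
  exact: (resid_independentC Zg gS m0).
have ud0 : 0 <= u * (1 + dt) by rewrite mulr_ge0 ?addr_ge0// ltW.
have r1 := gsp_chernoff Zg gS m0 ud0.
have r2 := gsp_chernoff Zg gS m0 (ltW u0).
have r3 : (P (~` B) <= (expR (- (k * (u * eps / 4) ^+ 2)))%:E)%E.
  apply: tail; move: hu2; rewrite ler_pdivrMr//; lra.
have r4 : (P [set w | (u <= S w)%R] * P (~` B) <=
    (expR (- (u ^+ 2 / (2 * m))) * expR (- (k * (u * eps / 4) ^+ 2)))%:E)%E.
  by rewrite EFinM; apply: lee_pmul.
apply: (le_trans (leeD r1 r4)).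
apply: (@le_trans _ _ ((2 * expR (- (c * u ^+ 2)))%:E *
   (expR (- (u ^+ 2 * ((2 * m)^-1 + c))))%:E)%E); last first.
  by apply: lee_wpmul2l (u1P u hu1); rewrite lee_fin mulr_ge0// expR_ge0.
rewrite -EFinD -EFinM lee_fin -expRD.
have -> : 2 * expR (- (c * u ^+ 2)) * expR (- (u ^+ 2 * ((2 * m)^-1 + c))) =
    expR (- (c * u ^+ 2) - u ^+ 2 * ((2 * m)^-1 + c)) +
    expR (- (c * u ^+ 2) - u ^+ 2 * ((2 * m)^-1 + c)) by rewrite expRD; ring.
have uu : 0 < u ^+ 2 by rewrite exprn_gt0.
apply: lerD; rewrite ler_expR.
  have q1 : u ^+ 2 * (2 * c) <= u ^+ 2 * (dt / m) by rewrite ler_pM2l.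
  have -> : (u * (1 + dt)) ^+ 2 / (2 * m) =
      u ^+ 2 * (2 * m)^-1 + u ^+ 2 * (dt / m) + u ^+ 2 * (dt ^+ 2 / (2 * m)).
    by field; rewrite gt_eqF.
  have : 0 <= u ^+ 2 * (dt ^+ 2 / (2 * m)).
    by rewrite mulr_ge0 ?sqr_ge0// divr_ge0 ?sqr_ge0// mulr_ge0// ltW.
  lra.
have q2 : u ^+ 2 * (2 * c) <= u ^+ 2 * (k * eps ^+ 2 / 16) by rewrite ler_pM2l.
have -> : k * (u * eps / 4) ^+ 2 = u ^+ 2 * (k * eps ^+ 2 / 16) by field.
lra.
Qed.

End tails.

(** * From exponential bounds to limits *)

Section limits_at_infinity.
Context {R : realType}.

(** For large u the bounds make [p u] a positive real, so [lnE] is the real logarithm there and both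
    bounds can be read on it. *)
Lemma log_asymptotics (p : R -> \bar R) (a : R) :
  (forall e : R, 0 < e -> exists2 u0 : R, 0 < u0 & forall u, u0 <= u ->
    ((expR (- (u ^+ 2 * (a + e))))%:E <= p u)%E) ->
  (forall u : R, 0 <= u -> (p u <= (expR (- (u ^+ 2 * a)))%:E)%E) ->
  ((u ^- 2)%:E * lnE (p u))%E @[u --> +oo] --> (- a)%:E.
Proof.
move=> lo up; have [u1 u10 lo1] := lo 1 ltr01.
have pE u : u1 <= u -> exists2 q : R, 0 < q & p u = q%:E.
  move=> hu; have h1 := lo1 u hu; have h2 := up u (le_trans (ltW u10) hu).
  case: (p u) h1 h2 => [q|//|//]; rewrite !lee_fin => h1 h2.
  by exists q => //; apply: lt_le_trans h1; exact: expR_gt0.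
have E u : u1 <= u -> ((u ^- 2 * ln (fine (p u)))%:E = (u ^- 2)%:E * lnE (p u))%E.
  by move=> /pE[q q0 ->]; rewrite /lnE eqe gt_eqF// EFinM.
have near1 : \forall u \near +oo, ((u ^- 2 * ln (fine (p u)))%:E = (u ^- 2)%:E * lnE (p u))%E.
  by exists u1; split; [exact: num_real|move=> u /ltW; exact: E].
apply: (cvg_trans (near_eq_cvg near1)).
apply: cvg_toE; apply/cvgrPdist_le => e e0.
have [u2 u20 lo2] := lo e e0.
exists (Num.max u1 u2); split; first exact: num_real.
move=> u; rewrite gt_max => /andP[/ltW h1 /ltW h2].
have u0 : 0 < u by exact: lt_le_trans h1.
have uu : 0 < u ^+ 2 by rewrite exprn_gt0.
have [q q0 qE] := pE u h1.
have := lo2 u h2; have := up u (ltW u0); rewrite qE !lee_fin => k1 k2 /=.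
have l1 : ln q <= - (u ^+ 2 * a) by rewrite -[leRHS]expRK ler_ln ?posrE ?expR_gt0.
have l2 : - (u ^+ 2 * (a + e)) <= ln q by rewrite -[leLHS]expRK ler_ln ?posrE ?expR_gt0.
have r1 : u ^- 2 * ln q <= - a by rewrite mulrC ler_pdivrMr// mulNr mulrC.
have r2 : - (a + e) <= u ^- 2 * ln q by rewrite mulrC ler_pdivlMr// mulNr mulrC.
by rewrite ler_norml; apply/andP; split; lra.
Qed.

Lemma log_asymptotics_null (p : R -> \bar R) : (forall u, 0 < u -> p u = 0%E) ->
  ((u ^- 2)%:E * lnE (p u))%E @[u --> +oo] --> -oo%E.
Proof.
move=> p0; apply: cvg_near_cst; exists 0; split; first exact: num_real.
move=> u u0; rewrite /lnE p0// eqxx gt0_muleNy// lte_fin.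
by rewrite invr_gt0 exprn_gt0.
Qed.

Lemma gaussian_ratio_cvg0 (p q : R -> \bar R) (c u0 : R) : 0 < c ->
  (forall u, (0 <= q u)%E) ->
  (forall u, u0 <= u -> exists2 r : R, 0 < r & p u = r%:E) ->
  (forall u, u0 <= u -> (q u <= (2 * expR (- (c * u ^+ 2)))%:E * p u)%E) ->
  (fine (q u) / fine (p u)) @[u --> +oo] --> (0 : R).
Proof.
move=> c0 q0 pE qp; apply/cvgr0Pnorm_le => e e0.
exists (Num.max u0 (Num.max 1 (2 / (c * e)))); split; first exact: num_real.
move=> u; rewrite !gt_max => /and3P[/ltW h1 /ltW h2 /ltW h3].
have [r r0 rE] := pE u h1; have := qp u h1; have := q0 u; rewrite rE -EFinM.
case: (q u) => [s|//|//]; rewrite !lee_fin /= => s0 sr.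
rewrite ger0_norm ?divr_ge0 ?(ltW r0)// ler_pdivrMr//; apply: le_trans sr _.
rewrite ler_pM2r//.
have cu : c * u <= c * u ^+ 2 by rewrite ler_pM2l// expr2 ler_peMl//; lra.
have h4 : 2 <= e * (c * u) by move: h3; rewrite ler_pdivrMr ?mulr_gt0//; lra.
have h5 := expR_ge1Dx (c * u ^+ 2).
rewrite expRN ler_pdivrMr ?expR_gt0//.
have h6 : e * (c * u) <= e * expR (c * u ^+ 2) by rewrite ler_pM2l//; lra.
lra.
Qed.

End limits_at_infinity.

(** * The field along the path *)

Section path.
Context {R : realType} {d : nat} {dO : measure_display} {Omega : measurableType dO}.
Variable P : probability Omega R.
Variables (T : set 'rV[R]_d) (X : 'rV[R]_d -> Omega -> R) (xi : R -> 'rV[R]_d).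
Local Notation I01 := (`[0, 1]%classic : set R).
Hypothesis GX : centered_gaussian_field P T X.
Hypothesis cX : forall w, {within T, continuous (fun t => X t w)}.
Hypothesis cxi : {within I01, continuous xi}.
Hypothesis xiT : forall v, I01 v -> T (xi v).

Local Notation Z := (fun v => X (xi v)).

Lemma path_continuous w : {within I01, continuous (fun v => X (xi v) w)}.
Proof.
apply/subspace_continuousP => v Iv.
move/subspace_continuousP : (@cX w) => /(_ _ (xiT Iv)) h.
move/subspace_continuousP : cxi => /(_ v Iv) h'.
move=> A nA; have hB : nbhs (xi v) [set t | T t -> A (X t w)] := h A nA.
have hV : nbhs v [set x | I01 x -> T (xi x) -> A (X (xi x) w)] := h' _ hB.
have : nbhs v [set x | I01 x -> A (X (xi x) w)].
  by apply: filterS hV => x k Ix; exact: k Ix (xiT Ix).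
exact.
Qed.

Definition on_path (s : seq (R * R)) : seq (R * 'rV[R]_d) := [seq (p.1, xi p.2) | p <- s].

Lemma lz_path s : lz Z s = lincomb X (on_path s).
Proof. by apply/funext => w; rewrite /lz /lincomb big_map. Qed.

Lemma on_path_T s : tagged01 s -> forall p, p \in on_path s -> T p.2.
Proof. by move=> ts p /mapP[q qs ->]; exact: xiT (ts q qs). Qed.

Lemma path_gaussian s : tagged01 s -> centered_gaussian P (lz Z s).
Proof. by move=> ts; rewrite lz_path; apply: GX; exact: on_path_T. Qed.

(** Convergence to 0 makes some approximation error finite, and H is that error plus a Gaussian
    combination. *)
Lemma inL_L2 H : inL P T X H -> L2 P H.
Proof.
move=> [mH [c [cT cH]]].
have Lc n : L2 P (lincomb X (c n)) by have [] := gaussianP (GX (cT n)).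
have [n nP] : exists n, (sqexp P (fun w => (H w - lincomb X (c n) w)%R) < +oo)%E.
  have /fine_cvgP[[n _ nP] _] := cH.
  by exists n; rewrite ltey_eq; have := nP n (leqnn _) => ->.
have LD : L2 P (fun w => H w - lincomb X (c n) w).
  by apply: sqexp_L2 => //; apply: measurable_funB => //; exact: L2_meas (Lc n).
have := L2_add LD (Lc n); congr (L2 P _).
by apply/funext => w; rewrite subrK.
Qed.

Lemma gsp_inL H : gsp P Z H -> inL P T X H.
Proof.
move=> [c [tc cH LH nH]]; split; first exact: L2_meas LH.
exists (fun n => on_path (c n)); split; first by move=> n; exact: on_path_T.
have Lc n : L2 P (lz Z (c n)) := lz_L2 path_gaussian (tc n).
have E : (fun n => \int[P]_w ((H w - lincomb X (on_path (c n)) w) ^+ 2)%:E)%E =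
    (fun n => (nrm P (fun w => lz Z (c n) w - H w) ^+ 2)%:E).
  apply/funext => n; rewrite -lz_path nrm_distC nrm_sqr.
  exact: sqexpE (L2_sub LH (Lc n)).
rewrite E; apply: cvg_toE.
have <- : 0 * 0 = 0 :> R by rewrite mulr0.
exact: (cvgM nH nH).
Qed.

Lemma wH_path H v : L2 P H -> I01 v -> wH P X H (xi v) = (ip P (Z v) H)%:E.
Proof.
by move=> LH Iv; rewrite /wH EFin_Rintegral//; apply: L2_mul => //; exact: (Z_L2 path_gaussian).
Qed.

End path.

(** * The constrained minimization problem *)

Section optimum.
Context {R : realType} {d : nat} {dO : measure_display} {Omega : measurableType dO}.
Variable P : probability Omega R.
Variables (T : set 'rV[R]_d) (X : 'rV[R]_d -> Omega -> R) (xi : R -> 'rV[R]_d).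
Local Notation I01 := (`[0, 1]%classic : set R).
Hypothesis GX : centered_gaussian_field P T X.
Hypothesis cX : forall w, {within T, continuous (fun t => X t w)}.
Hypothesis cxi : {within I01, continuous xi}.
Hypothesis xiT : forall v, I01 v -> T (xi v).
Local Notation Z := (fun v => X (xi v)).
Local Notation Zc := (path_continuous cX cxi xiT).
Local Notation Zg := (path_gaussian GX xiT).

Definition feasible : set (Omega -> R) :=
  [set H | inL P T X H /\ forall v, I01 v -> (1 <= wH P X H (xi v))%E].

Definition strictly_feasible : set (Omega -> R) :=
  [set H | inL P T X H /\ forall v, I01 v -> (1 < wH P X H (xi v))%E].

Lemma feasibleP H : feasible H -> L2 P H /\ forall v, I01 v -> 1 <= ip P (Z v) H.
Proof.
move=> [LH fH]; have L := inL_L2 GX LH; split=> // v Iv.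
by have := fH v Iv; rewrite (wH_path GX xiT L Iv) lee_fin.
Qed.

Lemma strictly_feasible_sub : strictly_feasible `<=` feasible.
Proof. by move=> H [LH fH]; split=> // v Iv; exact: ltW (fH v Iv). Qed.

Variable mu : prob01 R.
Hypothesis Wmu : minimizer P Z mu.
Local Notation m := (ip P (HZ Z mu) (HZ Z mu)).

Lemma infeasible : m = 0 -> feasible = set0.
Proof.
move=> m0; apply/seteqP; split=> // H /feasibleP[LH fH].
by have := feasible_energy_gt0 Zc Zg mu LH fH; rewrite m0 ltxx.
Qed.

Lemma Hstar_in_feasible : 0 < m -> feasible (Hstar P Z mu).
Proof.
move=> m0; have L := Hstar_L2 Zc Zg mu; split.
  exact: (gsp_inL GX xiT (Hstar_gsp Zc Zg mu)).
move=> v Iv; rewrite (wH_path GX xiT L Iv) lee_fin.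
exact: (Hstar_feasible Zc Zg Wmu m0).
Qed.

Lemma feasible_value : 0 < m ->
  ereal_inf [set sqexp P H | H in feasible] = (m^-1)%:E.
Proof.
move=> m0; have L := Hstar_L2 Zc Zg mu; apply/eqP; rewrite eq_le; apply/andP; split.
  apply: ereal_inf_lbound; exists (Hstar P Z mu); first exact: Hstar_in_feasible.
  by rewrite (sqexpE L) (ip_Hstar Zc Zg m0).
apply: le_ereal_inf_tmp => _ [H /feasibleP[LH fH] <-].
by rewrite (sqexpE LH) lee_fin (feasible_norm Zc Zg m0 LH fH).
Qed.

(** (1 + k) Hstar meets the strict constraints, and its norm tends to that of Hstar as k tends to
    0. *)
Lemma strictly_feasible_value : 0 < m ->
  ereal_inf [set sqexp P H | H in strictly_feasible] = (m^-1)%:E.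
Proof.
move=> m0; have L := Hstar_L2 Zc Zg mu; apply/eqP; rewrite eq_le; apply/andP; split; last first.
  by rewrite -(feasible_value m0); apply: le_ereal_inf => _ [H fH <-]; exists H => //;
    exact: strictly_feasible_sub.
apply/lee_addgt0Pr => e e0; pose k := Num.min 1 (e * m / 3).
have k0 : 0 < k by rewrite lt_min ltr01 divr_gt0// mulr_gt0.
have k1 : k <= 1 by rewrite ge_min lexx.
have ke : k <= e * m / 3 by rewrite ge_min lexx orbT.
have gH := gsp_scale Zg (1 + k) (Hstar_gsp Zc Zg mu).
have LH := gsp_L2 gH.
apply: (@le_trans _ _ (sqexp P (fun w => (1 + k)%R * Hstar P Z mu w)%R)).
  apply: ereal_inf_lbound; exists (fun w => (1 + k) * Hstar P Z mu w) => //; split.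
    exact: (gsp_inL GX xiT gH).
  move=> v Iv; rewrite (wH_path GX xiT LH Iv) lte_fin (ipZr _ L (Z_L2 Zg Iv)).
  apply: (@lt_le_trans _ _ (1 + k)); first by rewrite ltrDl.
  rewrite ler_pMr; first exact: (Hstar_feasible Zc Zg Wmu m0).
  by rewrite addr_gt0.
rewrite (sqexpE LH) (ipZl _ L LH) (ipZr _ L L) (ip_Hstar Zc Zg m0) -EFinD lee_fin.
have mi : 0 < m^-1 by rewrite invr_gt0.
have h1 : k * m^-1 <= e / 3 by rewrite ler_pdivrMr// (le_trans ke)// mulrAC.
have h2 : k * (k * m^-1) <= k * m^-1 by rewrite ler_piMl// mulr_ge0// ltW.
rewrite mulrA; set i := m^-1 in mi h1 h2 *.
have -> : (1 + k) * (1 + k) * i = i + 2 * (k * i) + k * (k * i) by ring.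
lra.
Qed.

Lemma optimizer_ae H : 0 < m -> feasible H ->
  sqexp P H = ereal_inf [set sqexp P H' | H' in feasible] ->
  {ae P, forall w, H w = Hstar P Z mu w}.
Proof.
move=> m0 /feasibleP[LH fH]; rewrite (feasible_value m0) (sqexpE LH) => -[nH].
exact: (feasible_unique Zc Zg m0 LH fH nH).
Qed.

(** Covariances ignore null sets, so whatever is shown for [Hstar] along the path passes to every
    optimizer. *)
Lemma optimizer_wH H v : 0 < m -> feasible H ->
  sqexp P H = ereal_inf [set sqexp P H' | H' in feasible] -> I01 v ->
  wH P X H (xi v) = (ip P (Z v) (Hstar P Z mu))%:E.
Proof.
move=> m0 fH nH Iv; have [LH _] := feasibleP fH; have L := Hstar_L2 Zc Zg mu.
rewrite (wH_path GX xiT LH Iv); congr EFin.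
exact: ae_eq_ip LH L (Z_L2 Zg Iv) (optimizer_ae m0 fH nH).
Qed.

End optimum.

Theorem theorem4p1 (R : realType) (d : nat) (dO : measure_display)
  (Omega : measurableType dO) (P : probability Omega R)
  (T : set 'rV[R]_d) (X : 'rV[R]_d -> Omega -> R)
  (xi : R -> 'rV[R]_d) (a b : 'rV[R]_d) :
  compact T ->
  centered_gaussian_field P T X ->
  (forall w, {within T, continuous (fun t => X t w)}) ->
  {within `[0, 1]%classic, continuous xi} ->
  (forall v, v \in `[0, 1] -> T (xi v)) ->
  xi 0 = a -> xi 1 = b ->
  let I01 := `[0, 1]%classic : set R in
  let C := ereal_inf [set sqexp P H | H in
             [set H | inL P T X H /\ forall v, I01 v -> (1 < wH P X H (xi v))%E]] in
  let feas := [set H | inL P T X H /\ forall v, I01 v -> (1 <= wH P X H (xi v))%E] in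
  let Hopt := fun H => feas H /\ sqexp P H = ereal_inf [set sqexp P H' | H' in feas] in
  let Psi := fun u : R => P [set w | forall v, I01 v -> u < X (xi v) w] in
  let W := [set mu : prob01 R | forall nu : prob01 R,
              (energy (fun u v => covX P X (xi u) (xi v)) mu
               <= energy (fun u v => covX P X (xi u) (xi v)) nu)%E] in
  (* (i) *)
  ((u ^- 2)%:E * lnE (Psi u))%E @[u --> +oo] --> (- (C * (2^-1)%:E))%E /\
  (* (ii) *)
  (C = ereal_inf [set sqexp P H | H in feas] /\
   (feas !=set0 -> exists H, Hopt H /\
      forall H', Hopt H' -> {ae P, forall w, H' w = H w})) /\
  (* (iii) *)
  (W !=set0 /\ weakly_compact W /\ convex_prob01 W /\
   (feas !=set0 -> forall H, Hopt H -> forall mu, W mu ->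
      mu [set v | I01 v /\ (1 < wH P X H (xi v))%E] = 0%E)) /\
  (* (iv) *)
  (feas !=set0 -> forall H, Hopt H -> forall eps : R, 0 < eps ->
     (fine (P ([set w | (eps%:E <= ereal_sup
                  [set `| X (xi v) w / u - fine (wH P X H (xi v)) |%:E | v in I01])%E]
               `&` [set w | forall v, I01 v -> u < X (xi v) w]))
      / fine (Psi u)) @[u --> +oo] --> 0).
Proof.
move=> cT GX cX cxi xiT' xa xb I01 C feas Hopt Psi W.
have xiT v : I01 v -> T (xi v) by move=> Iv; exact: xiT'.
pose Z v := X (xi v).
have Zc : forall w, {within I01, continuous (fun v => Z v w)}.
  exact: (path_continuous cX cxi xiT).
have Zg s : tagged01 s -> centered_gaussian P (lz Z s) by exact: (path_gaussian GX xiT).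
(* [covX] at two path points is convertible to [ip], so [energyE] applies to the kernel of the
   statement. *)
have WE : W = minimizer P Z.
  apply/seteqP; split=> mu h nu; have := h nu.
    by rewrite [X in (X <= _)%E -> _](energyE Zc Zg mu)
      [X in (_ <= X)%E -> _](energyE Zc Zg nu) lee_fin.
  by move=> k; rewrite [X in (X <= _)%E](energyE Zc Zg mu)
    [X in (_ <= X)%E](energyE Zc Zg nu) lee_fin.
have [mu Wmu] := minimizer_exists Zc Zg.
set m := ip P (HZ Z mu) (HZ Z mu).
have m_ge0 : 0 <= m by exact: ip_ge0.
have m_gt0 nu : feas !=set0 -> 0 < ip P (HZ Z nu) (HZ Z nu).
  by move=> [H fH]; have [LH fH'] := feasibleP GX xiT fH; exact: (feasible_energy_gt0 Zc Zg nu LH fH').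
have mS u : measurable (above Z u) by exact: (measurable_above Zc Zg).
have valC : feas !=set0 -> C = (m^-1)%:E.
  by move=> fe; exact: (strictly_feasible_value GX cX cxi xiT Wmu (m_gt0 mu fe)).
split.
  have [m0|m0] := eqVneq m 0; last first.
    have {}m0 : 0 < m by rewrite lt_def m0.
    have -> : C = (m^-1)%:E by exact: (strictly_feasible_value GX cX cxi xiT Wmu m0).
    rewrite -EFinM -EFinN; have -> : - (m^-1 * 2^-1) = - (2 * m)^-1 by rewrite invfM mulrC.
    apply: log_asymptotics.
      exact: (above_lower Zc Zg Wmu m0).
    exact: (above_upper Zc Zg m0).
  (* Zero energy: both infima are over the empty set, C = +oo, and the limit to reach is -oo. *)
  have f0 : feas = set0 by exact: (infeasible GX cX cxi xiT m0).
  have -> : C = +oo%E.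
    rewrite /C (_ : [set H | inL P T X H /\ _] = set0) ?image_set0 ?ereal_inf0//.
    by rewrite -subset0 -f0; exact: strictly_feasible_sub.
  rewrite gt0_mulye ?lte_fin//; apply: log_asymptotics_null => u u0.
  exact: (above_null Zc Zg m0 u0).
split.
  split.
    have [fe|/set0P/negP/negPn/eqP fe] := pselect (feas !=set0).
      rewrite valC//.
      by rewrite [RHS](feasible_value GX cX cxi xiT Wmu (m_gt0 mu fe)).
    rewrite /C fe (_ : [set H | inL P T X H /\ _] = set0)//.
    by rewrite -subset0 -fe; exact: strictly_feasible_sub.
  move=> fe; have m0 := m_gt0 mu fe; exists (Hstar P Z mu); split.
    split; first exact: (Hstar_in_feasible GX cX cxi xiT Wmu m0).
    rewrite [RHS](feasible_value GX cX cxi xiT Wmu m0).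
    by rewrite (sqexpE (Hstar_L2 Zc Zg mu)) (ip_Hstar Zc Zg m0).
  by move=> H' [fH' nH']; exact: (optimizer_ae GX cX cxi xiT Wmu m0 fH' nH').
split.
  rewrite WE; split; first by exists mu.
  split; first exact: (minimizer_weakly_compact Zc Zg).
  split; first exact: (minimizer_convex Zc Zg).
  (* The duality is replayed with [nu] in place of [mu]: any minimizer yields the same optimizer
     almost surely. *)
  move=> fe H [fH nH] nu Wnu; have m0 := m_gt0 nu fe.
  rewrite -(minimizer_sharp Zc Zg Wnu m0); congr (p01 nu _).
  apply/seteqP; split=> v /= [Iv h]; split=> //; move: h;
    by rewrite (optimizer_wH GX cX cxi xiT Wnu m0 fH nH Iv) lte_fin.
move=> fe H [fH nH] eps eps0; have m0 := m_gt0 mu fe.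
have [c [u0 [c0 u00 conc]]] := concentration Zc Zg Wmu m0 eps0.
have [u1 u10 lower] := above_lower Zc Zg Wmu m0 ltr01.
(* The supremum event is the complement of the good event of [concentration], by attainment of the
   supremum. *)
have E u : [set w | (eps%:E <= ereal_sup
      [set `|X (xi v) w / u - fine (wH P X H (xi v))|%:E | v in I01])%E] =
    ~` [set w | forall v, I01 v -> `|Z v w / u - ip P (Z v) (Hstar P Z mu)| < eps].
  have Ew w : [set `|X (xi v) w / u - fine (wH P X H (xi v))|%:E | v in I01] =
      [set (`|u^-1 * Z v w + -1 * ip P (Z v) (Hstar P Z mu)|)%:E | v in I01].
    have Ev v : I01 v -> `|X (xi v) w / u - fine (wH P X H (xi v))| =
        `|u^-1 * Z v w + -1 * ip P (Z v) (Hstar P Z mu)|.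
      move=> Iv; rewrite (optimizer_wH GX cX cxi xiT Wmu m0 fH nH Iv) /=.
      by rewrite mulN1r mulrC.
    by apply/seteqP; split=> _ [v Iv <-]; exists v => //; rewrite Ev.
  apply/funext => w; apply/propext; rewrite /= Ew.
  have cf : {within I01, continuous
      (fun v => `|u^-1 * Z v w + -1 * ip P (Z v) (Hstar P Z mu)|)}.
    apply: within_continuous_norm.
    exact: (@within_continuous_affine _ _ _ u^-1 (-1) (Zc w)
      (ip_Z_continuous Zc Zg (Hstar_L2 Zc Zg mu))).
  rewrite (ereal_sup_attained eps cf).
  by split=> h h'; apply: h => v Iv; have := h' v Iv; rewrite mulN1r mulrC.
have -> : (fun u => fine (P ([set w | (eps%:E <= ereal_sup
      [set `|X (xi v) w / u - fine (wH P X H (xi v))|%:E | v in I01])%E]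
      `&` [set w | forall v, I01 v -> u < X (xi v) w])) / fine (Psi u)) =
    (fun u => fine (P (~` [set w | forall v, I01 v ->
      `|Z v w / u - ip P (Z v) (Hstar P Z mu)| < eps] `&` above Z u)) / fine (P (above Z u))).
  by apply/funext => u; rewrite E.
apply: (@gaussian_ratio_cvg0 _ _ _ c (Num.max u0 u1)) => //.
- move=> u; rewrite ge_max => /andP[_ hu]; have := lower u hu.
  have fP : P (above Z u) \is a fin_num by exact: fin_num_measure.
  rewrite -(fineK fP) lee_fin => h; exists (fine (P (above Z u))) => //.
  by apply: lt_le_trans h; exact: expR_gt0.
- by move=> u; rewrite ge_max => /andP[hu _]; exact: conc.
Qed.
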